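(* Let $G$ be a finitely generated non-amenable group, let $B$ be a (finite or infinite) symmetric generating subset of $G$, and let $\mu\in\mathcal{P}_s(B)$ be a symmetric probability measure with support $B$. Assume that, in the Green metric $d_{\mathcal{G}}^\mu$, $\mu$ has a finite second moment, satisfies the second-moment deviation inequality and the locally uniform first-moment deviation inequality. Let $(\mu_t,\ t\in[0,1])$ be a curve in $\mathcal{P}(B)$ such that $\mu_0=\mu$ and, for all $a\in B$, the function $t\mapsto\log\mu_t(a)$ has a derivative at $t=0$, denoted $\nu(a)$. Assume that $\nu$ is bounded on $B$ and that $$\sup_{t\in(0,1]}\sup_{a\in B}\Big|\frac1t\log\frac{\mu_t(a)}{\mu_0(a)}-\nu(a)\Big|<\infty .$$ Then the limit of $\frac1t\big(h(\mu_t)-h(\mu)\big)$ as $t\to0$ exists, and it coincides with $$\sigma_{\mathcal{G}}(\nu,\mu):=\lim_{n\to\infty}\frac1n\,\mathbb{E}^\mu\Big[d_{\mathcal{G}}^\mu(id,Z_n)\Big(\sum_{j=1}^n\nu(X_j)\Big)\Big].$$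
   Context: $\mathcal{P}(B)$ (resp. $\mathcal{P}_s(B)$) is the set of probability measures (resp. symmetric probability measures, $\mu(x)=\mu(x^{-1})$) on $G$ with support equal to $B$. Random walk: under $\mathbb{P}^\mu$ (expectation $\mathbb{E}^\mu$), $X_1,X_2,\dots$ are i.i.d. of law $\mu$, $Z_0=id$, $Z_n=X_1\cdots X_n$. Entropy: $H(\mu)=\sum_{x\in G}(-\log\mu(x))\mu(x)$ and, when finite, $h(\mu)=\lim_n\frac1nH(\mu^n)$, $\mu^n$ being the $n$-th convolution power. Green metric of a symmetric measure $\mu$ whose support generates the non-amenable group $G$: $G^\mu(x)=\sum_{n\ge0}\mu^n(x)<\infty$ and $d_{\mathcal{G}}^\mu(x,y)=\log G^\mu(id)-\log G^\mu(x^{-1}y)$; it is a left-invariant metric on $G$. For a left-invariant metric $d$ with Gromov product $(x,y)_w=\frac12(d(w,x)+d(w,y)-d(x,y))$: finite second moment means $\sum_xd(id,x)^2\mu(x)<\infty$; second-moment deviation inequality means $\sup_{n,m\in\mathbb{N}}\mathbb{E}^\mu[(id,Z_{n+m})_{Z_n}^2]<\infty$; locally uniform first-moment deviation inequality means that there is $K>0$ such that $\sup_{\mu'}\sup_{n,m}\mathbb{E}^{\mu'}[(id,Z_{n+m})_{Z_n}]<\infty$, the supremum being over probability measures $\mu'$ on $G$ with $\mathbf{n}(\mu',\mu)\le K$, where $\mathbf{n}(\mu',\mu)=\sup_{a\in B}\max\big(\frac{\mu'(a)}{\mu(a)},\frac{\mu(a)}{\mu'(a)}\big)-1$ if $\mu'$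 has support $B$ and $\mathbf{n}(\mu',\mu)=\infty$ otherwise. *)

(* Defs.v *)
From HB Require Import structures.
From mathcomp Require Import all_boot all_order all_algebra.
From mathcomp Require Import all_classical all_reals all_analysis.

Set Implicit Arguments.
Unset Strict Implicit.
Unset Printing Implicit Defensive.

Import Order.TTheory GRing.Theory Num.Theory.
Import numFieldNormedType.Exports.

Local Open Scope classical_set_scope.
Local Open Scope ring_scope.

Section Groups.
Context {G : groupType}.

Definition is_subgroup (H : set G) : Prop :=
  [/\ H 1%g, forall x y, H x -> H y -> H (x * y)%g & forall x, H x -> H x^-1%g].

Definition generates (S : set G) : Prop :=
  forall H : set G, is_subgroup H -> S `<=` H -> H = setT.

Definition symmetric_set (S : set G) : Prop := forall x, S x -> S x^-1%g.

End Groups.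

Definition finitely_generated (G : groupType) : Prop :=
  exists2 S : set G, finite_set S & generates S.

(* Amenability of the discrete group G: there is a left-invariant, finitely
   additive probability defined on all subsets of G. *)
Definition amenable (R : realType) (G : groupType) : Prop :=
  exists m : set G -> R,
    [/\ forall A, 0 <= m A,
        m setT = 1,
        forall A B, A `&` B = set0 -> m (A `|` B) = m A + m B
      & forall g A, m [set (g * x)%g | x in A] = m A].

Section Walks.
Context {R : realType} {G : groupType}.
Implicit Types (mu nu : G -> R) (B : set G).

Definition prob_measure mu : Prop :=
  (forall x, 0 <= mu x) /\ (\esum_(x in [set: G]) (mu x)%:E = 1)%E.

Definition supp mu : set G := [set x | mu x != 0].

Definition prob_on B mu : Prop := prob_measure mu /\ supp mu = B.

Definition sym_prob_on B mu : Prop :=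
  prob_on B mu /\ forall x, mu x = mu x^-1%g.

Definition conv mu nu : G -> R :=
  fun x => fine (\esum_(y in [set: G]) (mu y * nu (y^-1 * x)%g)%:E).

Definition conv_pow mu (n : nat) : G -> R :=
  iter n (conv mu) (fun x => (x == 1%g)%:R).

(* The terms are nonnegative for a probability measure, and vanish outside the
   support since ln 0 = 0. *)
Definition entropy mu : \bar R :=
  (\esum_(x in [set: G]) (- ln (mu x) * mu x)%:E)%E.

Definition entropy_rate mu : (\bar R)^nat :=
  fun n => ((n%:R^-1)%:E * entropy (conv_pow mu n))%E.

Definition asymptotic_entropy mu : R := fine (limn (entropy_rate mu)).

(* A point x of G^n stands for the increments (X_1, ..., X_n); under P^mu it has
   probability mu(x_1) ... mu(x_n). *)
Definition path_prob mu (n : nat) (x : n.-tuple G) : R :=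
  \prod_(i < n) mu (tnth x i).

Definition walk (n : nat) (x : n.-tuple G) (k : nat) : G :=
  (\prod_(a <- take k x) a)%g.

(* \esum is a supremum of finite sums, hence meaningful for nonnegative terms
   only: the positive and negative parts are summed separately. *)
Definition expect mu (n : nat) (F : n.-tuple G -> R) : \bar R :=
  (\esum_(x in [set: n.-tuple G]) (path_prob mu x * Num.max (F x) 0)%:E
   - \esum_(x in [set: n.-tuple G]) (path_prob mu x * Num.max (- F x) 0)%:E)%E.

Definition green mu (x : G) : \bar R :=
  (\sum_(0 <= n <oo) (conv_pow mu n x)%:E)%E.

Definition green_dist mu (x y : G) : R :=
  ln (fine (green mu 1%g)) - ln (fine (green mu (x^-1 * y)%g)).

Implicit Type d : G -> G -> R.

Definition gromov d (w x y : G) : R := 2^-1 * (d w x + d w y - d x y).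

Definition finite_second_moment d mu : Prop :=
  (\esum_(x in [set: G]) (d 1%g x ^+ 2 * mu x)%:E < +oo)%E.

Definition second_moment_deviation d mu : Prop :=
  exists C : R, forall n m : nat,
    (expect mu (fun x : (n + m).-tuple G =>
       (gromov d (walk x n) 1%g (walk x (n + m)) ^+ 2)%R) <= C%:E)%E.

Definition ndist mu' mu : \bar R :=
  if `[< supp mu' = supp mu >] then
    (ereal_sup [set (Num.max (mu' a / mu a) (mu a / mu' a))%:E | a in supp mu]
     - 1)%E
  else +oo%E.

Definition locally_uniform_first_moment_deviation d mu : Prop :=
  exists2 K : R, 0 < K &
  exists C : R, forall mu', prob_measure mu' -> (ndist mu' mu <= K%:E)%E ->
    forall n m : nat,
    (expect mu' (fun x : (n + m).-tuple G =>
       gromov d (walk x n) 1%g (walk x (n + m))) <= C%:E)%E.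

Definition sigma_rate nu mu : (\bar R)^nat := fun n =>
  ((n%:R^-1)%:E *
   expect mu (fun x : n.-tuple G =>
     (green_dist mu 1%g (walk x n) * \sum_(j < n) nu (tnth x j))%R))%E.

Definition sigmaG nu mu : R := fine (limn (sigma_rate nu mu)).

End Walks.

(* Main.v *)
(* Let d be the Green metric of mu, and compare the entropy h(mu') of a
   bounded perturbation mu' of mu with the speed l(mu') of its walk in d.
   By non-amenability mu^n(x) decays exponentially (Kesten), so that only about
   d(1,x) terms matter in the Green function and, up to a factor exp(-e d(1,x)),
   it is dominated by a normalised sum of lam^k mu^k(x) with lam < 1; Gibbs'
   inequality then gives h(mu') <= l(mu').  Conversely mu^n <= G and Jensen's
   inequality give l(mu') <= h(mu') + chi^2(mu'|mu).  Since
   chi^2(mu_t|mu) = O(t^2), h and l have the same derivative at t = 0.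

   For the speed, a_n(t) = E^{mu_t} d(1,Z_n) is almost additive in n, uniformly in
   t, by the first-moment deviation inequality, so a_n(t)/n = l(mu_t) + O(1/n).
   On the other hand, expanding the likelihood ratio of the first n steps to
   first order and using Var d(1,Z_n) = O(n) along n = 2^k (second-moment
   deviation inequality), the difference quotient of a_n/n at 0 differs from
   E^mu[d(1,Z_n) sum_j nu(X_j)]/n by O(sqrt n t) + o(1).  Taking n of order
   t^(-3/2) makes both 1/(n t) and sqrt n t tend to 0. *)
Require Import Defs.
From mathcomp Require Import all_boot all_order all_algebra.
From mathcomp Require Import all_classical all_reals all_analysis.
From mathcomp Require Import ring lra.
Import Order.TTheory GRing.Theory Num.Theory.
Import numFieldNormedType.Exports.
Set Implicit Arguments.
Unset Strict Implicit.
Unset Printing Implicit Defensive.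
Local Open Scope classical_set_scope.
Local Open Scope ring_scope.

(** The limit in [n] and the derivative at [t = 0] cannot be exchanged at a fixed time: the error
    [O(1/n)] in the speed is divided by [t]. Hence [n] must depend on [t], with [n t] tending to
    infinity. This is what makes the variance decisive. Controlling the length by its second moment,
    of order [n^2], would replace the error [sqrt n t] by [n t], which contradicts that requirement.
    With a variance of order [n], any [n] of order [t^(-s)] with [1 < s < 2] is admissible, and
    [3/2] is the midpoint. The variance recursion only doubles times, so [n] is taken to be a power
    of two; this costs a factor 2 in the choice of [n]. At [t = 0] the chi-square term vanishes, so
    the two comparisons force entropy and speed of [mu] itself to coincide, and one sandwich serves
    both ends of the difference quotient. Since the support may be infinite, the linearisation of
    the density is not uniform in the letter; bounded logarithmic quotients give a uniform bound on
    its error, and dominated convergence then gives smallness in mean square. *)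

(** * Absolutely summable real families on an arbitrary index type *)

Section AbsoluteSums.
Context {R : realType}.
Implicit Types T U : choiceType.

Definition asummable {T : choiceType} (f : T -> R) : Prop :=
  (\esum_(x in [set: T]) (`|f x|)%:E < +oo)%E.

(** [fine] sends an infinite part to [0], so the value is meaningful only under [asummable]. The two
    parts are kept separate as in [expect]. *)
Definition tsum {T : choiceType} (f : T -> R) : R :=
  fine (\esum_(x in [set: T]) (Num.max (f x) 0)%:E)
  - fine (\esum_(x in [set: T]) (Num.max (- f x) 0)%:E).

Lemma posr_ge0 (x : R) : 0 <= Num.max x 0.
Proof. by rewrite le_max lexx orbT. Qed.

Lemma posr_sub (x : R) : Num.max x 0 - Num.max (- x) 0 = x.
Proof. by have [h|h] := leP x 0; [rewrite max_l|rewrite max_r]; lra. Qed.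

Lemma norm_posr (x : R) : `|Num.max x 0| <= `|x|.
Proof. by have [h|h] := leP x 0; rewrite ?normr0. Qed.

Lemma norm_posrN (x : R) : `|Num.max (- x) 0| <= `|x|.
Proof. by rewrite -(normrN x) norm_posr. Qed.

Hint Resolve posr_ge0 norm_posr norm_posrN : core.

Lemma eq_tsum T (f g : T -> R) : f =1 g -> tsum f = tsum g.
Proof. by move=> /funext ->. Qed.

Lemma eq_asummable T (f g : T -> R) : f =1 g -> asummable f -> asummable g.
Proof. by move=> /funext ->. Qed.

Lemma le_asummable T (f g : T -> R) :
  (forall x, `|f x| <= `|g x|) -> asummable g -> asummable f.
Proof.
move=> fg; apply: le_lt_trans; apply: le_esum => x _.
by rewrite lee_fin.
Qed.

Lemma asummable_norm T (f : T -> R) : asummable f -> asummable (fun x => `|f x|).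
Proof. by apply: le_asummable => x; rewrite normr_id. Qed.

Lemma asummableN T (f : T -> R) : asummable f -> asummable (fun x => - f x).
Proof. by apply: le_asummable => x; rewrite normrN. Qed.

Lemma asummableD T (f g : T -> R) :
  asummable f -> asummable g -> asummable (fun x => f x + g x).
Proof.
move=> hf hg; apply: le_lt_trans (lte_add_pinfty hf hg).
rewrite -esumD; [|by move=> *; rewrite lee_fin..].
by apply: le_esum => x _; rewrite -EFinD lee_fin ler_normD.
Qed.

Lemma asummableB T (f g : T -> R) :
  asummable f -> asummable g -> asummable (fun x => f x - g x).
Proof. by move=> hf /asummableN; apply: asummableD. Qed.

(** Natural multiples are summable by repeated addition, and [c * f] is dominated by the multiple
    with a natural number above the absolute value of [c]. *)
Lemma asummableZ T (c : R) (f : T -> R) :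
  asummable f -> asummable (fun x => c * f x).
Proof.
move=> hf.
have hn n : asummable (fun x => n%:R * f x).
  elim: n => [|n ih].
    by apply: le_asummable hf => x; rewrite mul0r normr0.
  apply: eq_asummable (asummableD ih hf) => x /=.
  by rewrite -natr1 mulrDl mul1r.
apply: le_asummable (hn (Num.truncn `|c|).+1) => x.
rewrite !normrM ler_wpM2r// [leRHS]ger0_norm//.
by apply: ltW; apply: truncnS_gt.
Qed.

Lemma ge0_tsumE T (f : T -> R) : (forall x, 0 <= f x) ->
  tsum f = fine (\esum_(x in [set: T]) (f x)%:E).
Proof.
move=> f0; rewrite /tsum [X in _ - fine X]esum1 ?subr0.
  by congr fine; apply: eq_esum => x _; rewrite max_l.
by move=> x _; rewrite max_r// oppr_le0.
Qed.

Lemma ge0_esumE T (f : T -> R) : (forall x, 0 <= f x) -> asummable f ->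
  \esum_(x in [set: T]) (f x)%:E = (tsum f)%:E.
Proof.
move=> f0 hf; rewrite ge0_tsumE// fineK// ge0_fin_numE.
  apply: le_lt_trans hf; apply: le_esum => x _; rewrite lee_fin.
  exact: ler_norm.
by apply: esum_ge0 => x _; rewrite lee_fin.
Qed.

Lemma ge0_asummable T (f : T -> R) : (forall x, 0 <= f x) ->
  (\esum_(x in [set: T]) (f x)%:E < +oo)%E -> asummable f.
Proof.
move=> f0; apply: le_lt_trans; apply: le_esum => x _.
by rewrite lee_fin ger0_norm.
Qed.

Lemma tsum_ge0 T (f : T -> R) : (forall x, 0 <= f x) -> 0 <= tsum f.
Proof.
move=> f0; rewrite ge0_tsumE//; apply: fine_ge0; apply: esum_ge0 => x _.
by rewrite lee_fin.
Qed.

Lemma tsum0 T : tsum (fun _ : T => 0) = 0.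
Proof. by rewrite ge0_tsumE// esum1. Qed.

Lemma ge0_tsumD T (f g : T -> R) :
  (forall x, 0 <= f x) -> (forall x, 0 <= g x) ->
  asummable f -> asummable g ->
  tsum (fun x => f x + g x) = tsum f + tsum g.
Proof.
move=> f0 g0 hf hg; apply: EFin_inj.
rewrite [RHS]EFinD -(ge0_esumE f0 hf) -(ge0_esumE g0 hg) -ge0_esumE; last 2 first.
- by move=> x; rewrite addr_ge0.
- exact: asummableD.
rewrite -esumD; [|by move=> *; rewrite lee_fin..].
by apply: eq_esum => x _; rewrite EFinD.
Qed.

Lemma ge0_tsumB T (f g : T -> R) :
  (forall x, 0 <= f x) -> (forall x, 0 <= g x) ->
  asummable f -> asummable g ->
  tsum (fun x => f x - g x) = tsum f - tsum g.
Proof.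
move=> f0 g0 hf hg.
pose p x := Num.max (f x - g x) 0; pose n x := Num.max (- (f x - g x)) 0.
have p0 x : 0 <= p x by rewrite le_max lexx orbT.
have n0 x : 0 <= n x by rewrite le_max lexx orbT.
have hp : asummable p.
  by apply: le_asummable (asummableB hf hg) => x; exact: norm_posr.
have hn : asummable n.
  by apply: le_asummable (asummableB hf hg) => x; exact: norm_posrN.
(* The identity [p - n = f - g] is rearranged so that only sums of nonnegative families occur, where
   additivity is already known. *)
have : tsum (fun x => p x + g x) = tsum (fun x => n x + f x).
  by apply: eq_tsum => x; have := posr_sub (f x - g x); rewrite /p /n; lra.
rewrite (ge0_tsumD p0 g0 hp hg) (ge0_tsumD n0 f0 hn hf) => E.
have -> : tsum (fun x => f x - g x) = tsum p - tsum n.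
  by rewrite [LHS]/tsum (ge0_tsumE p0) (ge0_tsumE n0).
lra.
Qed.

Lemma tsumE T (f : T -> R) : asummable f ->
  tsum f = tsum (fun x => Num.max (f x) 0) - tsum (fun x => Num.max (- f x) 0).
Proof.
move=> hf; rewrite -ge0_tsumB//; first by apply: eq_tsum => x; rewrite posr_sub.
- exact: le_asummable hf.
- exact: le_asummable hf.
Qed.

Lemma tsumN T (f : T -> R) : tsum (fun x => - f x) = - tsum f.
Proof.
rewrite /tsum opprB; congr (_ - fine _); apply: eq_esum => x _.
by rewrite opprK.
Qed.

Lemma tsumD T (f g : T -> R) : asummable f -> asummable g ->
  tsum (fun x => f x + g x) = tsum f + tsum g.
Proof.
move=> hf hg; rewrite (tsumE hf) (tsumE hg).
have a1 h : asummable h -> asummable (fun x : T => Num.max (h x) 0).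
  exact: le_asummable.
have a2 h : asummable h -> asummable (fun x : T => Num.max (- h x) 0).
  exact: le_asummable.
transitivity (tsum (fun x => (Num.max (f x) 0 + Num.max (g x) 0)
   - (Num.max (- f x) 0 + Num.max (- g x) 0))).
  apply: eq_tsum => x; have := posr_sub (f x); have := posr_sub (g x); lra.
rewrite ge0_tsumB; first (rewrite !ge0_tsumD//; first lra).
- exact: a2.
- exact: a2.
- exact: a1.
- exact: a1.
- by move=> x; rewrite addr_ge0.
- by move=> x; rewrite addr_ge0.
- by apply: asummableD; apply: a1.
- by apply: asummableD; apply: a2.
Qed.

Lemma tsumB T (f g : T -> R) : asummable f -> asummable g ->
  tsum (fun x => f x - g x) = tsum f - tsum g.
Proof. by move=> hf hg; rewrite tsumD ?tsumN//; apply: asummableN. Qed.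

Lemma le_tsum T (f g : T -> R) : asummable f -> asummable g ->
  (forall x, f x <= g x) -> tsum f <= tsum g.
Proof.
move=> hf hg fg; rewrite -subr_ge0 -tsumB//; apply: tsum_ge0 => x.
by rewrite subr_ge0.
Qed.

Lemma ler_norm_tsum T (f : T -> R) : asummable f ->
  `|tsum f| <= tsum (fun x => `|f x|).
Proof.
move=> hf; have hn := asummable_norm hf.
rewrite ler_norml -tsumN; apply/andP; split; apply: le_tsum => //.
- exact: asummableN.
- by move=> x; rewrite lerNl ler_normr lexx orbT.
- by move=> x; exact: ler_norm.
Qed.

Lemma tsum_cst0 T (f : T -> R) : (forall x, f x = 0) -> tsum f = 0.
Proof. by move=> f0; rewrite (eq_tsum f0) tsum0. Qed.

Lemma ge0_tsumZ T (c : R) (f : T -> R) : 0 <= c -> (forall x, 0 <= f x) ->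
  asummable f -> tsum (fun x => c * f x) = c * tsum f.
Proof.
move=> c0 f0 hf.
have le (a : R) g : 0 <= a -> (forall x : T, 0 <= g x) -> asummable g ->
    a * tsum g <= tsum (fun x => a * g x).
  move=> a0 g0 hg; have [->|an0] := eqVneq a 0.
    by rewrite mul0r; apply: tsum_ge0 => x; rewrite mul0r.
  have apos : 0 < a by rewrite lt_neqAle eq_sym an0.
  have fin : (tsum (fun x => a * g x))%:E =
      \esum_(x in [set: T]) (a * g x)%:E.
    rewrite ge0_esumE//; last exact: asummableZ.
    by move=> x; rewrite mulr_ge0.
  rewrite -ler_pdivlMl// -lee_fin -(ge0_esumE g0 hg).
  apply: ge_ereal_sup => _ [X [finX _] <-].
  rewrite fsbig_finite//= sumEFin lee_fin ler_pdivlMl//.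
  rewrite -lee_fin fin; apply: esum_ge; exists X => //.
  by rewrite fsbig_finite//= sumEFin lee_fin mulr_sumr.
apply/eqP; rewrite eq_le le// andbT.
have [->|cn0] := eqVneq c 0.
  rewrite mul0r (_ : tsum _ = 0)//; apply: tsum_cst0 => x; exact: mul0r.
have cpos : 0 < c by rewrite lt_neqAle eq_sym cn0.
(* The reverse inequality is [le] again, for the factor [c^-1] and the family [c * f]. *)
rewrite -ler_pdivrMl//; apply: le_trans (le _ _ _ _ _) _.
- by rewrite invr_ge0.
- by move=> x; rewrite mulr_ge0.
- exact: asummableZ.
by rewrite (eq_tsum (g := f))// => x; rewrite mulKf.
Qed.

Lemma tsumZ T (c : R) (f : T -> R) : asummable f ->
  tsum (fun x => c * f x) = c * tsum f.
Proof.
move=> hf.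
have a1 : asummable (fun x : T => Num.max (f x) 0).
  exact: le_asummable hf.
have a2 : asummable (fun x : T => Num.max (- f x) 0).
  exact: le_asummable hf.
have pos (a : R) : 0 <= a -> tsum (fun x => a * f x) = a * tsum f.
  move=> a0; rewrite (tsumE hf) mulrBr -!ge0_tsumZ//.
  rewrite -tsumB; [|exact: asummableZ..].
  by apply: eq_tsum => x; rewrite -mulrBr posr_sub.
have [c0|c0] := leP 0 c; first exact: pos.
rewrite -[RHS]opprK -mulNr -pos; last lra.
by rewrite -tsumN; apply: eq_tsum => x; rewrite mulNr opprK.
Qed.

Lemma asummable_bij T U (e : T -> U) (f : U -> R) : bijective e ->
  asummable f -> asummable (fun x => f (e x)).
Proof.
move=> be; rewrite /asummable (reindex_esum setT _ e)//.
by rewrite setTT_bijective.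
Qed.

Lemma tsum_bij T U (e : T -> U) (f : U -> R) : bijective e ->
  tsum f = tsum (fun x => f (e x)).
Proof.
move=> be; rewrite /tsum; congr (fine _ - fine _);
  by apply: reindex_esum; rewrite setTT_bijective.
Qed.

Lemma ge_sum_tsum T (f : T -> R) (s : seq T) : uniq s ->
  (forall x, 0 <= f x) -> asummable f -> \sum_(x <- s) f x <= tsum f.
Proof.
move=> us f0 hf; rewrite -lee_fin -ge0_esumE//; apply: esum_ge.
exists [set` s]; first by split => //; exact: finite_seq.
by rewrite -fsbig_seq//= sumEFin.
Qed.

Lemma ge_term_tsum T (f : T -> R) (x : T) :
  (forall x, 0 <= f x) -> asummable f -> f x <= tsum f.
Proof.
by move=> f0 hf; have := @ge_sum_tsum _ f [:: x] isT f0 hf; rewrite big_seq1.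
Qed.

Lemma tsum_approx T (f : T -> R) (e : R) : 0 < e ->
  (forall x, 0 <= f x) -> asummable f ->
  exists2 s : seq T, uniq s & tsum f - e < \sum_(x <- s) f x.
Proof.
move=> e0 f0 hf.
have : ((tsum f - e)%:E < \esum_(x in [set: T]) (f x)%:E)%E.
  by rewrite ge0_esumE// lte_fin ltrBlDr ltrDl.
move=> /ereal_sup_gt[_ [X [finX _] <-]].
rewrite fsbig_finite//= sumEFin lte_fin => h.
by exists (finmap.enum_fset (fset_set X)).
Qed.

Lemma asummable_le_sum T (f : T -> R) (C : R) : (forall x, 0 <= f x) ->
  (forall s : seq T, uniq s -> \sum_(x <- s) f x <= C) -> asummable f.
Proof.
move=> f0 h; apply: ge0_asummable => //.
apply: (@le_lt_trans _ _ C%:E); last exact: ltry.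
apply: ge_ereal_sup => _ [X [finX _] <-].
by rewrite fsbig_finite//= sumEFin lee_fin h// fset_uniq.
Qed.

Lemma tsum_delta T (f : T -> R) (a : T) : (forall x, x != a -> f x = 0) ->
  asummable f /\ tsum f = f a.
Proof.
move=> f0.
have E (g : T -> \bar R) : (forall x, x != a -> g x = 0%E) -> (0 <= g a)%E ->
   \esum_(x in [set: T]) g x = g a.
  move=> g0 ga; rewrite -(esum_set1 ga) [RHS]esum_mkcond; apply: eq_esum => x _.
  have [->|xa] := eqVneq x a; first by rewrite mem_set.
  by rewrite g0// memNset//; apply/eqP.
split.
  by rewrite /asummable E ?ltry// => x /f0 ->; rewrite normr0.
rewrite /tsum !E /=; first exact: posr_sub.
- by move=> x /f0 ->; rewrite oppr0 maxxx.
- by rewrite lee_fin.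
- by move=> x /f0 ->; rewrite maxxx.
- by rewrite lee_fin.
Qed.

(** * Tonelli and Fubini for sums over pairs *)

Section Pairs.
Context {T U : choiceType}.
Implicit Types (f : T * U -> R).

Lemma esum_pair (a : T * U -> \bar R) : (forall z, 0 <= a z)%E ->
  (\esum_(z in [set: T * U]) a z =
   \esum_(x in [set: T]) \esum_(y in [set: U]) a (x, y))%E.
Proof.
move=> a0; rewrite (@esum_esum _ _ _ setT (fun=> setT) (fun x y => a (x, y)))//.
rewrite (_ : setT `*`` _ = setT); last by apply/seteqP; split => -[].
by apply: eq_esum => -[].
Qed.

Lemma asummable_row f x : asummable f -> asummable (fun y => f (x, y)).
Proof.
rewrite /asummable esum_pair => [|z]; last by rewrite lee_fin.
apply: le_lt_trans; rewrite -(@esum_set1 _ _ x (fun x => \esum_(y in setT) `|f (x, y)|%:E)).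
  rewrite [leLHS]esum_mkcond; apply: le_esum => z _; case: ifP => // _.
  by apply: esum_ge0 => y _; rewrite lee_fin.
by apply: esum_ge0 => y _; rewrite lee_fin.
Qed.

Lemma asummable_pairP f : (forall x, asummable (fun y => f (x, y))) ->
  asummable (fun x => tsum (fun y => `|f (x, y)|)) <-> asummable f.
Proof.
move=> hr; rewrite /asummable [X in _ <-> (X < _)%E]esum_pair; last first.
  by move=> z; rewrite lee_fin.
set a := (X in (X < _)%E <-> _); set b := (X in _ <-> (X < _)%E).
suff -> : a = b by [].
apply: eq_esum => x _; rewrite ge0_esumE//; last exact/asummable_norm/hr.
by rewrite ger0_norm//; apply: tsum_ge0.
Qed.

Lemma asummable_pair f : (forall x, asummable (fun y => f (x, y))) ->
  asummable (fun x => tsum (fun y => `|f (x, y)|)) -> asummable f.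
Proof. by move=> hr; rewrite asummable_pairP. Qed.

Lemma asummable_tsum_norm f : asummable f ->
  asummable (fun x => tsum (fun y => `|f (x, y)|)).
Proof. by move=> hf; rewrite asummable_pairP// => x; exact: asummable_row. Qed.

Lemma asummable_tsum f : asummable f -> asummable (fun x => tsum (fun y => f (x, y))).
Proof.
move=> hf; apply: le_asummable (asummable_tsum_norm hf) => x.
rewrite [leRHS]ger0_norm; last exact: tsum_ge0.
exact/ler_norm_tsum/asummable_row.
Qed.

Lemma tsum_pair f : asummable f -> tsum f = tsum (fun x => tsum (fun y => f (x, y))).
Proof.
have pos (g : T * U -> R) : (forall z, 0 <= g z) -> asummable g ->
    tsum g = tsum (fun x => tsum (fun y => g (x, y))).
  move=> g0 hg; apply: EFin_inj; rewrite -(ge0_esumE g0 hg) -ge0_esumE; last 2 first.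
  - by move=> x; apply: tsum_ge0.
  - exact: asummable_tsum.
  rewrite esum_pair; last by move=> z; rewrite lee_fin.
  by apply: eq_esum => x _; rewrite ge0_esumE//; exact: asummable_row.
move=> hf; rewrite (tsumE hf).
have a1 : asummable (fun x => Num.max (f x) 0).
  exact: le_asummable hf.
have a2 : asummable (fun x => Num.max (- f x) 0).
  exact: le_asummable hf.
rewrite pos// [X in _ - X]pos//.
rewrite -tsumB; [|exact: (asummable_tsum a1)|exact: (asummable_tsum a2)].
by apply: eq_tsum => x; rewrite [RHS]tsumE//; exact: asummable_row.
Qed.

Lemma asummable_swap f : asummable f -> asummable (fun z : U * T => f (z.2, z.1)).
Proof.
apply: (@asummable_bij _ _ (fun z : U * T => (z.2, z.1))).
by exists (fun z => (z.2, z.1)) => -[].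
Qed.

End Pairs.

Lemma tsum_exchange T U (f : T -> U -> R) :
  asummable (fun z : T * U => f z.1 z.2) ->
  tsum (fun x => tsum (f x)) = tsum (fun y => tsum (f ^~ y)).
Proof.
move=> hf; rewrite -(tsum_pair hf) -(tsum_pair (asummable_swap hf)).
apply: (@tsum_bij _ _ (fun z : U * T => (z.2, z.1)) (fun z => f z.1 z.2)).
by exists (fun z => (z.2, z.1)) => -[].
Qed.

Lemma asummableM T U (f : T -> R) (g : U -> R) : asummable f -> asummable g ->
  asummable (fun z : T * U => f z.1 * g z.2).
Proof.
move=> hf hg; apply: asummable_pair => [x|]; first exact: (asummableZ (f x) hg).
apply: eq_asummable (asummableZ (tsum (fun y => `|g y|)) (asummable_norm hf)) => x /=.
rewrite mulrC -tsumZ; last exact: asummable_norm.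
by apply: eq_tsum => y; rewrite normrM.
Qed.

Lemma tsumM T U (f : T -> R) (g : U -> R) : asummable f -> asummable g ->
  tsum (fun z : T * U => f z.1 * g z.2) = tsum f * tsum g.
Proof.
move=> hf hg; rewrite tsum_pair; last exact: asummableM.
rewrite mulrC -tsumZ//; apply: eq_tsum => x /=.
by rewrite tsumZ// mulrC.
Qed.

End AbsoluteSums.

(** * Expectations under a discrete weight, L2 inequalities, product weights *)

Section Expectations.
Context {R : realType}.
Implicit Types T U : choiceType.

Definition is_prob {T : choiceType} (p : T -> R) : Prop :=
  [/\ forall x, 0 <= p x, asummable p & tsum p = 1].

Definition integ {T : choiceType} (p f : T -> R) : Prop :=
  asummable (fun x => p x * f x).

Definition Ex {T : choiceType} (p f : T -> R) : R :=
  tsum (fun x => p x * f x).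

Lemma eq_Ex T (p f g : T -> R) : (forall x, p x != 0 -> f x = g x) ->
  Ex p f = Ex p g.
Proof.
move=> fg; apply: eq_tsum => x.
by have [->|/fg ->//] := eqVneq (p x) 0; rewrite !mul0r.
Qed.

Lemma le_integ T (p f g : T -> R) : (forall x, p x != 0 -> `|f x| <= `|g x|) ->
  integ p g -> integ p f.
Proof.
move=> fg; apply: le_asummable => x; rewrite !normrM.
have [->|/fg h] := eqVneq (p x) 0; first by rewrite normr0 !mul0r.
by rewrite ler_wpM2l.
Qed.

Lemma integD T (p f g : T -> R) : integ p f -> integ p g ->
  integ p (fun x => f x + g x).
Proof.
by move=> hf hg; apply: eq_asummable (asummableD hf hg) => x; rewrite mulrDr.
Qed.

Lemma integN T (p f : T -> R) : integ p f -> integ p (fun x => - f x).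
Proof. by move=> hf; apply: eq_asummable (asummableN hf) => x; rewrite mulrN. Qed.

Lemma integB T (p f g : T -> R) : integ p f -> integ p g ->
  integ p (fun x => f x - g x).
Proof. by move=> hf hg; apply: integD => //; apply: integN. Qed.

Lemma integZ T (p : T -> R) c f : integ p f -> integ p (fun x => c * f x).
Proof. by move=> hf; apply: eq_asummable (asummableZ c hf) => x; rewrite mulrCA. Qed.

Lemma integ_norm T (p f : T -> R) : integ p f -> integ p (fun x => `|f x|).
Proof. by apply: le_integ => x; rewrite normr_id. Qed.

Lemma ExD T (p f g : T -> R) : integ p f -> integ p g ->
  Ex p (fun x => f x + g x) = Ex p f + Ex p g.
Proof. by move=> hf hg; rewrite -tsumD//; apply: eq_tsum => x; rewrite mulrDr. Qed.

Lemma ExB T (p f g : T -> R) : integ p f -> integ p g ->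
  Ex p (fun x => f x - g x) = Ex p f - Ex p g.
Proof. by move=> hf hg; rewrite -tsumB//; apply: eq_tsum => x; rewrite mulrBr. Qed.

Lemma ExZ T (p : T -> R) c f : integ p f ->
  Ex p (fun x => c * f x) = c * Ex p f.
Proof. by move=> hf; rewrite -tsumZ//; apply: eq_tsum => x; rewrite mulrCA. Qed.

Lemma le_Ex T (p f g : T -> R) : (forall x, 0 <= p x) ->
  integ p f -> integ p g -> (forall x, p x != 0 -> f x <= g x) ->
  Ex p f <= Ex p g.
Proof.
move=> p0 hf hg fg; apply: le_tsum => // x.
have [->|/fg h] := eqVneq (p x) 0; first by rewrite !mul0r.
exact: ler_wpM2l.
Qed.

Lemma Ex_ge0 T (p f : T -> R) : (forall x, 0 <= p x) ->
  (forall x, p x != 0 -> 0 <= f x) -> 0 <= Ex p f.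
Proof.
move=> p0 f0; apply: tsum_ge0 => x.
have [->|/f0 h] := eqVneq (p x) 0; first by rewrite !mul0r.
exact: mulr_ge0.
Qed.

Lemma integ_cst T (p : T -> R) c : asummable p -> integ p (fun=> c).
Proof. by move=> hp; apply: eq_asummable (asummableZ c hp) => x; rewrite mulrC. Qed.

Lemma integ_bounded T (p f : T -> R) C : asummable p ->
  (forall x, p x != 0 -> `|f x| <= C) -> integ p f.
Proof.
move=> hp fC; apply: le_integ (integ_cst C hp) => x /fC h.
by rewrite (le_trans h)// ler_norm.
Qed.

Lemma Ex_cst T (p : T -> R) c : is_prob p -> Ex p (fun=> c) = c.
Proof.
move=> [p0 hp p1]; rewrite -[RHS]mulr1 -p1 -tsumZ//.
by apply: eq_tsum => x; rewrite mulrC.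
Qed.

Lemma integ_le_sqr T (p f : T -> R) : asummable p ->
  integ p (fun x => f x ^+ 2) -> integ p f.
Proof.
move=> hp hf; apply: le_integ (integD (integ_cst 1 hp) hf) => x _.
rewrite [leRHS]ger0_norm; last by rewrite addr_ge0// sqr_ge0.
by rewrite ler_norml; apply/andP; split; nra.
Qed.

Lemma integM T (p f g : T -> R) : integ p (fun x => f x ^+ 2) ->
  integ p (fun x => g x ^+ 2) -> integ p (fun x => f x * g x).
Proof.
move=> hf hg; apply: le_integ (integD hf hg) => x _.
rewrite [leRHS]ger0_norm; last by rewrite addr_ge0// sqr_ge0.
by rewrite ler_norml; apply/andP; split; nra.
Qed.

Lemma integ_sqrD T (p f g : T -> R) : integ p (fun x => f x ^+ 2) ->
  integ p (fun x => g x ^+ 2) -> integ p (fun x => (f x + g x) ^+ 2).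
Proof.
move=> hf hg; apply: le_integ (integZ 2 (integD hf hg)) => x _.
rewrite !ger0_norm; first 1 last.
- by rewrite mulr_ge0// addr_ge0// sqr_ge0.
- exact: sqr_ge0.
rewrite -subr_ge0 (_ : _ - _ = (f x - g x) ^+ 2); last by ring.
exact: sqr_ge0.
Qed.

Lemma integ_sqrZ T (p f : T -> R) c : integ p (fun x => f x ^+ 2) ->
  integ p (fun x => (c * f x) ^+ 2).
Proof.
move=> hf; apply: le_integ (integZ (c ^+ 2) hf) => x _.
by rewrite exprMn.
Qed.

Lemma integ_sqrN T (p f : T -> R) : integ p (fun x => f x ^+ 2) ->
  integ p (fun x => (- f x) ^+ 2).
Proof. by move=> hf; apply: le_integ hf => x _; rewrite sqrrN. Qed.

Lemma integ_sqrB T (p f g : T -> R) : integ p (fun x => f x ^+ 2) ->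
  integ p (fun x => g x ^+ 2) -> integ p (fun x => (f x - g x) ^+ 2).
Proof. by move=> hf /integ_sqrN hg; apply: (integ_sqrD hf hg). Qed.

Lemma Ex_sqrD T (p f g : T -> R) : integ p (fun x => f x ^+ 2) ->
  integ p (fun x => g x ^+ 2) ->
  Ex p (fun x => (f x + g x) ^+ 2) = Ex p (fun x => f x ^+ 2)
    + 2 * Ex p (fun x => f x * g x) + Ex p (fun x => g x ^+ 2).
Proof.
move=> hf hg; have hfg := integM hf hg.
rewrite -ExZ// -ExD//; last exact: integZ.
rewrite -ExD//; last by apply: integD => //; exact: integZ.
by apply: eq_Ex => x _; ring.
Qed.

Lemma cauchy_schwarz T (p f g : T -> R) : (forall x, 0 <= p x) ->
  integ p (fun x => f x ^+ 2) -> integ p (fun x => g x ^+ 2) ->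
  Ex p (fun x => f x * g x) ^+ 2
    <= Ex p (fun x => f x ^+ 2) * Ex p (fun x => g x ^+ 2).
Proof.
move=> p0 hf hg.
set a := Ex p (fun x => f x ^+ 2); set b := Ex p _; set c := Ex p _.
have a0 : 0 <= a by apply: Ex_ge0 => // x _; exact: sqr_ge0.
have c0 : 0 <= c by apply: Ex_ge0 => // x _; exact: sqr_ge0.
have q t : 0 <= a + 2 * (t * b) + t ^+ 2 * c.
  have -> : a + 2 * (t * b) + t ^+ 2 * c = Ex p (fun x => (f x + t * g x) ^+ 2).
    rewrite Ex_sqrD//; last exact: integ_sqrZ.
    rewrite -(ExZ t); last exact: integM.
    rewrite -(ExZ (t ^+ 2) hg); congr (_ + 2 * _ + _).
      by apply: eq_Ex => x _; ring.
    by apply: eq_Ex => x _; ring.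
  by apply: Ex_ge0 => // x _; exact: sqr_ge0.
have [c00|cn0] := eqVneq c 0.
  (* For [c = 0] the affine function [a + 2 t b] is nonnegative for every [t], which forces [b = 0]:
     otherwise this [t] would give the value [-1]. *)
  have := q (- (a + 1) / (2 * b)); rewrite c00 !mulr0 addr0.
  have [->|bn0 h] := eqVneq b 0; first by rewrite expr2 mul0r.
  exfalso; move: h.
  have -> : 2 * (- (a + 1) / (2 * b) * b) = - (a + 1) by field.
  by lra.
have cp : 0 < c by rewrite lt_neqAle eq_sym cn0.
have := q (- b / c).
have -> : a + 2 * (- b / c * b) + (- b / c) ^+ 2 * c = (a * c - b ^+ 2) / c.
  by field.
by rewrite pmulr_lge0 ?invr_gt0// subr_ge0.
Qed.

Lemma cauchy_schwarz_sqrt T (p f g : T -> R) : (forall x, 0 <= p x) ->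
  integ p (fun x => f x ^+ 2) -> integ p (fun x => g x ^+ 2) ->
  `|Ex p (fun x => f x * g x)|
    <= Num.sqrt (Ex p (fun x => f x ^+ 2)) * Num.sqrt (Ex p (fun x => g x ^+ 2)).
Proof.
move=> p0 hf hg; rewrite -sqrtrM; last by apply: Ex_ge0 => // x _; exact: sqr_ge0.
by rewrite -sqrtr_sqr ler_wsqrtr// cauchy_schwarz.
Qed.

Lemma minkowski T (p f g : T -> R) : (forall x, 0 <= p x) ->
  integ p (fun x => f x ^+ 2) -> integ p (fun x => g x ^+ 2) ->
  Num.sqrt (Ex p (fun x => (f x + g x) ^+ 2)) <=
  Num.sqrt (Ex p (fun x => f x ^+ 2)) + Num.sqrt (Ex p (fun x => g x ^+ 2)).
Proof.
move=> p0 hf hg; have := cauchy_schwarz_sqrt p0 hf hg.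
have := @Ex_sqrD _ p f g hf hg.
set a := Ex p (fun x => f x ^+ 2); set b := Ex p _; set c := Ex p _.
set d := Ex p (fun x => g x ^+ 2) => hb hc.
have a0 : 0 <= a by apply: Ex_ge0 => // x _; exact: sqr_ge0.
have d0 : 0 <= d by apply: Ex_ge0 => // x _; exact: sqr_ge0.
rewrite -[leRHS]ger0_norm; last by rewrite addr_ge0// sqrtr_ge0.
rewrite -sqrtr_sqr ler_wsqrtr// sqrrD !sqr_sqrtr// hb.
by have := ler_norm c; rewrite -mulr_natl; lra.
Qed.

Lemma sqr_Ex_le T (p f : T -> R) : is_prob p -> integ p (fun x => f x ^+ 2) ->
  Ex p f ^+ 2 <= Ex p (fun x => f x ^+ 2).
Proof.
move=> hp hf; have [p0 ps p1] := hp.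
have h1 : integ p (fun x => 1 ^+ 2) by apply: integ_cst.
have := cauchy_schwarz p0 hf h1.
rewrite (Ex_cst _ hp) expr1n mulr1 => h.
by rewrite (@eq_Ex _ p f (fun x => f x * 1))// => x _; rewrite mulr1.
Qed.

Definition prodw {T U : choiceType} (p : T -> R) (q : U -> R) : T * U -> R :=
  fun z => p z.1 * q z.2.

Section Product.
Context {T U : choiceType} (p : T -> R) (q : U -> R).
Hypotheses (hp : is_prob p) (hq : is_prob q).

Lemma is_prob_prodw : is_prob (prodw p q).
Proof.
have [p0 ps p1] := hp; have [q0 qs q1] := hq; split.
- by move=> z; rewrite mulr_ge0.
- exact: asummableM.
- by rewrite tsumM// p1 q1 mulr1.
Qed.

Lemma Ex_prodw F : integ (prodw p q) F ->
  Ex (prodw p q) F = Ex p (fun x => Ex q (fun y => F (x, y))).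
Proof.
move=> hF; rewrite /Ex tsum_pair//; apply: eq_tsum => x.
have [px|px] := eqVneq (p x) 0.
  by rewrite px mul0r; apply: tsum_cst0 => y; rewrite /prodw /= px !mul0r.
have h := asummable_row x hF.
rewrite -tsumZ; first by apply: eq_tsum => y; rewrite /prodw/= mulrA.
apply: eq_asummable (asummableZ (p x)^-1 h) => y.
by rewrite /prodw/= -mulrA mulKf.
Qed.

Lemma integ_prodwM f g : integ p f -> integ q g ->
  integ (prodw p q) (fun z => f z.1 * g z.2).
Proof.
move=> hf hg; apply: eq_asummable (asummableM hf hg) => z.
by rewrite /prodw; ring.
Qed.

Lemma Ex_prodwM f g : integ p f -> integ q g ->
  Ex (prodw p q) (fun z => f z.1 * g z.2) = Ex p f * Ex q g.
Proof.
move=> hf hg; rewrite -tsumM//; apply: eq_tsum => z.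
by rewrite /prodw; ring.
Qed.

Lemma integ_fst f : integ p f -> integ (prodw p q) (fun z => f z.1).
Proof.
move=> hf; have [_ qs _] := hq.
apply: eq_asummable (integ_prodwM hf (integ_cst 1 qs)) => z.
by rewrite mulr1.
Qed.

Lemma integ_snd g : integ q g -> integ (prodw p q) (fun z => g z.2).
Proof.
move=> hg; have [_ ps _] := hp.
apply: eq_asummable (integ_prodwM (integ_cst 1 ps) hg) => z.
by rewrite mul1r.
Qed.

Lemma Ex_fst f : integ p f -> Ex (prodw p q) (fun z => f z.1) = Ex p f.
Proof.
move=> hf; have [_ qs _] := hq.
rewrite -[RHS]mulr1 -(Ex_cst 1 hq) -Ex_prodwM//; last exact: integ_cst.
by apply: eq_Ex => z _; rewrite mulr1.
Qed.

Lemma Ex_snd g : integ q g -> Ex (prodw p q) (fun z => g z.2) = Ex q g.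
Proof.
move=> hg; have [_ ps _] := hp.
rewrite -[RHS]mul1r -(Ex_cst 1 hp) -Ex_prodwM//; last exact: integ_cst.
by apply: eq_Ex => z _; rewrite mul1r.
Qed.

End Product.

End Expectations.

Local Notation conv := Defs.conv.

(** * Convolution, path space and the law of the endpoint *)

Section Walks.
Context {R : realType} {G : groupType}.
Implicit Types (mu nu f : G -> R) (F : seq G -> R).

Lemma prob_measureP mu : prob_measure mu -> is_prob mu.
Proof.
move=> [mu0 mu1].
have hs : asummable mu by apply: ge0_asummable => //; rewrite mu1 ltry.
by split=> //; apply: EFin_inj; rewrite -ge0_esumE.
Qed.

Lemma prob_le1 (T : choiceType) (p : T -> R) x : is_prob p -> p x <= 1.
Proof. by move=> [p0 ps <-]; apply: ge_term_tsum. Qed.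

Lemma mulg_bij (a : G) : bijective (fun x : G => (a * x)%g).
Proof. exists (fun x => (a^-1 * x)%g) => x; by rewrite ?mulKg ?mulVKg. Qed.

Lemma convE mu nu x : (forall y, 0 <= mu y) -> (forall y, 0 <= nu y) ->
  conv mu nu x = tsum (fun y => mu y * nu (y^-1 * x)%g).
Proof. by move=> mu0 nu0; rewrite ge0_tsumE// => y; rewrite mulr_ge0. Qed.

Lemma pair_mulV_bij : bijective (fun z : G * G => (z.1, (z.1^-1 * z.2)%g)).
Proof. by exists (fun z => (z.1, (z.1 * z.2)%g)) => -[x y] /=; rewrite ?mulKg ?mulVKg. Qed.

Section Convolution.
Variables mu nu : G -> R.
Hypotheses (hmu : is_prob mu) (hnu : is_prob nu).

Let mu0 x : 0 <= mu x. Proof. by have [] := hmu. Qed.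
Let nu0 x : 0 <= nu x. Proof. by have [] := hnu. Qed.

Let row (x : G) f : asummable (fun y => mu y * nu (y^-1 * x)%g * f x).
Proof.
have [_ mus _] := hmu.
apply: le_asummable (asummableZ (f x) mus) => y.
rewrite mulrC !normrM ler_wpM2l// ler_piMr// ger0_norm//.
exact: prob_le1.
Qed.

Let rowE (x : G) f :
  tsum (fun y => mu y * nu (y^-1 * x)%g * f x) = conv mu nu x * f x.
Proof.
have h := row x (fun=> 1).
rewrite convE// mulrC -tsumZ; first by apply: eq_tsum => y; rewrite mulrC.
by apply: eq_asummable h => y; rewrite mulr1.
Qed.

Lemma conv_ge0 x : 0 <= conv mu nu x.
Proof. by rewrite convE//; apply: tsum_ge0 => y; rewrite mulr_ge0. Qed.

(** The map [(x, y) |-> (x y, x)] is a bijection of [G * G] carrying the convolution kernel to the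
    product weight; all statements on [conv] reduce to Fubini through it. *)
Let shear f : asummable (fun z : G * G => mu z.2 * nu (z.2^-1 * z.1)%g * f z.1)
  <-> integ (prodw mu nu) (fun z => f (z.1 * z.2)%g).
Proof.
split => h.
- have b : bijective (fun z : G * G => ((z.1 * z.2)%g, z.1)).
    exists (fun z : G * G => (z.2, (z.2^-1 * z.1)%g)) => -[x y] /=;
      by rewrite ?mulKg ?mulVKg.
  apply: eq_asummable (asummable_bij b h) => -[x y] /=.
  by rewrite mulKg.
- have h1 := asummable_swap (asummable_bij pair_mulV_bij h).
  by apply: eq_asummable h1 => -[x y] /=; rewrite mulVKg.
Qed.

Lemma integ_conv f :
  integ (conv mu nu) f <-> integ (prodw mu nu) (fun z => f (z.1 * z.2)%g).
Proof.
rewrite -shear -asummable_pairP => [|x]; last exact: row.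
have E x : tsum (fun y => `|mu y * nu (y^-1 * x)%g * f x|) = `|conv mu nu x * f x|.
  rewrite normrM (ger0_norm (conv_ge0 x)) -(rowE x (fun x => `|f x|)).
  by apply: eq_tsum => y; rewrite normrM ger0_norm// mulr_ge0.
split => h; first by apply: eq_asummable (asummable_norm h) => x; rewrite /= E.
by apply: le_asummable h => x; rewrite /= E normr_id.
Qed.

Lemma Ex_conv f : integ (conv mu nu) f ->
  Ex (conv mu nu) f = Ex (prodw mu nu) (fun z => f (z.1 * z.2)%g).
Proof.
move=> /integ_conv h; rewrite /Ex [RHS](tsum_bij _ pair_mulV_bij) /=.
have h1 : asummable (fun z : G * G => mu z.1 * nu (z.1^-1 * z.2)%g * f z.2).
  by apply: eq_asummable (asummable_bij pair_mulV_bij h) => -[x y] /=; rewrite mulVKg.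
rewrite [RHS](_ : _ = tsum (fun z : G * G => mu z.1 * nu (z.1^-1 * z.2)%g * f z.2)).
  rewrite tsum_pair// [RHS](@tsum_exchange _ _ _ (fun x y => mu x * nu (x^-1 * y)%g * f y))//.
  by apply: eq_tsum => x; rewrite -rowE.
by apply: eq_tsum => -[x y] /=; rewrite /prodw /= mulVKg.
Qed.

Lemma is_prob_conv : is_prob (conv mu nu).
Proof.
have [_ ps p1] := is_prob_prodw hmu hnu.
have h : integ (conv mu nu) (fun=> 1) by apply/integ_conv; exact: integ_cst.
split; first exact: conv_ge0.
- by apply: eq_asummable h => x; rewrite mulr1.
- rewrite -p1 (_ : tsum (conv mu nu) = Ex (conv mu nu) (fun=> 1)).
    by rewrite Ex_conv//; apply: eq_tsum => x; rewrite mulr1.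
  by apply: eq_tsum => x; rewrite mulr1.
Qed.

End Convolution.

Lemma is_prob_conv_pow mu n : is_prob mu -> is_prob (conv_pow mu n).
Proof.
move=> hmu; elim: n => [|n ih]; last exact: is_prob_conv.
have h (x : G) : x != 1%g -> (x == 1%g)%:R = 0 :> R by move=> /negbTE ->.
have [hs h1] := tsum_delta h.
by split=> //; rewrite h1 eqxx.
Qed.

Lemma conv_powS mu n : conv_pow mu n.+1 = conv mu (conv_pow mu n).
Proof. by []. Qed.

Definition wprod (s : seq G) : G := (\prod_(a <- s) a)%g.

Lemma wprod_cat s t : wprod (s ++ t) = (wprod s * wprod t)%g.
Proof. exact: big_cat. Qed.

Lemma wprod_cons a s : wprod (a :: s) = (a * wprod s)%g.
Proof. exact: big_cons. Qed.

Definition EP mu n F : R := Ex (@path_prob R G mu n) (fun x => F x).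
Definition integP mu n F : Prop := integ (@path_prob R G mu n) (fun x => F x).

Lemma path_probE mu n (x : n.-tuple G) : path_prob mu x = \prod_(a <- x) mu a.
Proof. by rewrite big_tuple. Qed.

Lemma path_prob_neq0 mu n (x : n.-tuple G) :
  path_prob mu x != 0 -> forall a, a \in tval x -> mu a != 0.
Proof.
rewrite path_probE => h a ax; apply: contra h => /eqP ma.
by rewrite prodf_seq_eq0; apply/hasP; exists a => //=; rewrite ma.
Qed.

Lemma path_prob_ge0 mu n (x : n.-tuple G) : (forall a, 0 <= mu a) ->
  0 <= path_prob mu x.
Proof. by move=> mu0; apply: prodr_ge0. Qed.

Lemma path_prob_gt0 mu n (x : n.-tuple G) : (forall a, 0 <= mu a) ->
  path_prob mu x != 0 -> 0 < path_prob mu x.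
Proof. by move=> mu0; rewrite lt_neqAle eq_sym path_prob_ge0// => ->. Qed.

Lemma cat_tuple_bij n m :
  bijective (fun z : n.-tuple G * m.-tuple G => cat_tuple z.1 z.2).
Proof.
have h1 (x : (n + m).-tuple G) : size (take n x) == n.
  by rewrite size_takel// size_tuple leq_addr.
have h2 (x : (n + m).-tuple G) : size (drop n x) == m.
  by rewrite size_drop size_tuple addKn.
exists (fun x => (Tuple (h1 x), Tuple (h2 x))) => [[x y]|x] /=.
- congr pair; apply: val_inj => /=.
    by rewrite take_size_cat// size_tuple.
  by rewrite drop_size_cat// size_tuple.
- by apply: val_inj; rewrite /= cat_take_drop.
Qed.

Lemma cons_tuple_bij n :
  bijective (fun z : G * n.-tuple G => cons_tuple z.1 z.2).
Proof.
exists (fun x : n.+1.-tuple G => (thead x, behead_tuple x)) => [[a x]|x].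
- by congr pair; apply: val_inj.
- by rewrite [RHS]tuple_eta; apply: val_inj.
Qed.

Lemma path_prob_cat mu n m (x : n.-tuple G) (y : m.-tuple G) :
  path_prob mu (cat_tuple x y) = path_prob mu x * path_prob mu y.
Proof. by rewrite !path_probE /= big_cat. Qed.

Lemma path_prob_cons mu n a (x : n.-tuple G) :
  path_prob mu (cons_tuple a x) = mu a * path_prob mu x.
Proof. by rewrite !path_probE /= big_cons. Qed.

Lemma path_prob0 mu (x : 0.-tuple G) : path_prob mu x = 1.
Proof. by rewrite tuple0 path_probE big_nil. Qed.

Lemma tsum_tuple0 (h : 0.-tuple G -> R) : asummable h /\ tsum h = h [tuple].
Proof.
by apply: (@tsum_delta _ _ h [tuple]) => x; rewrite [x]tuple0 eqxx.
Qed.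

Lemma integP_cat mu n m F : integP mu (n + m) F <->
  integ (prodw (@path_prob R G mu n) (@path_prob R G mu m))
    (fun z => F (z.1 ++ z.2)).
Proof.
have [g gK Kg] := cat_tuple_bij n m.
split => h.
- apply: eq_asummable (asummable_bij (cat_tuple_bij n m) h) => z.
  by rewrite path_prob_cat.
- have b : bijective g by exists (fun z : _ * _ => cat_tuple z.1 z.2).
  apply: eq_asummable (asummable_bij b h) => z.
  by rewrite /= /prodw -path_prob_cat -[in RHS](Kg z).
Qed.

Lemma EP_cat mu n m F : EP mu (n + m) F =
  Ex (prodw (@path_prob R G mu n) (@path_prob R G mu m))
    (fun z => F (z.1 ++ z.2)).
Proof.
rewrite /EP /Ex (tsum_bij _ (cat_tuple_bij n m)); apply: eq_tsum => z.
by rewrite path_prob_cat.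
Qed.

Lemma integP_cons mu n F : integP mu n.+1 F <->
  integ (prodw mu (@path_prob R G mu n)) (fun z => F (z.1 :: z.2)).
Proof.
have [g gK Kg] := cons_tuple_bij n.
split => h.
- apply: eq_asummable (asummable_bij (cons_tuple_bij n) h) => z.
  by rewrite path_prob_cons.
- have b : bijective g by exists (fun z : _ * _ => cons_tuple z.1 z.2).
  apply: eq_asummable (asummable_bij b h) => z.
  by rewrite /= /prodw -path_prob_cons -[in RHS](Kg z).
Qed.

Lemma EP_cons mu n F : EP mu n.+1 F =
  Ex (prodw mu (@path_prob R G mu n)) (fun z => F (z.1 :: z.2)).
Proof.
rewrite /EP /Ex (tsum_bij _ (cons_tuple_bij n)); apply: eq_tsum => z.
by rewrite path_prob_cons.
Qed.

Lemma is_prob_path mu n : is_prob mu -> is_prob (@path_prob R G mu n).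
Proof.
move=> hmu; have [mu0 mus mu1] := hmu.
elim: n => [|n ih].
  have [h1 h2] := tsum_tuple0 (@path_prob R G mu 0).
  by split=> // [x|]; [exact: path_prob_ge0|rewrite h2 path_prob0].
have [_ hs h1] := is_prob_prodw hmu ih.
have hc : integP mu n.+1 (fun=> 1) by rewrite integP_cons; exact: integ_cst.
split=> [x||]; first exact: path_prob_ge0.
  by apply: eq_asummable hc => x; rewrite mulr1.
rewrite -h1 (_ : tsum _ = EP mu n.+1 (fun=> 1)).
  by rewrite EP_cons; apply: eq_tsum => z; rewrite mulr1.
by apply: eq_tsum => z; rewrite mulr1.
Qed.

(** Image of a weight under a map, expressed by test functions. Integrability is part of the
    statement, in both directions, so that it composes and applies to unbounded functions. *)
Definition law {T U : choiceType} (p : T -> R) (phi : T -> U) (q : U -> R) :=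
  forall f : U -> R, (integ p (fun x => f (phi x)) <-> integ q f) /\
    (integ q f -> Ex p (fun x => f (phi x)) = Ex q f).

Lemma law_comp (T U V : choiceType) (p : T -> R) (q : U -> R) (r : V -> R) phi psi :
  law p phi q -> law q psi r -> law p (fun x => psi (phi x)) r.
Proof.
move=> pq qr f; have [h1 h2] := qr f; have [h3 h4] := pq (fun y => f (psi y)).
split; first by rewrite h3.
by move=> hf; rewrite h4 ?h2//; apply/h1.
Qed.

Lemma law_prodw (S T U : choiceType) (m : S -> R) (p : T -> R) (q : U -> R) phi :
  (forall a, 0 <= m a) -> (forall x, 0 <= p x) -> (forall x, 0 <= q x) ->
  law p phi q ->
  law (prodw m p) (fun z => (z.1, phi z.2)) (prodw m q).
Proof.
move=> m0 p0 q0 pq f.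
(* The factor [m a] is absorbed into the test function, so that rows with [m a = 0] need no separate
   treatment. *)
pose g a y := m a * f (a, y).
have rowp a : asummable (fun x => prodw m p (a, x) * f (a, phi x)) <->
    integ p (fun x => g a (phi x)).
  by split; apply: eq_asummable => x; rewrite /prodw /g /=; ring.
have rowq a : asummable (fun y => prodw m q (a, y) * f (a, y)) <-> integ q (g a).
  by split; apply: eq_asummable => x; rewrite /prodw /g /=; ring.
have sump a : tsum (fun x => `|prodw m p (a, x) * f (a, phi x)|) =
    Ex p (fun x => `|g a (phi x)|).
  apply: eq_tsum => x; rewrite /prodw /g /= !normrM.
  by rewrite (ger0_norm (p0 x)); ring.
have sumq a : tsum (fun y => `|prodw m q (a, y) * f (a, y)|) =
    Ex q (fun y => `|g a y|).
  apply: eq_tsum => x; rewrite /prodw /g /= !normrM.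
  by rewrite (ger0_norm (q0 x)); ring.
have iff a : integ p (fun x => g a (phi x)) <-> integ q (g a).
  by have [] := pq (g a).
have eqn a : integ q (g a) ->
    Ex p (fun x => `|g a (phi x)|) = Ex q (fun y => `|g a y|).
  by move=> /integ_norm h; have [_ ->] := pq (fun y => `|g a y|).
have H : integ (prodw m p) (fun z => f (z.1, phi z.2)) <-> integ (prodw m q) f.
  split => h.
  - have hr a : integ q (g a) := (iff a).1 ((rowp a).1 (asummable_row a h)).
    apply: asummable_pair => [a|]; first exact: (rowq a).2.
    apply: eq_asummable (asummable_tsum_norm h) => a /=.
    by rewrite sump sumq eqn.
  - have hr a : integ q (g a) := (rowq a).1 (asummable_row a h).
    apply: asummable_pair => [a|]; first exact: (rowp a).2 ((iff a).2 (hr a)).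
    apply: eq_asummable (asummable_tsum_norm h) => a /=.
    by rewrite sump sumq eqn.
split=> // h; rewrite /Ex tsum_pair; last exact/H.
rewrite [RHS]tsum_pair//; apply: eq_tsum => a.
have hr : integ q (g a) := (rowq a).1 (asummable_row a h).
have [_ /(_ hr)] := pq (g a) => E.
rewrite (eq_tsum (g := fun x => p x * g a (phi x))); last first.
  by move=> x; rewrite /prodw /g /=; ring.
rewrite [LHS]E; apply: eq_tsum => x.
by rewrite /prodw /g /=; ring.
Qed.

Lemma law_conv mu nu : is_prob mu -> is_prob nu ->
  law (prodw mu nu) (fun z => (z.1 * z.2)%g) (conv mu nu).
Proof.
move=> hmu hnu f; split; first by rewrite integ_conv.
by move=> h; rewrite Ex_conv.
Qed.

Lemma law_walk mu n : is_prob mu ->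
  law (@path_prob R G mu n) (fun x => wprod x) (conv_pow mu n).
Proof.
move=> hmu; elim: n => [|n ih].
  move=> f.
  have [h1 h2] := @tsum_tuple0 (fun x => path_prob mu x * f (wprod x)).
  have h x : x != 1%g -> conv_pow mu 0 x * f x = 0.
    by move=> /negbTE e; rewrite /conv_pow/= e mul0r.
  have [h3 h4] := tsum_delta h; split=> // _.
  rewrite [LHS]h2 [RHS]h4 path_prob0 /conv_pow /= eqxx /wprod.
  by rewrite big_nil.
have hn := is_prob_conv_pow n hmu; have hp := is_prob_path n hmu.
have [n0 _ _] := hn; have [p0 _ _] := hp; have [mu0 _ _] := hmu.
have := law_comp (law_prodw mu0 p0 n0 ih) (law_conv hmu hn) => hl f.
rewrite -conv_powS in hl; have [h1 h2] := hl f.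
have E : (fun z : G * n.-tuple G => f (z.1 * wprod z.2)%g) =
    (fun z => f (wprod (z.1 :: z.2))).
  by apply/funext => z; rewrite wprod_cons.
split.
- rewrite -h1 /=.
  have := @integP_cons mu n (fun s => f (wprod s)).
  by rewrite -E.
- move=> /h2 <-.
  have := @EP_cons mu n (fun s => f (wprod s)).
  by rewrite -E.
Qed.

Lemma integ_walk mu n f : is_prob mu ->
  integP mu n (fun s => f (wprod s)) <-> integ (conv_pow mu n) f.
Proof. by move=> hmu; have [] := law_walk n hmu f. Qed.

Lemma EP_walk mu n f : is_prob mu -> integ (conv_pow mu n) f ->
  EP mu n (fun s => f (wprod s)) = Ex (conv_pow mu n) f.
Proof. by move=> hmu; have [] := law_walk n hmu f. Qed.

End Walks.

(** * Exponential decay of convolution powers on a non-amenable group *)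

Section Kesten.
Context {R : realType} {G : groupType}.
Implicit Types (mu f : G -> R) (A : set G).

Lemma fmap_ultra (T U : Type) (w : T -> U) (F : set_system T) :
  UltraFilter F -> UltraFilter (w @ F).
Proof.
move=> FU; split; first exact: fmap_proper_filter.
move=> H HP sub; apply/seteqP; split => // A HA.
have [//|FA] := in_ultra_setVsetC (w @^-1` A) FU.
have HC : H (~` A) by apply: sub.
by have /filter_ex [? []] : H (A `&` ~` A) by exact: filterI.
Qed.

(** Compactness of the segment. Limits along one ultrafilter exist simultaneously for all subsets of
    [G], for which extracting a common subsequence may be impossible. *)
Lemma ultra_bounded_lim (F : set_system nat) (w : nat -> R) (a b : R) :
  UltraFilter F -> (forall k, a <= w k <= b) ->
  exists l : R, w @ F --> l.
Proof.
move=> FU wab; have := @segment_compact R a b; rewrite compact_ultra.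
move=> /(_ _ (fmap_ultra w FU)) [|l [_ hl]]; last by exists l.
suff : F (w @^-1` `[a, b]) by [].
by apply: filterE => k /=; rewrite in_itv /= wab.
Qed.

(** A single atom contributes at most the whole variance, and the squared distance of two values is
    at most twice the sum of their squared distances to the mean; hence the factor 4. *)
Lemma dist_le_variance (T : choiceType) (p u : T -> R) a b : is_prob p ->
  integ p (fun x => u x ^+ 2) ->
  p a * p b * (u a - u b) ^+ 2 <= 4 * (Ex p (fun x => u x ^+ 2) - Ex p u ^+ 2).
Proof.
move=> hp hu; have [p0 ps p1] := hp.
set m := Ex p u.
have hm : integ p (fun x => (- m) ^+ 2) by exact: integ_cst.
have V : Ex p (fun x => (u x + - m) ^+ 2) = Ex p (fun x => u x ^+ 2) - m ^+ 2.
  rewrite (Ex_sqrD hu hm) (Ex_cst _ hp).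
  rewrite (@eq_Ex _ _ _ (fun x => u x * - m) (fun x => - m * u x)).
    by rewrite ExZ; [rewrite -/m; ring|exact: integ_le_sqr].
  by move=> x _; rewrite mulrC.
have hv := integ_sqrD hu hm.
have term c : p c * (u c - m) ^+ 2 <= Ex p (fun x => u x ^+ 2) - m ^+ 2.
  rewrite -V; apply: (@ge_term_tsum _ _ (fun x => p x * (u x + - m) ^+ 2)) => //.
  by move=> x; rewrite mulr_ge0// sqr_ge0.
have ha := term a; have hb := term b.
have a1 := prob_le1 a hp; have b1 := prob_le1 b hp.
have a0 := p0 a; have b0 := p0 b.
set V0 := Ex p _ - _ in ha hb *.
have V00 : 0 <= V0 by apply: le_trans ha; rewrite mulr_ge0// sqr_ge0.
have : (u a - u b) ^+ 2 <= 2 * (u a - m) ^+ 2 + 2 * (u b - m) ^+ 2.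
  rewrite -subr_ge0 (_ : _ - _ = (u a + u b - 2 * m) ^+ 2); last by ring.
  exact: sqr_ge0.
move=> /(ler_wpM2l (mulr_ge0 a0 b0)) /le_trans; apply.
have h1 : p b * (p a * (u a - m) ^+ 2) <= V0.
  by apply: le_trans ha; rewrite ler_piMl// mulr_ge0// sqr_ge0.
have h2 : p a * (p b * (u b - m) ^+ 2) <= V0.
  by apply: le_trans hb; rewrite ler_piMl// mulr_ge0// sqr_ge0.
rewrite [leLHS](_ : _ = 2 * (p b * (p a * (u a - m) ^+ 2)) +
  2 * (p a * (p b * (u b - m) ^+ 2))); last by ring.
lra.
Qed.

Lemma prob_sqr_summable (T : choiceType) (p : T -> R) : is_prob p ->
  asummable (fun x => p x ^+ 2).
Proof.
move=> hp; have [p0 ps _] := hp; apply: le_asummable ps => x.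
by rewrite expr2 normrM ler_piMl// ger0_norm// prob_le1.
Qed.

(* The average over [x] of the variance of [y |-> f (y^-1 x)] under [mu] is
   [|f|^2 - |mu * f|^2]: translates of an almost extremal [f] by two points of
   the support are close. *)
Lemma translates_close mu f s0 s1 : is_prob mu -> is_prob f ->
  mu s0 * mu s1 * tsum (fun x => (f (s0^-1 * x)%g - f (s1^-1 * x)%g) ^+ 2)
  <= 4 * (tsum (fun x => f x ^+ 2) - tsum (fun x => conv mu f x ^+ 2)).
Proof.
move=> hmu hf; have [mu0 mus mu1] := hmu; have [f0 fs f1] := hf.
have hc := is_prob_conv hmu hf.
have f2 := prob_sqr_summable hf; have c2 := prob_sqr_summable hc.
pose F (z : G * G) := mu z.2 * f (z.2^-1 * z.1)%g ^+ 2.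
have b : bijective (fun z : G * G => (z.2, (z.2^-1 * z.1)%g)).
  exists (fun z : G * G => ((z.1 * z.2)%g, z.1)) => -[x y] /=;
  by rewrite ?mulKg ?mulVKg.
have hF : asummable F by exact: asummable_bij b (asummableM mus f2).
have tF : tsum F = tsum (fun x => f x ^+ 2).
  by rewrite -[RHS]mul1r -mu1 -tsumM// [RHS](tsum_bij _ b).
have rows x : integ mu (fun y => f (y^-1 * x)%g ^+ 2) := asummable_row x hF.
have sums : asummable (fun x => Ex mu (fun y => f (y^-1 * x)%g ^+ 2)) :=
  asummable_tsum hF.
have tr s : asummable (fun x => f (s^-1 * x)%g ^+ 2).
  exact: asummable_bij (mulg_bij s^-1) f2.
have i1 : asummable (fun x => (f (s0^-1 * x)%g - f (s1^-1 * x)%g) ^+ 2).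
  apply: le_asummable (asummableZ 2 (asummableD (tr s0) (tr s1))) => x.
  rewrite !ger0_norm; first 1 last.
  - by rewrite mulr_ge0// addr_ge0// sqr_ge0.
  - exact: sqr_ge0.
  rewrite -subr_ge0 (_ : _ - _ = (f (s0^-1 * x)%g + f (s1^-1 * x)%g) ^+ 2).
    exact: sqr_ge0.
  by ring.
rewrite -tF tsum_pair// -tsumB// -tsumZ//.
rewrite -tsumZ; last exact: asummableB.
apply: le_tsum; [exact: asummableZ|exact/asummableZ/asummableB|] => x.
rewrite convE//.
exact: (dist_le_variance s0 s1 hmu (rows x)).
Qed.

(** The probability with density the square of the unit vector [f / |f|] of l2: closeness of unit
    vectors in l2 controls these masses uniformly in [A]. *)
Definition mass2 f A : R :=
  tsum (fun x => f x ^+ 2 * (x \in A)%:R) / tsum (fun x => f x ^+ 2).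

Section Mass.
Variable f : G -> R.
Hypothesis hf : is_prob f.

Let f2 : asummable (fun x => f x ^+ 2). Proof. exact: prob_sqr_summable. Qed.

Let fA A : asummable (fun x => f x ^+ 2 * (x \in A)%:R).
Proof.
apply: le_asummable f2 => x; rewrite normrM ler_piMr//.
by case: (_ \in _); rewrite ?normr1 ?normr0.
Qed.

Lemma tsum_sqr_gt0 : 0 < tsum (fun x => f x ^+ 2).
Proof.
have [f0 fs f1] := hf.
have n0 : 0 <= tsum (fun x => f x ^+ 2) by apply: tsum_ge0 => x; exact: sqr_ge0.
rewrite lt_neqAle n0 andbT eq_sym; apply/eqP => h.
have fx x : f x = 0.
  apply/eqP; rewrite -sqrf_eq0 eq_le sqr_ge0 andbT -h.
  by apply: (@ge_term_tsum _ _ (fun x => f x ^+ 2)) => // y; exact: sqr_ge0.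
by have := f1; rewrite (tsum_cst0 fx) => /eqP; rewrite eq_sym oner_eq0.
Qed.

Lemma mass2_ge0 A : 0 <= mass2 f A.
Proof.
rewrite divr_ge0//; apply: tsum_ge0 => x; rewrite ?sqr_ge0//.
by rewrite mulr_ge0 ?sqr_ge0.
Qed.

Lemma mass2T : mass2 f setT = 1.
Proof.
rewrite /mass2 (@eq_tsum _ _ _ (fun x => f x ^+ 2)) ?divff//.
  by rewrite gt_eqF// tsum_sqr_gt0.
by move=> x; rewrite in_setT mulr1.
Qed.

Lemma mass2U A C : A `&` C = set0 -> mass2 f (A `|` C) = mass2 f A + mass2 f C.
Proof.
move=> AC; rewrite -mulrDl -tsumD//; congr (_ / _); apply: eq_tsum => x.
rewrite -mulrDr in_setU; congr (_ * _).
have [xA|xA] := boolP (x \in A); have [xC|xC] := boolP (x \in C);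
  rewrite /= ?addr0 ?add0r//.
have : x \in A `&` C by rewrite in_setI xA xC.
by rewrite AC in_set0.
Qed.

Lemma mass2_le1 A : mass2 f A <= 1.
Proof.
rewrite -mass2T -(setUv A) mass2U ?setICr//.
by rewrite lerDl mass2_ge0.
Qed.

(** The difference of squares factors as [(u - v) (u + v)], and Cauchy-Schwarz is applied for
    counting measure (the weight constantly equal to 1); the sum of two translates has squared norm
    at most [4 |f|^2]. *)
Lemma mass2_translate A s0 s1 :
  (mass2 f [set (s0 * x)%g | x in A] - mass2 f [set (s1 * x)%g | x in A]) ^+ 2
  <= 4 * (tsum (fun x => (f (s0 * x)%g - f (s1 * x)%g) ^+ 2)
          / tsum (fun x => f x ^+ 2)).
Proof.
set N := tsum (fun x => f x ^+ 2).
have N0 : 0 < N := tsum_sqr_gt0.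
have tr s : asummable (fun x => f (s * x)%g ^+ 2).
  exact: asummable_bij (mulg_bij s) f2.
have trN s : tsum (fun x => f (s * x)%g ^+ 2) = N.
  by rewrite /N (tsum_bij _ (mulg_bij s)).
have trA s : asummable (fun x => f (s * x)%g ^+ 2 * (x \in A)%:R).
  apply: le_asummable (tr s) => x; rewrite normrM ler_piMr//.
  by case: (_ \in _); rewrite ?normr1 ?normr0.
have mE s : mass2 f [set (s * x)%g | x in A] =
    tsum (fun x => f (s * x)%g ^+ 2 * (x \in A)%:R) / N.
  rewrite /mass2 (tsum_bij _ (mulg_bij s)); congr (_ / _).
  apply: eq_tsum => x; congr (_ * _%:R); congr nat_of_bool.
  apply/idP/idP; rewrite !inE; last by move=> xA; exists x.
  by move=> [y Ay /mulgI <-].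
have h1 s : integ (fun=> 1 : R) (fun x : G => f (s * x)%g ^+ 2).
  by apply: eq_asummable (tr s) => x; rewrite mul1r.
rewrite !mE -mulrBl -tsumB//.
set a := fun x => (x \in A)%:R * (f (s0 * x)%g - f (s1 * x)%g).
set b := fun x => f (s0 * x)%g + f (s1 * x)%g.
have hb : integ (fun=> 1 : R) (fun x : G => b x ^+ 2) by exact: integ_sqrD.
have hd : integ (fun=> 1 : R) (fun x : G => (f (s0 * x)%g - f (s1 * x)%g) ^+ 2).
  exact: integ_sqrB.
have ha : integ (fun=> 1 : R) (fun x : G => a x ^+ 2).
  apply: le_integ hd => x _; rewrite /a.
  by case: (_ \in _); rewrite ?mul1r// mul0r expr2 mul0r normr0.
have -> : tsum (fun x => f (s0 * x)%g ^+ 2 * (x \in A)%:R -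
     f (s1 * x)%g ^+ 2 * (x \in A)%:R) = Ex (fun=> 1) (fun x => a x * b x).
  by apply: eq_tsum => x; rewrite /a /b; ring.
have CS := @cauchy_schwarz _ _ (fun=> 1) a b (fun=> ler01) ha hb.
have La : Ex (fun=> 1) (fun x => a x ^+ 2) <=
   tsum (fun x => (f (s0 * x)%g - f (s1 * x)%g) ^+ 2).
  apply: le_tsum => // [|x].
    by apply: eq_asummable hd => x; rewrite mul1r.
  rewrite mul1r /a; case: (_ \in _); rewrite ?mul1r// mul0r expr2 mul0r.
  exact: sqr_ge0.
have Lb : Ex (fun=> 1) (fun x => b x ^+ 2) <= 4 * N.
  have -> : 4 * N = 2 * (tsum (fun x => f (s0 * x)%g ^+ 2) +
                         tsum (fun x => f (s1 * x)%g ^+ 2)).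
    by rewrite !trN; lra.
  rewrite -tsumD// -tsumZ; last exact: asummableD.
  apply: le_tsum => // [|x]; first exact/asummableZ/asummableD.
  rewrite mul1r /b -subr_ge0 (_ : _ - _ = (f (s0 * x)%g - f (s1 * x)%g) ^+ 2).
    exact: sqr_ge0.
  by ring.
rewrite expr_div_n ler_pdivrMr ?exprn_gt0//.
set D := tsum (fun x => (f (s0 * x)%g - _) ^+ 2) in La *.
have -> : 4 * (D / N) * N ^+ 2 = D * (4 * N) by field; rewrite gt_eqF.
apply: le_trans CS _; apply: ler_pM => //;
  by apply: Ex_ge0 => // x _; exact: sqr_ge0.
Qed.

End Mass.

(* If [|mu^(n+1)|^2 / |mu^n|^2] is not bounded away from 1, an ultrafilter limit
   of the normalised squares of suitable [mu^n] is a finitely additive measure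
   [m] with [m (s A) = m (s' A)] for [s, s'] in the support. This only gives
   invariance under an index-two subgroup; averaging [m A] with [m (b A)],
   [b] in the support, makes it invariant under the whole group. *)
Theorem kesten mu (B : set G) : is_prob mu -> supp mu = B ->
  symmetric_set B -> generates B -> ~ amenable R G ->
  exists2 rho : R, 0 <= rho < 1 & forall n x, conv_pow mu n x ^+ 2 <= rho ^+ n.
Proof.
move=> hmu hB Bsym Bgen namen; have [mu0 mus mu1] := hmu.
pose N n := tsum (fun x => conv_pow mu n x ^+ 2).
have hn n := is_prob_conv_pow n hmu.
have [[rho [r01 hr]]|contr] := pselect (exists rho : R, 0 <= rho < 1 /\
    forall n, N n.+1 <= rho * N n).
  exists rho => // n x.
  have : N n <= rho ^+ n.
    elim: n => [|n ih]; last first.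
      rewrite exprS; apply: le_trans (hr n) _.
      by apply: ler_wpM2l => //; case/andP: r01.
    rewrite expr0 /N; have [p0 ps <-] := hn 0%N.
    apply: le_tsum => // [|y]; first exact: prob_sqr_summable.
    by rewrite expr2 ler_piMl// prob_le1.
  apply: le_trans.
  apply: (@ge_term_tsum _ _ (fun x => conv_pow mu n x ^+ 2)).
    by move=> y; exact: sqr_ge0.
  exact: prob_sqr_summable.
case: namen.
(* If no factor [1 - 1/(k+1)] contracts the squared norms at every step, some power of [mu] has
   relative loss below [1/(k+1)]. By [translates_close] its translates by points of the support
   almost coincide. *)
have ex k : exists n, (1 - (k.+1%:R)^-1) * N n < N n.+1.
  apply: contrapT => /forallNP h; apply: contr.
  exists (1 - (k.+1%:R)^-1); split; last first.
    by move=> n; rewrite leNgt; apply/negP/h.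
  rewrite subr_ge0 invf_le1// ler1n /= gtrBl invr_gt0.
  by rewrite ltr0n.
have [nk hnk] := choice ex.
pose w k A := mass2 (conv_pow mu (nk k)) A.
have Npos k : 0 < N (nk k) by exact: tsum_sqr_gt0.
have wclose k s0 s1 A : B s0 -> B s1 ->
    (w k [set (s0 * x)%g | x in A] - w k [set (s1 * x)%g | x in A]) ^+ 2
    <= 16 / (mu s0^-1%g * mu s1^-1%g) / k.+1%:R.
  move=> Bs0 Bs1.
  have pos s : B s -> 0 < mu s^-1%g.
    move=> /Bsym; rewrite -hB => h.
    by rewrite lt_neqAle mu0 eq_sym h.
  apply: le_trans (mass2_translate (hn (nk k)) A s0 s1) _.
  have := translates_close s0^-1%g s1^-1%g hmu (hn (nk k)).
  rewrite !invgK -conv_powS -/(N _) -/(N _).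
  set D := tsum _ => hD.
  have h1 : mu s0^-1%g * mu s1^-1%g * D <= 4 * (N (nk k) / k.+1%:R).
    apply: le_trans hD _; rewrite ler_pM2l//.
    have := hnk k; rewrite mulrBl mul1r mulrC => /ltW.
    by set a := N _ / _; lra.
  have mp : 0 < mu s0^-1%g * mu s1^-1%g by rewrite mulr_gt0 ?pos.
  have h2 : D / N (nk k) <= 4 / (mu s0^-1%g * mu s1^-1%g) / k.+1%:R.
    rewrite ler_pdivrMr// -(ler_pM2l mp); apply: le_trans h1 _.
    by rewrite le_eqVlt; apply/orP; left; apply/eqP; field; rewrite ?gt_eqF// pos.
  apply: le_trans (ler_wpM2l _ h2) _ => //.
  rewrite le_eqVlt; apply/orP; left; apply/eqP; field.
  by rewrite ?gt_eqF// pos.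
have [U [UU Usub]] := @ultraFilterLemma nat \oo _.
have UP : ProperFilter U by exact: ultra_proper.
have lims A : exists l : R, w ^~ A @ U --> l.
  apply: (ultra_bounded_lim (a := 0) (b := 1)) => k.
  by rewrite mass2_ge0 mass2_le1.
have [m hm] := choice lims.
have uniq (u : nat -> R) (a b : R) : u @ U --> a -> u @ U --> b -> a = b.
  by move=> ha hb; apply: (cvg_unique _ ha hb); exact: norm_hausdorff.
have m0 A : 0 <= m A.
  by apply: (cvgr_to_ge (hm A)); apply: nearW => k; exact: mass2_ge0.
have mT : m setT = 1.
  apply: uniq (hm setT) _; rewrite (_ : w ^~ setT = fun=> 1); first exact: cvg_cst.
  by apply/funext => k; exact: mass2T.
have mU A C : A `&` C = set0 -> m (A `|` C) = m A + m C.
  move=> AC; apply: uniq (hm _) _.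
  rewrite (_ : w ^~ (A `|` C) = fun k => w k A + w k C); first exact: cvgD.
  by apply/funext => k; exact: mass2U.
have minv A s0 s1 : B s0 -> B s1 ->
    m [set (s0 * x)%g | x in A] = m [set (s1 * x)%g | x in A].
  move=> Bs0 Bs1; apply/eqP; rewrite -subr_eq0 -sqrf_eq0; apply/eqP.
  set A0 := [set _ | _ in _]; set A1 := [set _ | _ in _].
  have c1 : (fun k => (w k A0 - w k A1) ^+ 2) @ U --> (m A0 - m A1) ^+ 2.
    by rewrite expr2; under eq_fun do rewrite expr2; apply: cvgM; apply: cvgB.
  apply: uniq c1 _.
  have c2 : (fun k => 16 / (mu s0^-1%g * mu s1^-1%g) / k.+1%:R : R) @ \oo --> (0 : R).
    rewrite -[X in _ --> X](mulr0 (16 / (mu s0^-1%g * mu s1^-1%g))).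
    apply: cvgM; first exact: cvg_cst.
    exact: cvg_harmonic.
  apply: (squeeze_cvgr (f := fun=> 0) (h := fun k => 16 / (mu s0^-1%g * mu s1^-1%g) / k.+1%:R)).
  - by apply: nearW => k; rewrite sqr_ge0 wclose.
  - exact: cvg_cst.
  - by move=> V /c2; exact: Usub.
have [b Bb] : exists b, B b.
  apply: contrapT => /forallNP h.
  have : tsum mu = 0.
    apply: tsum_cst0 => x; apply/eqP; apply: contrapT => hx.
    by apply: (h x); rewrite -hB; apply/negP.
  by rewrite mu1 => /eqP; rewrite oner_eq0.
pose tr (g : G) A := [set (g * x)%g | x in A].
have trM g h A : tr (g * h)%g A = tr g (tr h A).
  apply/seteqP; split => x /=.
    by move=> [y Ay <-]; exists (h * y)%g; [exists y|rewrite mulgA].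
  by move=> [_ [y Ay <-] <-]; exists y => //; rewrite mulgA.
have tr1 A : tr 1%g A = A.
  apply/seteqP; split => x /=; first by move=> [y Ay <-]; rewrite mul1g.
  by move=> Ax; exists x => //; rewrite mul1g.
pose m' A := (m A + m (tr b A)) / 2.
have inv : forall g A, m' (tr g A) = m' A.
  have := Bgen [set g | forall A, m' (tr g A) = m' A].
  move=> H g; suff : [set g | forall A, m' (tr g A) = m' A] g by [].
  rewrite H//; first split.
  - by move=> A /=; rewrite tr1.
  - by move=> x y hx hy A /=; rewrite trM hx hy.
  - by move=> x hx A /=; rewrite -(hx (tr x^-1%g A)) -trM mulgV tr1.
  (* Translation by [s] swaps the two terms of [m']: [m (s A) = m (b A)], and
     [m (b s A) = m (s^-1 s A) = m A] because [s^-1] also lies in the support. *)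
  move=> s Bs A /=; rewrite /m'.
  have -> : m (tr s A) = m (tr b A) by exact: minv.
  have -> : m (tr b (tr s A)) = m (tr s^-1%g (tr s A)).
    by apply: minv => //; exact: Bsym.
  by rewrite -trM mulVg tr1 addrC.
exists m'; split.
- by move=> A; rewrite divr_ge0// addr_ge0.
- rewrite /m' (_ : tr b setT = setT) ?mT; first by lra.
  apply/seteqP; split => // x _ /=.
  by exists (b^-1 * x)%g => //; rewrite mulVKg.
- move=> A C AC; rewrite /m' mU// (_ : tr b (A `|` C) = tr b A `|` tr b C).
    rewrite mU; first by lra.
    apply/seteqP; split => // x [[y Ay <-] [z Cz /mulgI yz]].
    have : (A `&` C) y by split => //; rewrite -yz.
    by rewrite AC.
  by rewrite /tr image_setU.
- by move=> g A; exact: inv.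
Qed.

End Kesten.

(** * Tails of sums over the natural numbers *)

Section SumsOverNat.
Context {R : realType}.
Implicit Type f : nat -> R.

Lemma tsum_recl f : (forall n, 0 <= f n) -> asummable f ->
  asummable (fun n => f n.+1) /\ tsum f = f 0%N + tsum (fun n => f n.+1).
Proof.
move=> f0 hf.
have b : set_bij setT [set n | (0 < n)%N] S.
  split=> //; first by move=> x y _ _ [].
  by move=> [|n] //= _; exists n.
have E (g : nat -> R) : \esum_(n in [set n | (0 < n)%N]) (g n)%:E =
    \esum_(n in [set: nat]) (g n.+1)%:E by exact: reindex_esum.
have hS : asummable (fun n => f n.+1).
  apply: ge0_asummable => //; rewrite -E esum_mkcond.
  apply: le_lt_trans hf; apply: le_esum => n _.
  by case: ifP => // _; rewrite lee_fin// ler_norm.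
split=> //; apply: EFin_inj.
rewrite [RHS]EFinD -(ge0_esumE f0 hf) -(ge0_esumE (fun n => f0 n.+1) hS) -E.
rewrite (esumID [set n | (0 < n)%N]); last by move=> *; rewrite lee_fin.
rewrite setTI addeC; congr (_ + _)%E.
rewrite setTI (_ : ~` _ = [set 0%N]) ?esum_set1 ?lee_fin//.
by apply/seteqP; split => -[|n]//=.
Qed.

Lemma tsum_split f N : (forall n, 0 <= f n) -> asummable f ->
  asummable (fun n => f (N + n)%N) /\
  tsum f = \sum_(k < N) f k + tsum (fun n => f (N + n)%N).
Proof.
move=> f0 hf; elim: N => [|N [ihs ih]]; first by rewrite big_ord0 add0r.
have [h1 h2] := @tsum_recl (fun n => f (N + n)%N) (fun n => f0 _) ihs.
split; first by apply: eq_asummable h1 => n; rewrite addSnnS.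
rewrite ih h2 addn0 big_ord_recr/= -addrA; congr (_ + (_ + _)).
by apply: eq_tsum => n; rewrite addSnnS.
Qed.

Lemma asummable_geometric (q : R) : 0 <= q < 1 -> asummable (fun n => q ^+ n).
Proof.
move=> /andP[q0 q1]; apply: (@asummable_le_sum _ _ _ (1 - q)^-1) => [n|s us].
  exact: exprn_ge0.
have partial N : \sum_(0 <= k < N) q ^+ k <= (1 - q)^-1.
  have q1' : 0 < 1 - q by rewrite subr_gt0.
  rewrite -(ler_pM2l q1') divff ?gt_eqF// big_mkord.
  rewrite -(opprB q 1) mulNr -subrX1 opprB gerBl.
  exact: exprn_ge0.
pose N := (\max_(k <- s) k).+1.
apply: le_trans (partial N).
rewrite [leRHS](bigID (mem s))/= -[leLHS]addr0 lerD ?sumr_ge0//; last first.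
  by move=> i _; exact: exprn_ge0.
rewrite -[leRHS]big_filter le_eqVlt; apply/orP; left; apply/eqP/perm_big.
apply: uniq_perm => //; first by rewrite filter_uniq// iota_uniq.
move=> x; rewrite mem_filter mem_index_iota /= andbC; apply/idP/idP.
  move=> xs; rewrite xs andbT /N ltnS; exact: leq_bigmax_seq.
by move=> /andP[].
Qed.

End SumsOverNat.


(** * Almost additive and subadditive sequences *)

Section RealSequences.
Context {R : realType}.
Implicit Types (u b phi : nat -> R).

(** The bounds on the increments from [k] on add up to [g k = 3 e (3/4)^k], so [u - g] increases,
    [u + g] decreases, and the two bracket the limit. *)
Lemma geometric_increments u (e : R) :
  (forall k, `|u k.+1 - u k| <= e * (3 / 4) ^+ k.+1) ->
  exists2 L, u @ \oo --> L & `|u 0%N - L| <= 3 * e.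
Proof.
move=> hu.
have e0 : 0 <= e.
  by have := hu 0%N; rewrite expr1; have := normr_ge0 (u 1%N - u 0%N); lra.
pose g k : R := 3 * (e * (3 / 4) ^+ k).
have gS k : g k.+1 = g k * (3 / 4) by rewrite /g exprS; ring.
have gE k : e * (3 / 4) ^+ k.+1 = g k / 4 by rewrite /g exprS; lra.
have g0 k : 0 <= g k by rewrite !mulr_ge0// exprn_ge0.
have step k : `|u k.+1 - u k| <= g k / 4 by rewrite -gE.
pose l k := u k - g k; pose U k := u k + g k.
have lS k : l k <= l k.+1.
  by have := step k; rewrite /l gS ler_norml => /andP[]; lra.
have US k : U k.+1 <= U k.
  by have := step k; rewrite /U gS ler_norml => /andP[]; lra.
have ln k : l 0%N <= l k by elim: k => // k /le_trans; apply.
have Un k : U k <= U 0%N by elim: k => // k ih; apply: le_trans (US k) ih.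
have lU k : l k <= U k by rewrite /l /U; have := g0 k; lra.
have l_nd : nondecreasing_seq l by apply/nondecreasing_seqP.
have l_cv : l @ \oo --> limn l.
  apply: nondecreasing_is_cvgn => //.
  by exists (U 0%N) => _ [k _ <-]; exact: le_trans (lU k) (Un k).
have g_cv : g @ \oo --> (0 : R).
  rewrite -[X in _ --> X](mulr0 3); apply: cvgM; first exact: cvg_cst.
  rewrite -[X in _ --> X](mulr0 e); apply: cvgM; first exact: cvg_cst.
  by apply: cvg_expr; rewrite ger0_norm; lra.
have u_cv : u @ \oo --> limn l.
  rewrite (_ : u = fun k => l k + g k).
    by rewrite -[X in _ --> X]addr0; exact: cvgD.
  by apply/funext => k; rewrite /l; ring.
exists (limn l) => //.
have h1 : u 0%N - g 0%N <= limn l by apply: (cvgr_to_ge l_cv); apply: nearW.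
have h2 : limn l <= u 0%N + g 0%N.
  by apply: (cvgr_to_le l_cv); apply: nearW => k; exact: le_trans (lU k) (Un k).
have : g 0%N = 3 * e by rewrite /g expr0 mulr1.
by rewrite ler_norml => E; apply/andP; split; lra.
Qed.

(* The dyadic subsequence [b (2^k n) / (2^k n)] is Cauchy with geometric rate
   because [phi] grows at most by [3/2 < 2] when its argument doubles. *)
Lemma almost_additive b phi : (forall n, 0 <= phi n) ->
  (forall n m, (n <= m)%N -> phi n <= phi m) ->
  (forall n, phi n.*2 <= 3 / 2 * phi n) ->
  (forall n m, `|b (n + m)%N - b n - b m| <= phi (n + m)%N) ->
  exists L : R, forall n, (0 < n)%N -> `|b n / n%:R - L| <= 3 * (phi n / n%:R).
Proof.
move=> phi0 phi_nd phi2 hb.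
have phi2k n k : phi (2 ^ k * n)%N <= (3 / 2) ^+ k * phi n.
  elim: k => [|k ih]; first by rewrite expn0 mul1n expr0 mul1r.
  rewrite expnS -mulnA mul2n; apply: le_trans (phi2 _) _.
  by rewrite exprS -[leRHS]mulrA ler_pM2l//; lra.
pose c n := b n / n%:R.
have halve k : (3 / 4 : R) ^+ k = (3 / 2) ^+ k / (2 ^ k)%:R.
  by rewrite natrX -expr_div_n; congr (_ ^+ _); lra.
have lim n : (0 < n)%N -> exists2 L, (fun k => c (2 ^ k * n)%N) @ \oo --> L &
    `|c n - L| <= 3 * (phi n / n%:R).
  move=> n0.
  have := @geometric_increments (fun k => c (2 ^ k * n)%N) (phi n / n%:R).
  rewrite expn0 mul1n; apply => k.
  set m := (2 ^ k * n)%N.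
  have m0 : 0 < m%:R :> R by rewrite ltr0n muln_gt0 expn_gt0.
  have n0' : 0 < n%:R :> R by rewrite ltr0n.
  have -> : (2 ^ k.+1 * n = m + m)%N by rewrite expnS -mulnA mul2n addnn.
  have -> : c (m + m)%N - c m = (b (m + m)%N - b m - b m) / (2 * m%:R).
    rewrite /c natrD; field; rewrite gt_eqF//=; lra.
  rewrite normrM normfV (ger0_norm (_ : 0 <= 2 * m%:R)); last by rewrite mulr_ge0// ltW.
  rewrite ler_pdivrMr ?mulr_gt0//.
  apply: le_trans (hb m m) _.
  rewrite addnn -mul2n /m mulnA -expnS; apply: le_trans (phi2k n k.+1) _.
  rewrite halve expnS !natrM le_eqVlt; apply/orP; left; apply/eqP.
  have : (2 ^ k)%:R != 0 :> R by rewrite pnatr_eq0 -lt0n expn_gt0.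
  have : n%:R != 0 :> R by rewrite gt_eqF.
  move: (n%:R) ((2 ^ k)%:R) => x y x0 y0.
  by field; rewrite x0 y0.
have [L Lcv _] := lim 1%N isT.
exists L => n n0; have [L' Lcv' Ln] := lim n n0.
suff -> : L = L' by [].
(* Independence of the limit from [n]: cutting [n 2^k] steps into [n] blocks of length [2^k] costs
   fewer than [n] defects, each of order [(3/2)^k], which is negligible against [2^k]. *)
have mult k m : `|b (k.+1 * m)%N - k.+1%:R * b m| <= k%:R * phi (k.+1 * m)%N.
  elim: k => [|k ih]; first by rewrite mul1n !mul1r subrr normr0 mul0r.
  rewrite mulSn.
  have -> : b (m + k.+1 * m)%N - k.+2%:R * b m =
     (b (m + k.+1 * m)%N - b m - b (k.+1 * m)%N) + (b (k.+1 * m)%N - k.+1%:R * b m).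
    by rewrite -(natr1 k.+1); ring.
  apply: le_trans (ler_normD _ _) _.
  rewrite -[X in _ <= X * _](natr1 k) mulrDl mul1r [leLHS]addrC lerD//.
  apply: le_trans ih _; rewrite ler_wpM2l//.
  by apply: phi_nd; rewrite leq_addl.
have d0 : (fun k => c (2 ^ k * n)%N - c (2 ^ k * 1)%N) @ \oo --> (0 : R).
  apply: norm_cvg0.
  apply: (squeeze_cvgr (f := fun=> 0) (h := fun k => phi n * (3 / 4) ^+ k)).
  - apply: nearW => k; rewrite normr_ge0 /= muln1.
    have n0' : 0 < n%:R :> R by rewrite ltr0n.
    have k0' : 0 < (2 ^ k)%:R :> R by rewrite ltr0n expn_gt0.
    have -> : c (2 ^ k * n)%N - c (2 ^ k)%N =
        (b (n * 2 ^ k)%N - n%:R * b (2 ^ k)%N) / (n%:R * (2 ^ k)%:R).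
      by rewrite mulnC /c natrM; field; rewrite !gt_eqF.
    rewrite normrM normfV (ger0_norm (_ : 0 <= _ * _)); last by rewrite mulr_ge0// ltW.
    rewrite ler_pdivrMr ?mulr_gt0//; apply: (@le_trans _ _ (n%:R * phi (n * 2 ^ k)%N)).
      have := mult n.-1 (2 ^ k)%N; rewrite prednK// => /le_trans; apply.
      by rewrite ler_wpM2r// ler_nat leq_pred.
    rewrite mulnC halve.
    have -> : phi n * ((3 / 2) ^+ k / (2 ^ k)%:R) * (n%:R * (2 ^ k)%:R) =
       n%:R * ((3 / 2) ^+ k * phi n) by field; rewrite gt_eqF.
    by rewrite ler_wpM2l.
  - exact: cvg_cst.
  - rewrite -[X in _ --> X](mulr0 (phi n)); apply: cvgM; first exact: cvg_cst.
    by apply: cvg_expr; rewrite ger0_norm; lra.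
have d1 : (fun k => c (2 ^ k * n)%N - c (2 ^ k * 1)%N) @ \oo --> L' - L.
  exact: cvgB.
have : L' - L = 0 by apply: (cvg_unique _ d1 d0); exact: norm_hausdorff.
by lra.
Qed.

Lemma fekete b : (forall n, 0 <= b n) ->
  (forall n m, b (n + m)%N <= b n + b m) ->
  exists L : R, (fun n => b n / n%:R) @ \oo --> L.
Proof.
move=> b0 bD.
pose E := [set b n / n%:R | n in [set n | (0 < n)%N]].
have Einf : has_inf E.
  split; first by exists (b 1%N / 1%:R), 1%N.
  by exists 0 => _ [n _ <-]; rewrite divr_ge0.
exists (inf E).
have bM k m : b (k * m)%N <= k%:R * b m + b 0%N.
  elim: k => [|k ih]; first by rewrite mul0r add0r.
  by rewrite mulSn; apply: le_trans (bD _ _) _; rewrite -natr1; lra.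
apply/cvgrPdist_le => e e0.
have [_ [m m0 <-] hm] := inf_adherent (divr_gt0 e0 (ltr0n _ 2)) Einf.
(* Bounds, uniformly in [n], the remainder block of length [n %% m] together with the term [b 0]
   left over by [bM]. *)
pose M := b 0%N + \sum_(r < m) b r.
have M0 : 0 <= M by rewrite addr_ge0// sumr_ge0.
near=> n.
have n0 : (0 < n)%N by near: n; exact: nbhs_infty_gt.
have n0' : 0 < n%:R :> R by rewrite ltr0n.
have m0' : 0 < m%:R :> R by rewrite ltr0n.
have Mn : M * n%:R^-1 <= e / 2.
  have : M / (e / 2) <= n%:R by near: n; exact: nbhs_infty_ger.
  by rewrite ler_pdivrMr ?divr_gt0// mulrC -ler_pdivrMr.
have low : inf E <= b n / n%:R by apply: ge_inf; [case: Einf|exists n].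
have up : b n / n%:R <= b m / m%:R + M * n%:R^-1.
  have h : b n <= (n %/ m)%:R * b m + M.
    rewrite {1}(divn_eq n m); apply: le_trans (bD _ _) _.
    have h1 := bM (n %/ m)%N m.
    have h2 : b (n %% m)%N <= \sum_(r < m) b r.
      have hlt : (n %% m < m)%N by rewrite ltn_mod.
      by rewrite (bigD1 (Ordinal hlt))//= lerDl sumr_ge0.
    by rewrite /M; lra.
  have h3 : (n %/ m)%:R <= n%:R / m%:R :> R.
    by rewrite ler_pdivlMr// -natrM ler_nat leq_divM.
  rewrite ler_pdivrMr// mulrDl [M / _ * _]divfK ?gt_eqF//.
  apply: le_trans h _; rewrite lerD2r.
  apply: le_trans (ler_wpM2r (b0 m) h3) _.
  by rewrite le_eqVlt; apply/orP; left; apply/eqP; ring.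
by rewrite distrC ger0_norm; lra.
Unshelve. all: by end_near.
Qed.

Lemma cvg_of_sqrt_rate (u : nat -> R) (K L : R) :
  (forall n, (0 < n)%N -> `|u n - L| <= K / Num.sqrt n%:R) -> u @ \oo --> L.
Proof.
move=> hu; apply/cvgrPdist_le => e e0.
near=> n; have n0 : (0 < n)%N by near: n; exact: nbhs_infty_gt.
rewrite distrC; apply: le_trans (hu n n0) _.
have n0' : 0 < Num.sqrt n%:R :> R by rewrite sqrtr_gt0 ltr0n.
have hn : (`|K| / e) ^+ 2 <= n%:R by near: n; exact: nbhs_infty_ger.
rewrite ler_pdivrMr//; apply: le_trans (ler_norm _) _.
rewrite mulrC -ler_pdivrMr//.
have ke0 : 0 <= `|K| / e by rewrite divr_ge0// ltW.
by rewrite -(ger0_norm ke0) -sqrtr_sqr ler_wsqrtr.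
Unshelve. all: by end_near.
Qed.

(** Serves to bound [(1 + v)^n - 1 - n v], the second moment of [second_order], by [(n v)^2]. *)
Lemma one_plus_expn (v : R) n : 0 <= v -> n%:R * v <= 1 ->
  (1 + v) ^+ n <= 1 + n%:R * v + (n%:R * v) ^+ 2.
Proof.
move=> v0; elim: n => [|n ih] h; first by rewrite expr0 mul0r expr2; lra.
have nv0 : 0 <= n%:R * v by rewrite mulr_ge0.
rewrite -natr1 mulrDl mul1r in h *.
have := ih ltac:(lra) => {}ih.
rewrite exprSr; apply: le_trans (ler_wpM2r _ ih) _; first by lra.
set y := n%:R * v in h nv0 *.
rewrite -subr_ge0 (_ : _ - _ = v * (y * (1 - y) + v)); last by ring.
by rewrite mulr_ge0// addr_ge0// mulr_ge0//; lra.
Qed.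

End RealSequences.

(** * Variance and covariance of an independent sum with a correction term *)

Section Defect.
Context {R : realType} {T U : choiceType}.

Definition var {T : choiceType} (p f : T -> R) : R :=
  Ex p (fun x => (f x - Ex p f) ^+ 2).

Variables (p : T -> R) (q : U -> R).
Hypotheses (hp : is_prob p) (hq : is_prob q).
Variables (f : T -> R) (g : U -> R) (h : T * U -> R).
Hypotheses (f2 : integ p (fun x => f x ^+ 2)) (g2 : integ q (fun y => g y ^+ 2)).
Hypothesis h2 : integ (prodw p q) (fun z => h z ^+ 2).

Let p0 x : 0 <= p x. Proof. by have [] := hp. Qed.
Let q0 x : 0 <= q x. Proof. by have [] := hq. Qed.
Let ps : asummable p. Proof. by have [] := hp. Qed.
Let qs : asummable q. Proof. by have [] := hq. Qed.
Let f1 : integ p f. Proof. exact: integ_le_sqr. Qed.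
Let g1 : integ q g. Proof. exact: integ_le_sqr. Qed.
Let pqP := is_prob_prodw hp hq.
Let pq0 z : 0 <= prodw p q z. Proof. by have [] := pqP. Qed.
Let pqs : asummable (prodw p q). Proof. by have [] := pqP. Qed.
Let h1 : integ (prodw p q) h. Proof. exact: integ_le_sqr. Qed.

(** The shape of the length of a concatenated path: [f] and [g] are the lengths of the two pieces
    and [h] is the Gromov product at the junction. *)
Let k z := f z.1 + g z.2 - 2 * h z.

Lemma Ex_defect : Ex (prodw p q) k = Ex p f + Ex q g - 2 * Ex (prodw p q) h.
Proof.
have i1 := integ_fst hq f1; have i2 := integ_snd hp g1.
rewrite ExB; [|exact: integD|exact: integZ].
by rewrite ExD// ExZ// Ex_fst// Ex_snd.
Qed.

Lemma var_le_sqr (S : choiceType) (r u : S -> R) : is_prob r ->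
  integ r (fun x => u x ^+ 2) -> var r u <= Ex r (fun x => u x ^+ 2).
Proof.
move=> hr u2; have [r0 rs r1] := hr; rewrite /var.
have u1 := integ_le_sqr rs u2.
rewrite (@eq_Ex _ _ _ _ (fun x => u x ^+ 2 - (2 * Ex r u * u x - Ex r u ^+ 2))).
  rewrite ExB//; last by apply: integB; [exact: integZ|exact: integ_cst].
  rewrite ExB; [|exact: integZ|exact: integ_cst].
  rewrite ExZ// (Ex_cst _ hr).
  by have := sqr_ge0 (Ex r u); rewrite expr2; lra.
by move=> x _; ring.
Qed.

(** Minkowski separates the centred independent sum, whose cross term vanishes, from the correction,
    whose variance is at most its second moment. *)
Lemma sqrt_var_defect : Num.sqrt (var (prodw p q) k) <=
  Num.sqrt (var p f + var q g) + 2 * Num.sqrt (Ex (prodw p q) (fun z => h z ^+ 2)).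
Proof.
have c1 : integ p (fun x => (f x - Ex p f) ^+ 2).
  by apply: integ_sqrB => //; exact: integ_cst.
have c2 : integ q (fun x => (g x - Ex q g) ^+ 2).
  by apply: integ_sqrB => //; exact: integ_cst.
have i1 := integ_fst hq c1; have i2 := integ_snd hp c2.
have i3 : integ (prodw p q) (fun z => (h z - Ex (prodw p q) h) ^+ 2).
  by apply: integ_sqrB => //; exact: integ_cst.
have -> : var (prodw p q) k = Ex (prodw p q) (fun z =>
    ((f z.1 - Ex p f) + (g z.2 - Ex q g) + - 2 * (h z - Ex (prodw p q) h)) ^+ 2).
  apply: eq_Ex => z _; rewrite Ex_defect /k; congr (_ ^+ 2); ring.
apply: le_trans (minkowski pq0 (integ_sqrD i1 i2) (integ_sqrZ (-2) i3)) _.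
apply: lerD.
  rewrite (Ex_sqrD i1 i2) (Ex_fst hq c1) (Ex_snd hp c2).
  rewrite (@Ex_prodwM _ _ _ _ _ (fun x => f x - Ex p f) (fun y => g y - Ex q g)).
  - rewrite (ExB f1 (integ_cst _ ps)) (Ex_cst _ hp) subrr mul0r mulr0 addr0.
    exact: lexx.
  - by apply: integB => //; exact: integ_cst.
  - by apply: integB => //; exact: integ_cst.
rewrite (@eq_Ex _ _ _ _ (fun z => 4 * (h z - Ex (prodw p q) h) ^+ 2)); last first.
  by move=> z _; ring.
rewrite ExZ// sqrtrM// (_ : Num.sqrt 4 = 2); last first.
  by rewrite (_ : 4 = 2 ^+ 2) ?sqrtr_sqr ?ger0_norm//; ring.
by rewrite ler_pM2l// ler_wsqrtr// (var_le_sqr pqP h2).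
Qed.

(** The mixed products [f S'] and [g S] have mean zero by independence and centring, so additivity
    fails only through [h]. *)
Lemma cov_defect (S : T -> R) (S' : U -> R) :
  integ p (fun x => S x ^+ 2) -> integ q (fun y => S' y ^+ 2) ->
  Ex p S = 0 -> Ex q S' = 0 ->
  Ex (prodw p q) (fun z => k z * (S z.1 + S' z.2)) =
    Ex p (fun x => f x * S x) + Ex q (fun y => g y * S' y)
    - 2 * Ex (prodw p q) (fun z => h z * (S z.1 + S' z.2)).
Proof.
move=> S2 S2' S0 S0'.
have S1 := integ_le_sqr ps S2; have S1' := integ_le_sqr qs S2'.
have fS := integM f2 S2; have gS' := integM g2 S2'.
have i1 := integ_fst hq fS; have i2 := integ_snd hp gS'.
have i3 := integ_prodwM f1 S1'; have i4 := integ_prodwM S1 g1.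
have i5 : integ (prodw p q) (fun z => (S z.1 + S' z.2) ^+ 2).
  by apply: integ_sqrD; [have := integ_fst hq S2|have := integ_snd hp S2'].
have i6 := integM h2 i5.
rewrite (@eq_Ex _ _ _ _ (fun z => (f z.1 * S z.1 + g z.2 * S' z.2) +
  (f z.1 * S' z.2 + S z.1 * g z.2) - 2 * (h z * (S z.1 + S' z.2)))); last first.
  by move=> z _; rewrite /k; ring.
rewrite ExB; [|by apply: integD; apply: integD|exact: integZ].
rewrite ExD; [|exact: integD..].
rewrite ExD// ExD// ExZ// (Ex_fst hq fS) (Ex_snd hp gS').
by rewrite Ex_prodwM// Ex_prodwM// S0 S0' mulr0 mul0r !addr0.
Qed.

End Defect.

(** * Moments of sums of centred independent increments *)

Section IidSums.
Context {R : realType} {G : groupType}.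
Implicit Types (mu f : G -> R).

Definition ssum f (s : seq G) : R := \sum_(a <- s) f a.

Lemma ssum_cat f s t : ssum f (s ++ t) = ssum f s + ssum f t.
Proof. exact: big_cat. Qed.

Lemma EP0 mu F : EP mu 0 F = F [::].
Proof.
rewrite /EP /Ex; have [_ ->] := tsum_tuple0 (fun x => path_prob mu x * F x).
by rewrite path_prob0 mul1r.
Qed.

Lemma integP0 mu F : integP mu 0 F.
Proof. by have [] := tsum_tuple0 (fun x => path_prob mu x * F x). Qed.

Lemma iid_sum mu f n : is_prob mu -> integ mu (fun a => f a ^+ 2) ->
  Ex mu f = 0 ->
  [/\ integP mu n (fun s => ssum f s ^+ 2), EP mu n (ssum f) = 0
    & EP mu n (fun s => ssum f s ^+ 2) = n%:R * Ex mu (fun a => f a ^+ 2)].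
Proof.
move=> hmu f2 f0; have [mu0 mus mu1] := hmu; have f1 := integ_le_sqr mus f2.
elim: n => [|n [i2 e1 e2]].
  split; first exact: integP0.
  - by rewrite EP0 /ssum big_nil.
  - by rewrite EP0 /ssum big_nil expr2 !mul0r.
have hP := is_prob_path n hmu; have [p0 ps _] := hP.
have i1 := integ_le_sqr ps i2.
have j1 := integ_fst hP f2.
have j2 : integ (prodw mu (@path_prob R G mu n)) (fun z => ssum f z.2 ^+ 2).
  exact: (integ_snd hmu i2).
have E (z : G * n.-tuple G) : ssum f (z.1 :: z.2) = f z.1 + ssum f z.2.
  by rewrite /ssum big_cons.
split.
- by apply/integP_cons; under eq_fun do rewrite E; apply: integ_sqrD.
- rewrite EP_cons (@eq_Ex _ _ _ _ (fun z : G * _.-tuple G => f z.1 + ssum f z.2)) => [|z _].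
    rewrite ExD; [|exact: integ_fst|exact: (integ_snd hmu i1)].
    rewrite Ex_fst// f0 add0r -[RHS]e1; exact: (Ex_snd hmu i1).
  exact: E.
- rewrite EP_cons (@eq_Ex _ _ _ _ (fun z : G * _.-tuple G => (f z.1 + ssum f z.2) ^+ 2)) => [|z _].
    rewrite (Ex_sqrD j1 j2) (Ex_fst hP f2).
    have -> : Ex (prodw mu (@path_prob R G mu n)) (fun z => ssum f z.2 ^+ 2) =
       n%:R * Ex mu (fun a => f a ^+ 2) by rewrite -e2; exact: (Ex_snd hmu i2).
    have -> : Ex (prodw mu (@path_prob R G mu n)) (fun z => f z.1 * ssum f z.2) = 0.
      by rewrite (Ex_prodwM f1 i1) f0 mul0r.
    by rewrite -natr1; ring.
  by rewrite E.
Qed.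

End IidSums.

(** * Change of measure on paths and its first-order expansion *)

Section Tilting.
Context {R : realType} {G : groupType}.
Variables (mu mu' Y : G -> R) (eta : R).
Hypotheses (hmu : is_prob mu) (hmu' : is_prob mu').
Hypothesis (hY : forall a, mu' a = mu a * (1 + Y a)).
Hypothesis (Yeta : forall a, `|Y a| <= eta).

Let mu0 a : 0 <= mu a. Proof. by have [] := hmu. Qed.
Let mus : asummable mu. Proof. by have [] := hmu. Qed.
Let eta0 : 0 <= eta. Proof. exact: le_trans (Yeta 1%g). Qed.

Definition likelihood (s : seq G) : R := \prod_(a <- s) (1 + Y a).

Lemma path_prob_tilt n (x : n.-tuple G) :
  path_prob mu' x = path_prob mu x * likelihood x.
Proof. by rewrite !path_probE /likelihood -big_split; apply: eq_bigr => a _; exact: hY. Qed.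

Lemma EP_tilt n F : EP mu' n F = EP mu n (fun s => likelihood s * F s).
Proof. by apply: eq_tsum => x; rewrite path_prob_tilt mulrA. Qed.

Lemma likelihood_le s : `|likelihood s| <= (1 + eta) ^+ size s.
Proof.
rewrite /likelihood; elim: s => [|a s ih]; first by rewrite big_nil normr1.
rewrite big_cons normrM exprS ler_pM//.
by apply: le_trans (ler_normD _ _) _; rewrite normr1 lerD2l.
Qed.

Lemma Y_integ : integ mu Y. Proof. exact: (integ_bounded (C := eta)). Qed.

Lemma Y2_integ : integ mu (fun a => Y a ^+ 2).
Proof.
apply: (integ_bounded (C := eta ^+ 2)) => // a _.
by rewrite normrX lerXn2r ?nnegrE.
Qed.

Lemma Ex_Y : Ex mu Y = 0.
Proof.
have [_ _ m1] := hmu'; have [_ _ m2] := hmu.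
have : tsum mu' = Ex mu (fun a => 1 + Y a) by apply: eq_tsum => a; exact: hY.
rewrite ExD; [|exact: integ_cst|exact: Y_integ].
by rewrite (Ex_cst _ hmu) m1; lra.
Qed.

Let v := Ex mu (fun a => Y a ^+ 2).

(** The terms of degree at least two in the expansion of the product of the factors [1 + Y]. *)
Definition second_order (s : seq G) : R := likelihood s - 1 - ssum Y s.

Lemma likelihood_bounded n : exists C, forall x : n.-tuple G, `|likelihood x| <= C.
Proof.
by exists ((1 + eta) ^+ n) => x; have := likelihood_le x; rewrite size_tuple.
Qed.

Lemma likelihood2_integ n : integP mu n (fun s => likelihood s ^+ 2).
Proof.
have [C hC] := likelihood_bounded n; have [_ ps _] := is_prob_path n hmu.
apply: (integ_bounded (C := C ^+ 2)) => // x _.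
by rewrite normrX lerXn2r ?nnegrE// (le_trans _ (hC x)).
Qed.

Lemma second_order2_integ n : integP mu n (fun s => second_order s ^+ 2).
Proof.
have [_ ps _] := is_prob_path n hmu.
apply: integ_sqrB; last by have [] := iid_sum n hmu Y2_integ Ex_Y.
by apply: integ_sqrB; [exact: likelihood2_integ|exact: integ_cst].
Qed.

Lemma EP_likelihood n : EP mu n likelihood = 1.
Proof.
have [_ _ <-] := is_prob_path n hmu'.
by apply: eq_tsum => x; rewrite path_prob_tilt.
Qed.

Lemma EP_likelihood_sqr n :
  EP mu n (fun s => (likelihood s - 1) ^+ 2) = (1 + v) ^+ n - 1.
Proof.
have sq k : EP mu k (fun s => likelihood s ^+ 2) = (1 + v) ^+ k.
  elim: k => [|k ih]; first by rewrite EP0 /likelihood big_nil !expr1n expr0.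
  have hP := is_prob_path k hmu.
  have i : integ mu (fun a => (1 + Y a) ^+ 2).
    by apply: integ_sqrD; [exact: integ_cst|exact: Y2_integ].
  rewrite EP_cons exprS -ih.
  rewrite (@eq_Ex _ _ _ _ (fun z : G * _.-tuple G => (1 + Y z.1) ^+ 2 * likelihood z.2 ^+ 2)); last first.
    by move=> z _; rewrite /likelihood big_cons exprMn.
  rewrite (Ex_prodwM i (likelihood2_integ k)).
  congr (_ * _).
  rewrite Ex_sqrD; [|exact: integ_cst|exact: Y2_integ].
  rewrite (Ex_cst _ hmu) (@eq_Ex _ _ _ (fun x => 1 * Y x) Y) => [|x _].
    by rewrite Ex_Y; rewrite -/v; ring.
  by rewrite mul1r.
have hP := is_prob_path n hmu; have [p0 ps _] := hP.
have l2 := likelihood2_integ n; have l1 := integ_le_sqr ps l2.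
rewrite /EP (@eq_Ex _ _ _ _ (fun x : n.-tuple G => likelihood x ^+ 2 - (2 * likelihood x - 1))).
  rewrite ExB//; last by apply: integB; [exact: integZ|exact: integ_cst].
  rewrite ExB; [|exact: integZ|exact: integ_cst].
  rewrite ExZ// (Ex_cst _ hP) -/(EP mu n likelihood) EP_likelihood.
  by rewrite -/(EP mu n (fun s => likelihood s ^+ 2)) sq; ring.
by move=> x _; ring.
Qed.

(** Adding a first letter with excess [Y] changes the remainder by [Y (L - 1)], where [L] is the
    likelihood of the other letters. As [Y] is centred and independent of them, this increment is
    orthogonal to the old remainder. *)
Lemma EP_second_order n :
  EP mu n (fun s => second_order s ^+ 2) = (1 + v) ^+ n - 1 - n%:R * v.
Proof.
elim: n => [|n ih].
  by rewrite EP0 /second_order /likelihood /ssum !big_nil; ring.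
have hP := is_prob_path n hmu; have [p0 ps _] := hP.
have r2 := second_order2_integ n.
have l2 : integP mu n (fun s => (likelihood s - 1) ^+ 2).
  by apply: integ_sqrB; [exact: likelihood2_integ|exact: integ_cst].
have rl := integM r2 l2.
rewrite EP_cons (@eq_Ex _ _ _ _ (fun z : G * _.-tuple G => second_order z.2 ^+ 2 +
   Y z.1 * (2 * (second_order z.2 * (likelihood z.2 - 1))) +
   Y z.1 ^+ 2 * (likelihood z.2 - 1) ^+ 2)); last first.
  move=> z _; rewrite /second_order /likelihood /ssum !big_cons; ring.
have i1 : integ (prodw mu (@path_prob R G mu n)) (fun z => second_order z.2 ^+ 2).
  exact: (integ_snd hmu r2).
have i2 : integ (prodw mu (@path_prob R G mu n))
    (fun z => Y z.1 * (2 * (second_order z.2 * (likelihood z.2 - 1)))).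
  exact: (integ_prodwM Y_integ (integZ 2 rl)).
have i3 : integ (prodw mu (@path_prob R G mu n))
    (fun z => Y z.1 ^+ 2 * (likelihood z.2 - 1) ^+ 2).
  exact: (integ_prodwM Y2_integ l2).
rewrite ExD//; last exact: integD.
rewrite ExD//.
have -> : Ex (prodw mu (@path_prob R G mu n)) (fun z => second_order z.2 ^+ 2)
   = (1 + v) ^+ n - 1 - n%:R * v by rewrite -ih; exact: (Ex_snd hmu r2).
have -> : Ex (prodw mu (@path_prob R G mu n))
    (fun z => Y z.1 * (2 * (second_order z.2 * (likelihood z.2 - 1)))) = 0.
  by rewrite (Ex_prodwM Y_integ (integZ 2 rl)) Ex_Y mul0r.
rewrite (Ex_prodwM Y2_integ l2) -/v.
have -> : Ex (@path_prob R G mu n) (fun x => (likelihood x - 1) ^+ 2) =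
    (1 + v) ^+ n - 1 by exact: EP_likelihood_sqr.
by rewrite exprS -natr1; ring.
Qed.

(* Both sides are centred, so only the fluctuation of [F] enters. *)
Lemma EP_tilt_first_order n (F : seq G -> R) (nu : G -> R) :
  integP mu n (fun s => F s ^+ 2) ->
  integ mu (fun a => nu a ^+ 2) -> Ex mu nu = 0 ->
  n%:R * v <= 1 ->
  `|EP mu' n F - EP mu n F - EP mu n (fun s => F s * ssum nu s)| <=
    Num.sqrt (var (@path_prob R G mu n) (fun x => F x)) *
    (n%:R * v + Num.sqrt (n%:R * Ex mu (fun a => (Y a - nu a) ^+ 2))).
Proof.
move=> F2 nu2 nu0 nv1.
have hP := is_prob_path n hmu; have [p0 ps _] := hP.
have F1 := integ_le_sqr ps F2.
pose a := EP mu n F.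
(* This is [likelihood - 1 - ssum nu], split into the nonlinear remainder and the error made in
   replacing [Y] by [nu]. *)
pose Z s := second_order s + ssum (fun a => Y a - nu a) s.
have Ynu2 : integ mu (fun a => (Y a - nu a) ^+ 2).
  by apply: integ_sqrB => //; exact: Y2_integ.
have nu1 := integ_le_sqr mus nu2.
have Ynu0 : Ex mu (fun a => Y a - nu a) = 0.
  by rewrite ExB// ?Ex_Y ?nu0 ?subrr//; exact: Y_integ.
have [s1 s2 s3] := iid_sum n hmu Ynu2 Ynu0.
have [n1 n2 n3] := iid_sum n hmu nu2 nu0.
have r2 := second_order2_integ n.
have l2 := likelihood2_integ n; have l1 := integ_le_sqr ps l2.
have Fa : integP mu n (fun s => (F s - a) ^+ 2).
  by apply: integ_sqrB => //; exact: integ_cst.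
have -> : EP mu' n F - EP mu n F - EP mu n (fun s => F s * ssum nu s) =
   EP mu n (fun s => (F s - a) * Z s).
  have lF := integM l2 F2; have Fn := integM F2 n1.
  have Sn1 := integ_le_sqr ps n1.
  rewrite EP_tilt /EP -ExB// -ExB//; last exact: integB.
  rewrite [RHS](@eq_Ex _ _ _ _ (fun x : n.-tuple G => likelihood x * F x - F x - F x * ssum nu x -
     (a * likelihood x - a - a * ssum nu x))); last first.
    move=> x _; rewrite /Z /second_order.
    have -> : ssum (fun a => Y a - nu a) x = ssum Y x - ssum nu x.
      by rewrite /ssum -sumrB.
    ring.
  rewrite [RHS]ExB; last 2 first.
  - by apply: integB => //; apply: integB.
  - apply: integB; last exact: integZ.
    by apply: integB; [exact: integZ|exact: integ_cst].
  rewrite [X in _ = _ - X](_ : _ = 0) ?subr0//.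
  rewrite ExB; [|by apply: integB; [exact: integZ|exact: integ_cst]|exact: integZ].
  rewrite ExB; [|exact: integZ|exact: integ_cst].
  rewrite ExZ// ExZ// (Ex_cst _ hP).
  have -> : Ex (@path_prob R G mu n) (fun x => likelihood x) = 1 by exact: EP_likelihood.
  have -> : Ex (@path_prob R G mu n) (fun x => ssum nu x) = 0 by exact: n2.
  by ring.
apply: le_trans (cauchy_schwarz_sqrt p0 Fa (integ_sqrD r2 s1)) _.
rewrite ler_wpM2l ?sqrtr_ge0//.
apply: le_trans (minkowski p0 r2 s1) _; apply: lerD; last by rewrite -s3.
have v0 : 0 <= v by apply: Ex_ge0 => // x _; exact: sqr_ge0.
have nv0 : 0 <= n%:R * v by rewrite mulr_ge0.
rewrite -[leRHS]ger0_norm// -sqrtr_sqr ler_wsqrtr//.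
have -> : Ex (@path_prob R G mu n) (fun x => second_order x ^+ 2) =
  (1 + v) ^+ n - 1 - n%:R * v by exact: EP_second_order.
by have := one_plus_expn v0 nv1; lra.
Qed.

End Tilting.

(** * Symmetric subadditive lengths along a random walk *)

Section LengthFunction.
Context {R : realType} {G : groupType}.
Variable len : G -> R.
Hypotheses (len_ge0 : forall x, 0 <= len x)
  (lenV : forall x, len x^-1%g = len x)
  (lenM : forall x y, len (x * y)%g <= len x + len y).

(** The Gromov product of the identity and [x y] seen from [x], for the left-invariant metric with
    length [len]. *)
Definition gprod (x y : G) : R := 2^-1 * (len x + len y - len (x * y)%g).

Lemma gprod_ge0 x y : 0 <= gprod x y.
Proof. by rewrite /gprod mulr_ge0// subr_ge0. Qed.

Lemma gprod_le x y : gprod x y <= len x.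
Proof.
have := lenM x^-1 (x * y); rewrite mulKg lenV /gprod; lra.
Qed.

Definition wlen (s : seq G) : R := len (wprod s).

Variable mu : G -> R.
Hypotheses (hmu : is_prob mu) (len2 : integ mu (fun x => len x ^+ 2)).

Local Notation PP n := (@path_prob R G mu n).

Let mu0 x : 0 <= mu x. Proof. by have [] := hmu. Qed.
Let mus : asummable mu. Proof. by have [] := hmu. Qed.

Lemma len2_conv_pow n : integ (conv_pow mu n) (fun x => len x ^+ 2).
Proof.
elim: n => [|n ih].
  have [x /negbTE e|//] := @tsum_delta _ _ (fun x => conv_pow mu 0 x * len x ^+ 2) 1%g.
  by rewrite /conv_pow/= e mul0r.
have hn := is_prob_conv_pow n hmu.
rewrite conv_powS; apply/integ_conv => //.
have i1 := integ_fst hn len2; have i2 := integ_snd hmu ih.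
apply: le_integ (integ_sqrD i1 i2) => z _.
by rewrite !normrX lerXn2r ?nnegrE// !ger0_norm// addr_ge0.
Qed.

Lemma wlen2_integ n : integP mu n (fun s => wlen s ^+ 2).
Proof. exact/(integ_walk n (fun x => len x ^+ 2) hmu)/len2_conv_pow. Qed.

Definition gprod_path n m (z : n.-tuple G * m.-tuple G) : R :=
  gprod (wprod z.1) (wprod z.2).

Lemma wlen_cat n m (z : n.-tuple G * m.-tuple G) :
  wlen (z.1 ++ z.2) = wlen z.1 + wlen z.2 - 2 * gprod_path z.
Proof. by rewrite /wlen /gprod_path /gprod wprod_cat; lra. Qed.

Lemma gprod2_integ n m : integ (prodw (PP n) (PP m)) (fun z => gprod_path z ^+ 2).
Proof.
have hn := is_prob_path n hmu; have hm := is_prob_path m hmu.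
apply: le_integ (integ_fst hm (wlen2_integ n)) => z _.
have g0 : 0 <= gprod_path z by exact: gprod_ge0.
have l0 : 0 <= wlen z.1 by exact: len_ge0.
by rewrite !normrX lerXn2r ?nnegrE// !ger0_norm//; exact: gprod_le.
Qed.

Definition mean_len n : R := EP mu n wlen.

Lemma mean_len_ge0 n : 0 <= mean_len n.
Proof.
have [p0 _ _] := is_prob_path n hmu.
by apply: Ex_ge0 => // x _; exact: len_ge0.
Qed.

Lemma mean_lenD n m : mean_len (n + m) =
  mean_len n + mean_len m - 2 * Ex (prodw (PP n) (PP m)) (@gprod_path n m).
Proof.
have hn := is_prob_path n hmu; have hm := is_prob_path m hmu.
rewrite {1}/mean_len EP_cat.
rewrite -(Ex_defect hn hm (wlen2_integ n) (wlen2_integ m) (gprod2_integ n m)).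
by apply: eq_Ex => z _; exact: wlen_cat.
Qed.

Lemma Ex_gprod_ge0 n m : 0 <= Ex (prodw (PP n) (PP m)) (@gprod_path n m).
Proof.
have hn := is_prob_path n hmu; have hm := is_prob_path m hmu.
have [p0 _ _] := is_prob_prodw hn hm.
by apply: Ex_ge0 => // z _; exact: gprod_ge0.
Qed.

Lemma speed_rate (C : R) : 0 <= C ->
  (forall n m, Ex (prodw (PP n) (PP m)) (@gprod_path n m) <= C) ->
  exists L : R, forall n, (0 < n)%N -> `|mean_len n / n%:R - L| <= 6 * C / n%:R.
Proof.
move=> C0 hC.
have [L hL] : exists L : R, forall n, (0 < n)%N ->
    `|mean_len n / n%:R - L| <= 3 * (2 * C / n%:R).
  apply: (@almost_additive _ mean_len (fun=> 2 * C)) => //.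
  - by move=> _; rewrite mulr_ge0.
  - by move=> _; lra.
  - move=> n m; rewrite mean_lenD; have := Ex_gprod_ge0 n m; have := hC n m.
    set e := Ex _ _ => h1 h2.
    rewrite (_ : _ - _ - _ = - (2 * e)); last by ring.
    by rewrite normrN ger0_norm; lra.
by exists L => n n0; apply: le_trans (hL n n0) _; lra.
Qed.

Section SecondMoment.
Variable C2 : R.
Hypothesis hC2 : forall n m,
  Ex (prodw (PP n) (PP m)) (fun z => gprod_path z ^+ 2) <= C2.

(** By [sqrt_var_defect], doubling the time multiplies the standard deviation by at most [sqrt 2],
    up to an additive constant; along powers of two this gives linear growth of the variance. *)
Lemma var_dyadic : exists2 V : R, 0 <= V &
  forall k, var (PP (2 ^ k)) (fun x => wlen x) <= V * (2 ^ k)%:R.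
Proof.
pose v n := var (PP n) (fun x => wlen x).
have v0 n : 0 <= v n.
  have [p0 _ _] := is_prob_path n hmu.
  by apply: Ex_ge0 => // x _; exact: sqr_ge0.
pose r : R := Num.sqrt 2.
have r2 : r ^+ 2 = 2 by rewrite sqr_sqrtr.
have r0 : 0 <= r by exact: sqrtr_ge0.
have r1 : 1 < r by rewrite -sqrtr1 ltr_sqrt// ltr1n.
pose c := 2 * Num.sqrt C2.
have c0 : 0 <= c by rewrite mulr_ge0// sqrtr_ge0.
have step n : Num.sqrt (v (n + n)%N) <= r * Num.sqrt (v n) + c.
  have hn := is_prob_path n hmu.
  have -> : v (n + n)%N = var (prodw (PP n) (PP n))
      (fun z => wlen z.1 + wlen z.2 - 2 * gprod_path z).
    rewrite /v /var -/(EP mu (n + n) wlen).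
    have -> : EP mu (n + n) wlen = Ex (prodw (PP n) (PP n))
        (fun z => wlen z.1 + wlen z.2 - 2 * gprod_path z).
      by rewrite EP_cat; apply: eq_Ex => z _; exact: wlen_cat.
    set e := Ex (prodw _ _) _.
    rewrite -/(EP mu (n + n) (fun s => (wlen s - e) ^+ 2)) EP_cat.
    by apply: eq_Ex => z _; rewrite wlen_cat.
  apply: le_trans (sqrt_var_defect hn hn (wlen2_integ n) (wlen2_integ n) (gprod2_integ n n)) _.
  apply: lerD; last by rewrite ler_pM2l// ler_wsqrtr.
  rewrite -/(v n) (_ : v n + v n = 2 * v n); last by ring.
  by rewrite sqrtrM.
(* [w] solves [r w = w + c], so the standard deviation plus [w] is multiplied by at most [r] at each
   doubling. *)
pose w := c / (r - 1); pose A := Num.sqrt (v 1%N) + w.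
have w0 : 0 <= w by rewrite divr_ge0// subr_ge0 ltW.
have bound k : Num.sqrt (v (2 ^ k)%N) + w <= A * r ^+ k.
  elim: k => [|k ih]; first by rewrite expn0 expr0 mulr1.
  rewrite expnS mul2n -addnn.
  have := step (2 ^ k)%N.
  have hw : r * w = w + c by rewrite /w; field; rewrite subr_eq0 gt_eqF.
  have := ler_wpM2l r0 ih; rewrite mulrDr hw exprS mulrCA.
  by lra.
exists (A ^+ 2); first exact: sqr_ge0.
move=> k; rewrite -/(v _) natrX -r2 -exprM mulnC exprM -exprMn.
rewrite -[leLHS]sqr_sqrtr// lerXn2r ?nnegrE ?sqrtr_ge0//.
  by rewrite mulr_ge0 ?exprn_ge0// addr_ge0// sqrtr_ge0.
by have := bound k; lra.
Qed.

Definition cov_len (nu : G -> R) n : R := EP mu n (fun s => wlen s * ssum nu s).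

(** By [cov_defect] and Cauchy-Schwarz, the covariance is additive up to a defect of order
    [sqrt (n + m)]; the growth condition of [almost_additive] holds since [sqrt 2 <= 3/2]. *)
Lemma cov_rate (nu : G -> R) : integ mu (fun a => nu a ^+ 2) -> Ex mu nu = 0 ->
  exists K : R, exists L : R, forall n, (0 < n)%N ->
    `|cov_len nu n / n%:R - L| <= K / Num.sqrt n%:R.
Proof.
move=> nu2 nu0; set s2 := Ex mu (fun a => nu a ^+ 2).
have s20 : 0 <= s2 by apply: Ex_ge0 => // x _; exact: sqr_ge0.
pose K := 2 * (Num.sqrt C2 * Num.sqrt s2).
have K0 : 0 <= K by rewrite !mulr_ge0// sqrtr_ge0.
have [L hL] : exists L : R, forall n, (0 < n)%N ->
    `|cov_len nu n / n%:R - L| <= 3 * (K * Num.sqrt n%:R / n%:R).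
  apply: (@almost_additive _ (cov_len nu) (fun n => K * Num.sqrt n%:R)).
  - by move=> n; rewrite mulr_ge0// sqrtr_ge0.
  - by move=> n m nm; rewrite ler_wpM2l// ler_wsqrtr// ler_nat.
  - move=> n; rewrite -mul2n natrM sqrtrM// mulrCA ler_wpM2r//.
      by rewrite mulr_ge0// sqrtr_ge0.
    rewrite -[leRHS]ger0_norm; last lra.
    by rewrite -sqrtr_sqr ler_wsqrtr//; lra.
  - move=> n m.
    have hn := is_prob_path n hmu; have hm := is_prob_path m hmu.
    have [p0 _ _] := is_prob_prodw hn hm.
    have [n1 n2 n3] := iid_sum n hmu nu2 nu0.
    have [m1 m2 m3] := iid_sum m hmu nu2 nu0.
    have [t1 t2 t3] := iid_sum (n + m) hmu nu2 nu0.
    have g2 := gprod2_integ n m.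
    have -> : cov_len nu (n + m) - cov_len nu n - cov_len nu m =
      - (2 * Ex (prodw (PP n) (PP m))
         (fun z => gprod_path z * (ssum nu z.1 + ssum nu z.2))).
      rewrite {1}/cov_len EP_cat.
      rewrite (@eq_Ex _ _ _ _ (fun z : n.-tuple G * m.-tuple G =>
        (wlen z.1 + wlen z.2 - 2 * gprod_path z) * (ssum nu z.1 + ssum nu z.2))).
        rewrite (cov_defect hn hm (wlen2_integ n) (wlen2_integ m) g2 n1 m1 n2 m2).
        by rewrite /cov_len /EP; ring.
      by move=> z _; rewrite wlen_cat ssum_cat.
    rewrite normrN normrM ger0_norm// -mulrA ler_pM2l//.
    have S2 : integ (prodw (PP n) (PP m)) (fun z => (ssum nu z.1 + ssum nu z.2) ^+ 2).
      by move/integP_cat : t1; under eq_fun do rewrite ssum_cat.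
    apply: le_trans (cauchy_schwarz_sqrt p0 g2 S2) _.
    rewrite -mulrA ler_pM ?sqrtr_ge0// ?ler_wsqrtr// -sqrtrM// ler_wsqrtr//.
    rewrite mulrC -t3 EP_cat le_eqVlt; apply/orP; left; apply/eqP.
    by apply: eq_Ex => z _; rewrite ssum_cat.
exists (3 * K), L => n n0; apply: le_trans (hL n n0) _.
have n0' : 0 < Num.sqrt n%:R :> R by rewrite sqrtr_gt0 ltr0n.
rewrite -{2}(@sqr_sqrtr _ (n%:R : R))// le_eqVlt; apply/orP; left; apply/eqP.
by field; rewrite gt_eqF.
Qed.

End SecondMoment.

End LengthFunction.

(** * Shannon entropy, Gibbs' inequality and the asymptotic entropy *)

Section Entropy.
Context {R : realType}.

Definition finite_entropy {T : choiceType} (p : T -> R) : Prop :=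
  integ p (fun x => - ln (p x)).

Definition shannon {T : choiceType} (p : T -> R) : R := Ex p (fun x => - ln (p x)).

Lemma ln_le_sub1 (x : R) : 0 < x -> ln x <= x - 1.
Proof.
by move=> x0; have := @le_ln1Dx R (x - 1); rewrite (addrC 1) subrK; apply; lra.
Qed.

Lemma neg_ln_ge0 (T : choiceType) (p : T -> R) x : is_prob p -> 0 <= - ln (p x).
Proof. by move=> hp; rewrite oppr_ge0 ln_le0// prob_le1. Qed.

Lemma shannon_ge0 (T : choiceType) (p : T -> R) : is_prob p -> 0 <= shannon p.
Proof.
move=> hp; have [p0 _ _] := hp.
by apply: Ex_ge0 => // x _; exact: neg_ln_ge0.
Qed.

(** The inequality [ln u <= u - 1] at [u = q / p] bounds the entropy density pointwise by a summable
    family, so finiteness of the entropy comes together with the estimate. *)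
Lemma gibbs (T : choiceType) (p q : T -> R) : is_prob p ->
  (forall x, 0 <= q x) -> (forall x, p x != 0 -> 0 < q x) ->
  asummable q -> tsum q <= 1 ->
  integ p (fun x => - ln (q x)) ->
  finite_entropy p /\ shannon p <= Ex p (fun x => - ln (q x)).
Proof.
move=> hp q0 qpos qs q1 iq; have [p0 ps p1] := hp.
have pt x : p x * - ln (p x) <= p x * - ln (q x) + (q x - p x).
  have [->|px] := eqVneq (p x) 0; first by rewrite !mul0r subr0 add0r.
  have px0 : 0 < p x by rewrite lt_neqAle eq_sym px p0.
  have qx0 := qpos _ px.
  have := ln_le_sub1 (divr_gt0 qx0 px0); rewrite ln_div ?posrE// => h.
  have := ler_wpM2l (p0 x) h.
  have -> : p x * (q x / p x - 1) = q x - p x by field.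
  by lra.
have fe : finite_entropy p.
  apply: le_asummable (asummableD iq qs) => x.
  have e0 : 0 <= p x * - ln (p x) by rewrite mulr_ge0// neg_ln_ge0.
  rewrite (ger0_norm e0); apply: le_trans _ (ler_norm _).
  by apply: le_trans (pt x) _; rewrite lerD2l gerBl.
split=> //; have : shannon p <= tsum (fun x => p x * - ln (q x) + (q x - p x)).
  by apply: le_tsum => //; apply: asummableD => //; exact: asummableB.
rewrite tsumD//; last exact: asummableB.
rewrite tsumB// p1 -/(Ex p (fun x => - ln (q x))); lra.
Qed.

Context {G : groupType}.
Implicit Types mu nu : G -> R.

Lemma entropyE mu : is_prob mu -> finite_entropy mu -> entropy mu = (shannon mu)%:E.
Proof.
move=> hmu fe; have [mu0 _ _] := hmu.
rewrite /entropy /shannon /Ex -ge0_esumE//.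
  by apply: eq_esum => x _; rewrite mulrC.
by move=> x; rewrite mulr_ge0// neg_ln_ge0.
Qed.

Lemma convA (a b c : G -> R) : is_prob a -> is_prob b -> is_prob c ->
  conv (conv a b) c = conv a (conv b c).
Proof.
move=> ha hb hc; have hab := is_prob_conv ha hb; have hbc := is_prob_conv hb hc.
have [a0 as_ a1] := ha; have [b0 bs b1] := hb; have [c0 cs c1] := hc.
have [ab0 abs ab1] := hab; have [bc0 _ _] := hbc.
apply/funext => x.
have ic (p : G -> R) (e : G -> G) : asummable p -> integ p (fun y => c (e y)).
  move=> ps; apply: (integ_bounded (C := 1)) => // y _.
  by rewrite ger0_norm// prob_le1.
rewrite convE// -[LHS]/(Ex (conv a b) (fun y => c (y^-1 * x)%g)).
rewrite Ex_conv//; last exact: ic.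
have [_ pab _] := is_prob_prodw ha hb.
rewrite Ex_prodw; last first.
  apply: (integ_bounded (C := 1)) => // z _.
  by rewrite ger0_norm// prob_le1.
rewrite [RHS]convE//; apply: eq_tsum => y; congr (_ * _).
rewrite [RHS]convE//; apply: eq_tsum => z /=.
by rewrite invgM mulgA.
Qed.

Lemma conv_powD mu n m : is_prob mu ->
  conv_pow mu (n + m) = conv (conv_pow mu n) (conv_pow mu m).
Proof.
move=> hmu; have hn k := is_prob_conv_pow k hmu.
elim: n => [|n ih]; last by rewrite addSn !conv_powS ih convA.
have [h0 _ _] := hn 0%N; have [m0 _ _] := hn m.
apply/funext => x; rewrite convE//.
have [y /negbTE e|_ ->] := @tsum_delta _ _
    (fun y => conv_pow mu 0 y * conv_pow mu m (y^-1 * x)%g) 1%g.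
  by rewrite /conv_pow /= e mul0r.
by rewrite [X in _ = X * _]/conv_pow /= eqxx mul1r invg1 mul1g.
Qed.

(** At a product [x y] the convolution is at least the single term [mu x * nu y], and [- ln]
    reverses this pointwise bound. *)
Lemma shannon_conv mu nu : is_prob mu -> is_prob nu ->
  finite_entropy mu -> finite_entropy nu -> finite_entropy (conv mu nu) ->
  shannon (conv mu nu) <= shannon mu + shannon nu.
Proof.
move=> hmu hnu emu enu ec; have [mu0 mus _] := hmu; have [nu0 nus _] := hnu.
have hc := is_prob_conv hmu hnu; have [pq0 pqs _] := is_prob_prodw hmu hnu.
rewrite /shannon Ex_conv// -(Ex_fst hnu emu) -(Ex_snd hmu enu) -ExD; last 2 first.
- exact: (integ_fst hnu emu).
- exact: (integ_snd hmu enu).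
apply: le_Ex => //.
- exact/(integ_conv hmu hnu (fun x => - ln (conv mu nu x))).
- by apply: integD; [exact: (integ_fst hnu emu)|exact: (integ_snd hmu enu)].
move=> [x y]; rewrite /prodw /= => xy0.
have x0 : 0 < mu x.
  by rewrite lt_neqAle mu0 andbT eq_sym; apply: contra xy0 => /eqP ->; rewrite mul0r.
have y0 : 0 < nu y.
  by rewrite lt_neqAle nu0 andbT eq_sym; apply: contra xy0 => /eqP ->; rewrite mulr0.
rewrite -opprD lerN2 -lnM ?posrE// ler_ln ?posrE ?mulr_gt0//.
- rewrite convE//.
  have := @ge_term_tsum _ _ (fun z => mu z * nu (z^-1 * (x * y))%g) x.
  rewrite mulKg; apply=> [z|]; first by rewrite mulr_ge0.
  apply: le_asummable mus => z.
  by rewrite normrM ler_piMr// ger0_norm// prob_le1.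
- rewrite convE//.
  apply: lt_le_trans (_ : 0 < mu x * nu (x^-1 * (x * y))%g) _.
    by rewrite mulKg mulr_gt0.
  apply: (@ge_term_tsum _ _ (fun z => mu z * nu (z^-1 * (x * y))%g)) => [z|].
    by rewrite mulr_ge0.
  apply: le_asummable mus => z.
  by rewrite normrM ler_piMr// ger0_norm// prob_le1.
Qed.

Lemma entropy_rate_cvg mu : is_prob mu ->
  (forall n, finite_entropy (conv_pow mu n)) ->
  exists2 h : R, (fun n => shannon (conv_pow mu n) / n%:R) @ \oo --> h &
    [/\ entropy_rate mu @ \oo --> h%:E & asymptotic_entropy mu = h].
Proof.
move=> hmu fe; have hn k := is_prob_conv_pow k hmu.
have [h hh] : exists L : R, (fun n => shannon (conv_pow mu n) / n%:R) @ \oo --> L.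
  apply: fekete => [n|n m]; first exact: shannon_ge0.
  by rewrite conv_powD//; apply: shannon_conv => //; rewrite -conv_powD.
have E : entropy_rate mu = EFin \o (fun n => shannon (conv_pow mu n) / n%:R).
  by apply/funext => n; rewrite /entropy_rate entropyE//= -EFinM mulrC.
have cv : entropy_rate mu @ \oo --> h%:E.
  by rewrite E; apply: cvg_EFin => //; exact: nearW.
exists h => //; split=> //.
by rewrite /asymptotic_entropy (cvg_lim _ cv).
Qed.

End Entropy.

(** * The Green function, its metric, and entropy bounds in terms of length *)

Section GreenFunction.
Context {R : realType} {G : groupType}.
Implicit Types (x y z : G).

(** Time reversal: it preserves path weights for a symmetric [mu] and inverts the endpoint, whence
    the symmetry of convolution powers. *)
Definition rev_inv n (x : n.-tuple G) : n.-tuple G :=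
  [tuple of rev [tuple of map (fun a => a^-1)%g x]].

Lemma rev_invK n : involutive (@rev_inv n).
Proof.
move=> x; apply: val_inj; rewrite /= map_rev revK -map_comp.
by rewrite -[RHS]map_id; apply: eq_map => a /=; rewrite invgK.
Qed.

Lemma wprod_rev_inv n (x : n.-tuple G) : wprod (rev_inv x) = (wprod x)^-1%g.
Proof.
case: x => s /= _; elim: s => [|a s ih] /=.
  by rewrite /wprod !big_nil invg1.
by rewrite rev_cons -cats1 wprod_cat ih wprod_cons [in RHS]wprod_cons invgM /wprod big_nil mulg1.
Qed.

Variable mu : G -> R.
Hypothesis hmu : is_prob mu.
Hypothesis mu_sym : forall x, mu x = mu x^-1%g.

Lemma path_prob_rev_inv n (x : n.-tuple G) : path_prob mu (rev_inv x) = path_prob mu x.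
Proof.
rewrite !path_probE /= big_rev /= big_map; apply: eq_bigr => a _.
by rewrite -mu_sym.
Qed.

Lemma conv_pow_sym n x : conv_pow mu n x^-1%g = conv_pow mu n x.
Proof.
pose d (y z : G) : R := (z == y)%:R.
have hn := is_prob_conv_pow n hmu; have [n0 ns _] := hn.
have i y : integ (conv_pow mu n) (d y).
  by apply: (integ_bounded (C := 1)) => // z _; rewrite /d; case: eqP; rewrite ?normr1 ?normr0.
have E y : conv_pow mu n y = EP mu n (fun s => d y (wprod s)).
  rewrite EP_walk// /Ex.
  have [z /negbTE h|_ ->] := @tsum_delta _ _ (fun z => conv_pow mu n z * d y z) y.
    by rewrite /d h mulr0.
  by rewrite /d eqxx mulr1.
have b : bijective (@rev_inv n) by exists (@rev_inv n); exact: rev_invK.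
rewrite !E /EP /Ex [LHS](tsum_bij _ b); apply: eq_tsum => s.
by rewrite path_prob_rev_inv wprod_rev_inv /d (inj_eq invg_inj).
Qed.

Variable rho : R.
Hypothesis rho01 : 0 < rho < 1.
Hypothesis hrho : forall n x, conv_pow mu n x ^+ 2 <= rho ^+ n.

Let q := Num.sqrt rho.

Let q01 : 0 <= q < 1.
Proof.
case/andP: rho01 => r0 r1.
by rewrite sqrtr_ge0 /q -sqrtr1 ltr_sqrt.
Qed.

Let q0 : 0 <= q. Proof. by case/andP: q01. Qed.

Let cp0 n x : 0 <= conv_pow mu n x. Proof. by have [] := is_prob_conv_pow n hmu. Qed.

Lemma conv_pow_le n x : conv_pow mu n x <= q ^+ n.
Proof.
rewrite -(ler_pXn2r (n := 2))// ?nnegrE//; last exact: exprn_ge0.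
rewrite exprAC /q sqr_sqrtr ?hrho//.
by case/andP: rho01 => /ltW.
Qed.

Definition greenf x : R := tsum (fun n => conv_pow mu n x).

Definition green_tail n x : R := tsum (fun k => conv_pow mu (n + k) x).

Lemma asummable_green_tail n x : asummable (fun k => conv_pow mu (n + k) x).
Proof.
apply: le_asummable (asummableZ (q ^+ n) (asummable_geometric q01)) => k.
rewrite !ger0_norm ?mulr_ge0 ?exprn_ge0// -exprD; exact: conv_pow_le.
Qed.

Definition geom_sum : R := tsum (fun k => q ^+ k).

Lemma green_tail_le n x : green_tail n x <= q ^+ n * geom_sum.
Proof.
rewrite -tsumZ; last exact: asummable_geometric.
apply: le_tsum => [||k]; first exact: asummable_green_tail.
  exact/asummableZ/asummable_geometric.
by rewrite -exprD conv_pow_le.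
Qed.

Lemma green_tail_ge0 n x : 0 <= green_tail n x.
Proof. exact: tsum_ge0. Qed.

Lemma greenf_split n x :
  greenf x = \sum_(k < n) conv_pow mu k x + green_tail n x.
Proof.
by have [_ h] := tsum_split n (fun k => cp0 k x) (asummable_green_tail 0 x).
Qed.

Lemma greenf_ge0 x : 0 <= greenf x.
Proof. exact: tsum_ge0. Qed.

Lemma conv_pow_le_greenf n x : conv_pow mu n x <= greenf x.
Proof.
apply: (@ge_term_tsum _ _ (fun n => conv_pow mu n x)) => //.
exact: (asummable_green_tail 0).
Qed.

Lemma greenE x : green mu x = (greenf x)%:E.
Proof.
rewrite /green nneseries_esumT; last by move=> n; rewrite lee_fin.
by rewrite ge0_esumE//; exact: (asummable_green_tail 0).
Qed.

Lemma integ_green_tail n x : integ mu (fun y => green_tail n (y^-1 * x)%g).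
Proof.
have [mu0 mus mu1] := hmu.
apply: (integ_bounded (C := q ^+ n * geom_sum)) => // y _.
by rewrite ger0_norm ?green_tail_le// green_tail_ge0.
Qed.

(** For [n = 0] this says that the Green function is superharmonic, and harmonic away from the
    identity. *)
Lemma green_tailS n x :
  Ex mu (fun y => green_tail n (y^-1 * x)%g) = green_tail n.+1 x.
Proof.
have [mu0 mus mu1] := hmu.
have h : asummable (fun z : G * nat => mu z.1 * conv_pow mu (n + z.2) (z.1^-1 * x)%g).
  apply: le_asummable (asummableM mus (asummableZ (q ^+ n) (asummable_geometric q01))) => z.
  rewrite !normrM ler_wpM2l// ger0_norm// -normrM ger0_norm; last first.
    by rewrite mulr_ge0// exprn_ge0.
  by rewrite -exprD conv_pow_le.
rewrite /Ex (eq_tsum (g := fun y => tsum (fun k => mu y * conv_pow mu (n + k) (y^-1 * x)%g))).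
  rewrite (@tsum_exchange _ _ _ (fun y k => mu y * conv_pow mu (n + k) (y^-1 * x)%g))//.
  by apply: eq_tsum => k; rewrite addSn conv_powS convE.
by move=> y; rewrite tsumZ//; exact: asummable_green_tail.
Qed.

(* Domination principle: [r = max (c G - u) 0] is subharmonic and dominated by
   every [c * green_tail n], hence vanishes. *)
Lemma green_domination (u : G -> R) (c : R) : 0 <= c ->
  (forall x, 0 <= u x) ->
  (forall x, integ mu (fun y => u (y^-1 * x)%g)) ->
  (forall x, Ex mu (fun y => u (y^-1 * x)%g) <= u x) ->
  c * greenf 1%g <= u 1%g -> forall x, c * greenf x <= u x.
Proof.
move=> c0 u0 ui uS u1 x; have [mu0 mus mu1] := hmu.
have tail0 y : green_tail 0 y = greenf y by [].
pose r y := Num.max (c * greenf y - u y) 0.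
have rle n y : r y <= c * green_tail n y.
  elim: n y => [|n ih] y.
    rewrite /r ge_max tail0 mulr_ge0 ?greenf_ge0// andbT.
    by rewrite gerBl.
  rewrite /r ge_max mulr_ge0 ?green_tail_ge0// andbT.
  (* At the identity the excess is nonpositive by assumption; elsewhere the time-zero term vanishes,
     so [greenf] equals its own average and the induction applies under [mu]. *)
  have [->|y1] := eqVneq y 1%g.
    apply: (@le_trans _ _ 0); first by rewrite subr_le0.
    by rewrite mulr_ge0// green_tail_ge0.
  have -> : greenf y = green_tail 1 y.
    by rewrite (greenf_split 1) big_ord1 /conv_pow /= (negbTE y1) add0r.
  rewrite -green_tailS -ExZ; last exact: integ_green_tail.
  rewrite -(green_tailS n) -[leRHS]ExZ; last exact: integ_green_tail.
  apply: le_trans (lerB (lexx _) (uS y)) _.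
  have i1 := integZ c (integ_green_tail 0 y).
  rewrite -ExB//; apply: le_Ex => //.
  - exact: integB.
  - exact/integZ/integ_green_tail.
  - move=> z _; apply: le_trans (ih _).
    by rewrite /r le_max tail0 lexx.
have r0 : r x <= 0.
  have cv : (fun n => c * (q ^+ n * geom_sum)) @ \oo --> c * (0 * geom_sum).
    apply: cvgM; first exact: cvg_cst.
    apply: cvgM; last exact: cvg_cst.
    by apply: cvg_expr; rewrite ger0_norm//; case/andP: q01.
  rewrite mul0r mulr0 in cv; apply: (cvgr_to_ge cv).
  apply: nearW => n; apply: le_trans (rle n x) _.
  by rewrite ler_wpM2l// green_tail_le.
by move: r0; rewrite /r ge_max lexx andbT subr_le0.
Qed.

Lemma greenf1_ge1 : 1 <= greenf 1%g.
Proof. by apply: le_trans (conv_pow_le_greenf 0 _); rewrite /conv_pow /= eqxx. Qed.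

Lemma greenf_le1 x : greenf x <= greenf 1%g.
Proof.
rewrite -[leLHS]mul1r.
apply: (@green_domination (fun=> greenf 1%g)) => // *; last by rewrite mul1r.
- exact: greenf_ge0.
- by apply: integ_cst; have [] := hmu.
- by rewrite Ex_cst.
Qed.

(** As a function of [x] the right side is superharmonic and agrees with the left one at the
    identity, so the domination principle applies. Its logarithm is the triangle inequality for the
    Green metric. *)
Lemma greenfM x y : greenf x * greenf y <= greenf 1%g * greenf (x * y)%g.
Proof.
rewrite mulrC.
apply: (@green_domination (fun x => greenf 1%g * greenf (x * y)%g)) => //.
- exact: greenf_ge0.
- by move=> z; rewrite mulr_ge0// greenf_ge0.
- move=> z; apply: integZ; have := integ_green_tail 0 (z * y)%g.
  by under eq_fun do rewrite mulgA.
- move=> z; have := integ_green_tail 0 (z * y)%g => hi.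
  have h := green_tailS 0 (z * y)%g.
  rewrite (eq_Ex (g := fun s => greenf 1%g * green_tail 0 (s^-1 * (z * y))%g)).
    rewrite ExZ// h ler_wpM2l ?greenf_ge0//.
    by rewrite (greenf_split 1) big_ord1 lerDr.
  by move=> s _; rewrite mulgA.
- by rewrite mul1g mulrC.
Qed.

Lemma greenf_sym x : greenf x^-1%g = greenf x.
Proof. by apply: eq_tsum => n; rewrite conv_pow_sym. Qed.

Hypothesis gen : generates (supp mu).

Lemma greenf_gt0 x : 0 < greenf x.
Proof.
suff : [set x | 0 < greenf x] x by [].
have G1 : 0 < greenf 1%g by apply: lt_le_trans greenf1_ge1.
rewrite (@gen [set x | 0 < greenf x])//.
  split=> //= [y z hy hz|y hy]; last by rewrite greenf_sym.
  have := greenfM y z; move: (mulr_gt0 hy hz) => h /(lt_le_trans h).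
  by rewrite pmulr_rgt0.
move=> a /= ha; apply: lt_le_trans (conv_pow_le_greenf 1 a).
have [mu0 mus mu1] := hmu.
rewrite conv_powS convE//.
have [y ya|_ ->] := @tsum_delta _ _ (fun y => mu y * conv_pow mu 0 (y^-1 * a)%g) a.
  rewrite /conv_pow /= (_ : _ == _ = false) ?mulr0//.
  by apply/negbTE; apply: contra ya => /eqP h; rewrite -(mulVKg y a) h mulg1.
rewrite mulVg /conv_pow/= eqxx mulr1 lt_neqAle eq_sym mu0.
by rewrite andbT.
Qed.

Definition gdist x : R := ln (greenf 1%g) - ln (greenf x).

Lemma green_distE x y : green_dist mu x y = gdist (x^-1 * y)%g.
Proof. by rewrite /green_dist !greenE. Qed.

Lemma gdist_ge0 x : 0 <= gdist x.
Proof. by rewrite subr_ge0 ler_ln ?posrE ?greenf_gt0// greenf_le1. Qed.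

Lemma gdistV x : gdist x^-1%g = gdist x.
Proof. by rewrite /gdist greenf_sym. Qed.

Lemma gdistM x y : gdist (x * y)%g <= gdist x + gdist y.
Proof.
have h z := greenf_gt0 z.
have := greenfM x y; rewrite -ler_ln ?posrE ?mulr_gt0// !lnM ?posrE//.
by rewrite /gdist; lra.
Qed.


(** [w] is the normalised sum of [lam^k mu^k] with [lam = q^e]. The first [N] terms of the Green
    function already make up half of it once [N] is about [d / (- ln q)], and there the damping
    [lam^N] is [exp (- e d)] up to a constant factor. *)
Lemma greenf_superlevel (e : R) : 0 < e ->
  exists C, exists w : G -> R, [/\ forall x, 0 < w x, asummable w, tsum w <= 1
    & forall x, - ln (w x) <= (1 + e) * gdist x + C].
Proof.
move=> e0; have Gpos := greenf_gt0.
have q1 : q < 1 by case/andP: q01.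
have qpos : 0 < q by rewrite sqrtr_gt0; case/andP: rho01.
have lq : ln q < 0 by rewrite ln_lt0// qpos.
pose lam := expR (e * ln q).
have lam0 : 0 < lam := expR_gt0 _.
have lam1 : lam < 1.
  by rewrite -[X in _ < X]expR0 ltr_expR pmulr_rlt0.
have lam01 : 0 <= lam < 1 by rewrite ltW.
have lams := asummable_geometric lam01.
pose Z := tsum (fun k => lam ^+ k).
have Z0 : 0 < Z.
  apply: lt_le_trans ltr01 _; rewrite -(expr0 lam).
  by apply: (@ge_term_tsum _ _ (fun k => lam ^+ k)) => // k; rewrite exprn_ge0// ltW.
pose F (z : nat * G) := lam ^+ z.1 * conv_pow mu z.1 z.2.
have F0 (z : nat * G) : 0 <= F z by rewrite mulr_ge0// exprn_ge0// ltW.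
have hF : asummable F.
  apply: asummable_pair => [k|].
    by have [_ ps _] := is_prob_conv_pow k hmu; exact: (asummableZ (lam ^+ k) ps).
  apply: eq_asummable lams => k /=; have [_ ps p1] := is_prob_conv_pow k hmu.
  rewrite -[LHS]mulr1 -p1 -tsumZ//; apply: eq_tsum => x.
  by rewrite ger0_norm// (F0 (k, x)).
have hFs := asummable_swap hF.
pose gl x := tsum (fun k => lam ^+ k * conv_pow mu k x).
have gls : asummable gl := asummable_tsum hFs.
have rowx x : asummable (fun k => lam ^+ k * conv_pow mu k x) := asummable_row x hFs.
have glZ : tsum gl = Z.
  rewrite /gl (@tsum_exchange _ _ _ (fun x k => lam ^+ k * conv_pow mu k x))//.
  apply: eq_tsum => k; have [_ ps p1] := is_prob_conv_pow k hmu.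
  by rewrite tsumZ// p1 mulr1.
have key x N : q ^+ N * geom_sum <= greenf x / 2 -> lam ^+ N * (greenf x / 2) <= gl x.
  move=> hN; have h1 : greenf x / 2 <= \sum_(k < N) conv_pow mu k x.
    have := greenf_split N x; have := green_tail_le N x; lra.
  apply: le_trans (ler_wpM2l _ h1) _; first by rewrite exprn_ge0// ltW.
  rewrite mulr_sumr.
  have [_ h] := @tsum_split _ (fun k => lam ^+ k * conv_pow mu k x) N
    (fun k => F0 (k, x)) (rowx x).
  rewrite /gl h -[leLHS]addr0; apply: lerD; last first.
    by apply: tsum_ge0 => k; exact: (F0 (_, x)).
  apply: ler_sum => k _; rewrite ler_wpM2r//.
  by apply: ler_wiXn2l; [exact: ltW|exact: ltW|exact: ltnW].
have geom0 : 0 < geom_sum.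
  apply: lt_le_trans ltr01 _; rewrite -(expr0 q).
  by apply: (@ge_term_tsum _ _ (fun k => q ^+ k)) => // [k|];
    [exact: exprn_ge0|exact: asummable_geometric].
have G1 := Gpos 1%g.
(* Cost of passing from [q^N <= exp (- d)] to [q^N * geom_sum <= greenf x / 2]; the absolute value
   keeps [y] below nonnegative. *)
pose c1 := `|ln (2 * geom_sum) - ln (greenf 1%g)|.
have exN x : exists2 N : nat, q ^+ N * geom_sum <= greenf x / 2 &
    N%:R * - ln q <= gdist x + c1 - ln q.
  pose y := (gdist x + c1) / - ln q.
  have lq' : 0 < - ln q by rewrite oppr_gt0.
  have y0 : 0 <= y.
    apply: divr_ge0; last exact: ltW.
    by apply: addr_ge0; [exact: gdist_ge0|exact: normr_ge0].
  have yE : y * - ln q = gdist x + c1 by rewrite /y divfK// gt_eqF.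
  exists (Num.truncn y).+1; last first.
    have : (Num.truncn y).+1%:R <= y + 1.
      by rewrite -natr1 lerD2r truncn_le.
    by move=> /(ler_wpM2r (ltW lq')); rewrite mulrDl yE mul1r.
  have : y <= (Num.truncn y).+1%:R by apply: ltW; apply: truncnS_gt.
  move=> /(ler_wpM2r (ltW lq')); rewrite yE; set N := (Num.truncn y).+1 => h.
  have := ler_norm (ln (2 * geom_sum) - ln (greenf 1%g)); rewrite -/c1 => hc.
  rewrite -ler_ln ?posrE ?mulr_gt0 ?exprn_gt0 ?invr_gt0//.
  rewrite [leRHS]ln_div ?posrE// [leLHS]lnM ?posrE ?exprn_gt0// lnXn// -[_ *+ N]mulr_natl.
  move: hc h; rewrite lnM ?posrE// /gdist; lra.
have glpos x : 0 < gl x.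
  have [N hN _] := exN x; apply: lt_le_trans (key x N hN).
  by rewrite mulr_gt0 ?exprn_gt0// divr_gt0.
(* [ln Z] comes from normalising, [e * c1 - e * ln q] from the cut-off [N] and its rounding, [ln 2]
   from keeping half of the sum, and [ln (greenf 1)] from the definition of [gdist]. *)
exists (ln Z + e * c1 - e * ln q - ln (greenf 1%g) + ln 2), (fun x => Z^-1 * gl x).
split.
- by move=> x; rewrite mulr_gt0// invr_gt0.
- exact: asummableZ.
- by rewrite tsumZ// glZ mulVf// gt_eqF.
move=> x; have [N hN1 hN2] := exN x.
rewrite lnM ?posrE ?invr_gt0// lnV ?posrE//.
have : ln (lam ^+ N * (greenf x / 2)) <= ln (gl x).
  by rewrite ler_ln ?posrE ?key// mulr_gt0 ?exprn_gt0// divr_gt0.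
rewrite lnM ?posrE ?exprn_gt0 ?divr_gt0// ln_div ?posrE// lnXn// /lam expRK.
rewrite -[_ *+ N]mulr_natl => h.
have := ler_wpM2l (ltW e0) hN2.
move: h; rewrite /gdist; lra.
Qed.

(** [C] depends on [e] but not on [p]: applied to all convolution powers of a measure, it disappears
    after division by [n]. *)
Lemma shannon_le_mean (e : R) : 0 < e -> exists C, forall p : G -> R,
  is_prob p -> integ p gdist ->
  finite_entropy p /\ shannon p <= (1 + e) * Ex p gdist + C.
Proof.
move=> e0; have [C [w [w0 ws w1 hw]]] := greenf_superlevel e0.
exists C => p hp ip; have [p0 ps p1] := hp.
have w_le1 x : w x <= 1.
  by apply: le_trans w1; apply: ge_term_tsum => // y; exact: ltW.
have i1 : integ p (fun x => (1 + e) * gdist x + C).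
  by apply: integD; [exact: integZ|exact: integ_cst].
have iw : integ p (fun x => - ln (w x)).
  apply: le_integ i1 => x _.
  have h0 : 0 <= - ln (w x) by rewrite oppr_ge0 ln_le0.
  by rewrite (ger0_norm h0); apply: le_trans (ler_norm _).
have [fe h] := gibbs hp (fun x => ltW (w0 x)) (fun x _ => w0 x) ws w1 iw.
split=> //; apply: le_trans h _.
rewrite -ExZ// -(Ex_cst C hp) -ExD//; [|exact: integZ|exact: integ_cst].
by apply: le_Ex.
Qed.

(* Jensen's inequality for [ln] applied to the ratio
   [mu'^n (Z_n) / (G (Z_n) dP'/dP)], whose mean under [P'] is at most 1 as
   [mu^n <= G]; the log-likelihood is bounded by [ln (1 + Y) <= Y]. *)
Lemma mean_le_shannon (mu' Y : G -> R) (eta : R) n : is_prob mu' ->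
  (forall a, mu' a = mu a * (1 + Y a)) -> (forall a, `|Y a| <= eta) ->
  (forall a, 0 < 1 + Y a) ->
  integ (conv_pow mu' n) gdist -> finite_entropy (conv_pow mu' n) ->
  EP mu' n (wlen gdist) <= shannon (conv_pow mu' n) + ln (greenf 1%g)
    + n%:R * Ex mu (fun a => Y a ^+ 2).
Proof.
move=> hmu' hY Yeta Ypos ig fe.
have hP := is_prob_path n hmu'; have [P0 Ps P1] := hP.
have hc := is_prob_conv_pow n hmu'; have [c0 cs c1] := hc.
have [mu0 mus _] := hmu; have [mu0' mus' _] := hmu'.
have Gpos := greenf_gt0.
pose f z := conv_pow mu' n z / greenf z.
have f0 z : 0 <= f z by rewrite divr_ge0// greenf_ge0.
have cf z : conv_pow mu n z * f z <= conv_pow mu' n z.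
  rewrite /f mulrCA ler_piMr// ler_pdivrMr ?mul1r//.
  exact: conv_pow_le_greenf.
have if_ : integ (conv_pow mu n) f.
  apply: le_asummable cs => z; rewrite !ger0_norm//.
  by rewrite mulr_ge0//; have [] := is_prob_conv_pow n hmu.
have iP : integP mu n (fun s => f (wprod s)) by apply/integ_walk.
have EPf : EP mu n (fun s => f (wprod s)) <= 1.
  by rewrite EP_walk// -c1; apply: le_tsum.
have i1 : integP mu' n (fun s => - ln (conv_pow mu' n (wprod s))).
  exact/(integ_walk n (fun z => - ln (conv_pow mu' n z)) hmu').
have i2 : integP mu' n (wlen gdist) by apply/integ_walk.
have iY : integ mu' Y by apply: (integ_bounded (C := eta)).
(* [Y] is centred under [mu], so its mean under [mu' = mu (1 + Y)] is the chi-square divergence. *)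
have EY : Ex mu' Y = Ex mu (fun a => Y a ^+ 2).
  rewrite -[RHS]add0r -(Ex_Y hmu hmu' hY Yeta) -ExD.
  - by apply: eq_tsum => a; rewrite hY; ring.
  - exact: (Y_integ hmu Yeta).
  - exact: (Y2_integ hmu Yeta).
have [i3 e3] : integP mu' n (ssum Y) /\ EP mu' n (ssum Y) = n%:R * Ex mu (fun a => Y a ^+ 2).
  rewrite -EY; set c := Ex mu' Y.
  have iYc : integ mu' (fun a => (Y a - c) ^+ 2).
    apply: integ_sqrB; last exact: integ_cst.
    apply: (integ_bounded (C := eta ^+ 2)) => // a _.
    by rewrite normrX lerXn2r ?nnegrE// (le_trans _ (Yeta a)).
  have EYc : Ex mu' (fun a => Y a - c) = 0.
    by rewrite ExB ?(Ex_cst _ hmu') ?subrr//; exact: integ_cst.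
  have [s2 s1 _] := iid_sum n hmu' iYc EYc.
  have s2' := integ_le_sqr Ps s2.
  have E (x : n.-tuple G) : ssum Y x = ssum (fun a => Y a - c) x + n%:R * c.
    by rewrite /ssum sumrB big_const_seq count_predT size_tuple iter_addr_0 mulr_natl subrK.
  split.
    by rewrite /integP; under eq_fun do rewrite E; apply: integD => //; exact: integ_cst.
  rewrite /EP (@eq_Ex _ _ _ _ (fun x : n.-tuple G =>
    ssum (fun a => Y a - c) x + n%:R * c)); last by move=> x _; exact: E.
  rewrite ExD//; last exact: integ_cst.
  by rewrite (Ex_cst _ hP) [X in X + _](_ : _ = 0) ?add0r.
pose L := likelihood Y.
have Lpos s : 0 < L s by rewrite /L /likelihood; elim: s => [|a s ih]; rewrite ?big_nil// big_cons mulr_gt0.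
have lnL s : ln (L s) <= ssum Y s.
  rewrite /L /likelihood /ssum; elim: s => [|a s ih]; first by rewrite !big_nil ln1.
  have := Lpos s; rewrite /L /likelihood => Ls.
  rewrite !big_cons lnM ?posrE// lerD//.
  by apply: le_ln1Dx; have := Ypos a; lra.
have tilt (x : n.-tuple G) : path_prob mu' x = path_prob mu x * L x.
  exact: path_prob_tilt.
(* Division by the likelihood turns the expectation under [mu'] back into one under [mu], where
   [EPf] applies. *)
have ir : integP mu' n (fun s => f (wprod s) / L s).
  apply: eq_asummable iP => x; rewrite tilt.
  by field; rewrite gt_eqF// Lpos.
have Er : EP mu' n (fun s => f (wprod s) / L s) <= 1.
  apply: le_trans EPf; rewrite le_eqVlt; apply/orP; left; apply/eqP.
  by apply: eq_tsum => x; rewrite tilt; field; rewrite gt_eqF// Lpos.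
have main : EP mu' n (fun s => wlen gdist s - (- ln (conv_pow mu' n (wprod s)))
    - ssum Y s - ln (greenf 1%g)) <= EP mu' n (fun s => f (wprod s) / L s - 1).
  apply: le_Ex => //.
  - by apply: integB; [apply: integB => //; exact: integB|exact: integ_cst].
  - by apply: integB => //; exact: integ_cst.
  move=> x Px.
  (* The mass of the endpoint dominates the weight of the single path [x], which is positive. *)
  have cpos : 0 < conv_pow mu' n (wprod x).
    have hx := path_prob_gt0 mu0' Px.
    apply: lt_le_trans hx _.
    pose d (z : G) : R := (z == wprod x)%:R.
    have id : integ (conv_pow mu' n) d.
      apply: (integ_bounded (C := 1)) => // z _; rewrite /d.
      by case: eqP; rewrite ?normr1 ?normr0.
    have -> : conv_pow mu' n (wprod x) = EP mu' n (fun s => d (wprod s)).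
      rewrite EP_walk// /Ex.
      have [z /negbTE h|_ ->] := @tsum_delta _ _ (fun z => conv_pow mu' n z * d z) (wprod x).
        by rewrite /d h mulr0.
      by rewrite /d eqxx mulr1.
    have := @ge_term_tsum _ _ (fun y : n.-tuple G => path_prob mu' y * d (wprod y)) x.
    have dx : d (wprod x) = 1 by rewrite /d eqxx.
    rewrite dx mulr1; apply; last exact/(integ_walk n d hmu').
    by move=> y; rewrite mulr_ge0// /d ler0n.
  have fpos : 0 < f (wprod x) by rewrite divr_gt0.
  have := ln_le_sub1 (divr_gt0 fpos (Lpos x)).
  rewrite ln_div ?posrE// /f ln_div ?posrE//.
  have := lnL x; rewrite /wlen /gdist; lra.
move: main; rewrite /EP ExB//; last 2 first.
- by apply: integB => //; exact: integB.
- exact: integ_cst.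
rewrite ExB//; last exact: integB.
rewrite (ExB i2 i1) (Ex_cst _ hP) (ExB ir (integ_cst 1 Ps)) (Ex_cst _ hP).
have -> : Ex (@path_prob R G mu' n) (fun x : n.-tuple G => - ln (conv_pow mu' n (wprod x))) =
    shannon (conv_pow mu' n).
  exact: (@EP_walk _ _ mu' n (fun z => - ln (conv_pow mu' n z))).
move: Er e3; rewrite /EP => h1 h2; lra.
Qed.

End GreenFunction.

(** * Exponential estimates, limits at [0] from the right, dominated convergence *)

Section Exponential.
Context {R : realType}.

Lemma norm_expR_sub1 (w : R) : `|expR w - 1| <= `|w| * expR `|w|.
Proof.
have h1 := expR_ge1Dx w.
have h2 : expR w - 1 <= w * expR w.
  have := ler_wpM2l (expR_ge0 w) (expR_ge1Dx (- w)).
  by rewrite -expRD subrr expR0; lra.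
have [w0|w0] := leP 0 w; first by rewrite (ger0_norm w0) ger0_norm; lra.
have e1 : expR w <= 1 by rewrite -expR0 ler_expR ltW.
have e2 : 1 <= expR (- w) by rewrite -expR0 ler_expR; lra.
rewrite (ltr0_norm w0) ler0_norm; last lra.
have : - w * 1 <= - w * expR (- w) by apply: ler_wpM2l; lra.
lra.
Qed.

Lemma norm_expR_sub1D (w : R) : `|expR w - 1 - w| <= w ^+ 2 * expR `|w|.
Proof.
have h1 := expR_ge1Dx w.
have h2 : expR w - 1 <= w * expR w.
  have := ler_wpM2l (expR_ge0 w) (expR_ge1Dx (- w)).
  by rewrite -expRD subrr expR0; lra.
rewrite ger0_norm; last lra.
apply: (@le_trans _ _ (`|w| * `|expR w - 1|)).
  by rewrite -normrM; apply: le_trans (ler_norm _); lra.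
rewrite -[w ^+ 2]real_normK ?num_real// [X in _ <= X * _]expr2 -mulrA.
by rewrite ler_wpM2l// norm_expR_sub1.
Qed.

Lemma cvg0_sqrt (f : R -> R) :
  f @ 0^'+ --> (0 : R) -> (fun t => Num.sqrt (f t)) @ 0^'+ --> (0 : R).
Proof.
move=> hf; have h : (fun t => Num.sqrt (f t)) @ 0^'+ --> Num.sqrt (0 : R).
  by apply: continuous_cvg => //; exact: sqrt_continuous.
by rewrite sqrtr0 in h.
Qed.

Lemma cvg0_scale (c : R) (f : R -> R) :
  f @ 0^'+ --> (0 : R) -> (fun t => c * f t) @ 0^'+ --> (0 : R).
Proof.
move=> hf; have h : (fun t => c * f t) @ 0^'+ --> c * 0.
  by apply: cvgM => //; exact: cvg_cst.
by rewrite mulr0 in h.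
Qed.

Lemma cvg0_add (f g : R -> R) : f @ 0^'+ --> (0 : R) -> g @ 0^'+ --> (0 : R) ->
  (fun t => f t + g t) @ 0^'+ --> (0 : R).
Proof.
move=> hf hg; have h : (fun t => f t + g t) @ 0^'+ --> (0 + 0 : R) by exact: cvgD.
by rewrite addr0 in h.
Qed.

Lemma right0_id : (fun t : R => t) @ 0^'+ --> (0 : R).
Proof. by apply: cvg_within_filter; exact: cvg_id. Qed.

Lemma error_cvg0 (a b c d : R) (eta : R -> R) : eta @ 0^'+ --> (0 : R) ->
  (fun t => a * t + b * Num.sqrt t +
    c * (a * Num.sqrt (2 * Num.sqrt t) + Num.sqrt (eta t)) +
    d * Num.sqrt (Num.sqrt t)) @ 0^'+ --> (0 : R).
Proof.
move=> heta; have s1 := cvg0_sqrt right0_id; have s2 := cvg0_sqrt s1.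
have s3 := cvg0_sqrt (cvg0_scale 2 s1); have s4 := cvg0_sqrt heta.
have h1 := cvg0_add (cvg0_scale a right0_id) (cvg0_scale b s1).
have h2 := cvg0_scale c (cvg0_add (cvg0_scale a s3) s4).
exact: (cvg0_add (cvg0_add h1 h2) (cvg0_scale d s2)).
Qed.

Lemma near_all_seq {T : eqType} {S : Type} (F : set_system S) (s : seq T)
  (P : T -> S -> Prop) : Filter F ->
  (forall a, a \in s -> \forall t \near F, P a t) ->
  \forall t \near F, forall a, a \in s -> P a t.
Proof.
move=> FF; elim: s => [|a s ih] h; first exact: nearW.
have h1 : \forall t \near F, P a t by apply: h; rewrite inE eqxx.
have h2 : \forall t \near F, forall b, b \in s -> P b t.
  by apply: ih => b bs; apply: h; rewrite inE bs orbT.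
near=> t => b; rewrite inE => /orP[/eqP ->|bs].
  by near: t.
by move: b bs; near: t.
Unshelve. all: by end_near.
Qed.

(** A finite set of letters carries almost all the mass; pointwise convergence is uniform on it, and
    the bound [M] handles the rest. *)
Lemma dominated_sqr (T : choiceType) (p : T -> R) (F : R -> T -> R) (M : R) :
  is_prob p -> (forall t a, 0 < t <= 1 -> `|F t a| <= M) ->
  (forall a, p a != 0 -> F t a @[t --> 0^'+] --> (0 : R)) ->
  Ex p (fun a => F t a ^+ 2) @[t --> 0^'+] --> (0 : R).
Proof.
move=> hp FM F0; have [p0 ps p1] := hp.
have M0 : 0 <= M ^+ 2 := sqr_ge0 M.
apply/cvgr0Pnorm_le => e e0.
(* Chosen so that the exceptional mass contributes [M ^+ 2 * e' <= e / 2]; the [+ 1] covers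
   [M = 0]. *)
pose e' := e / (2 * (M ^+ 2 + 1)).
have e'0 : 0 < e' by rewrite divr_gt0// mulr_gt0//; lra.
have [s us hs] := tsum_approx e'0 p0 ps; rewrite p1 in hs.
have : \forall t \near 0^'+, forall a, a \in s -> p a != 0 -> F t a ^+ 2 <= e / 2.
  apply: near_all_seq => a as_.
  have [pa|pa] := eqVneq (p a) 0; first by apply: nearW => t; rewrite ?eqxx.
  have := F0 a pa => /cvgr0_norm_le.
  move=> /(_ (Num.sqrt (e / 2))); rewrite sqrtr_gt0 divr_gt0// => /(_ isT).
  apply: filterS => t h _.
  rewrite -[leRHS]sqr_sqrtr; last by rewrite divr_ge0// ltW.
  rewrite -real_normK ?num_real//.
  by rewrite lerXn2r ?nnegrE// sqrtr_ge0.
move=> H; near=> t.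
have t01 : 0 < t <= 1.
  apply/andP; split; first by near: t; exact: nbhs_right_gt.
  by near: t; apply: nbhs_right_le.
have ht : forall a, a \in s -> p a != 0 -> F t a ^+ 2 <= e / 2 by near: t.
have sqM a : F t a ^+ 2 <= M ^+ 2.
  rewrite -real_normK ?num_real// lerXn2r ?nnegrE ?FM//.
  exact: le_trans (FM t a t01).
pose ps' a := p a * (a \in s)%:R.
have ps's : asummable ps'.
  apply: le_asummable ps => a; rewrite normrM ler_piMr//.
  by case: (_ \in _); rewrite ?normr1 ?normr0.
have ps'1 : 1 - e' < tsum ps'.
  apply: lt_le_trans hs _.
  rewrite (eq_big_seq ps'); last by move=> a as_; rewrite /ps' as_ mulr1.
  by apply: ge_sum_tsum => // a; rewrite mulr_ge0.
rewrite ger0_norm; last by apply: Ex_ge0 => // a _; exact: sqr_ge0.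
apply: (@le_trans _ _ (tsum (fun a => e / 2 * p a + M ^+ 2 * (p a - ps' a)))).
  apply: le_tsum.
  - by apply: (integ_bounded (C := M ^+ 2)) => // a _; rewrite ger0_norm ?sqM// sqr_ge0.
  - by apply: asummableD; apply: asummableZ => //; exact: asummableB.
  move=> a; rewrite /ps'; have [pa|pa] := eqVneq (p a) 0.
    by rewrite pa !mul0r subrr !mulr0 addr0.
  have [as_|as_] := boolP (a \in s).
    by rewrite mulr1 subrr mulr0 addr0 mulrC ler_wpM2r// ht.
  rewrite mulr0 subr0 mulrC -[leLHS]add0r lerD//.
    by rewrite mulr_ge0// divr_ge0// ltW.
  by rewrite ler_wpM2r.
rewrite tsumD; [|exact: asummableZ|exact/asummableZ/asummableB].
rewrite !tsumZ//; last exact: asummableB.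
rewrite tsumB// p1 mulr1.
have h : M ^+ 2 * (1 - tsum ps') <= M ^+ 2 * e' by rewrite ler_wpM2l//; lra.
have : M ^+ 2 * e' <= e / 2.
  rewrite /e' mulrA ler_pdivrMr; last by rewrite mulr_gt0//; lra.
  have -> : e / 2 * (2 * (M ^+ 2 + 1)) = M ^+ 2 * e + e by field.
  lra.
lra.
Unshelve. all: by end_near.
Qed.

Lemma exists_pow2 (x : R) : 1 <= x -> exists k : nat, x <= (2 ^ k)%:R <= 2 * x.
Proof.
move=> x1.
have ex : exists k : nat, x <= (2 ^ k)%:R.
  exists (Num.truncn x).+1.
  have h : x <= (Num.truncn x).+1%:R by apply: ltW; apply: truncnS_gt.
  apply: le_trans h _; rewrite ler_nat; exact/ltnW/ltn_expl.
exists (ex_minn ex); case: ex_minnP => -[|k] hk hmin; rewrite hk /=.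
  by rewrite expn0; lra.
have : (2 ^ k)%:R < x.
  by rewrite ltNge; apply/negP => /hmin; rewrite ltnn.
by rewrite expnS natrM; lra.
Qed.

End Exponential.

(** * From [expect] and [walk] to real expectations on words *)

Section Conversions.
Context {R : realType} {G : groupType}.
Implicit Types mu : G -> R.

(** [expect] splits the values of [F] by sign and [tsum] splits the weighted values; the two agree
    because path weights are nonnegative. *)
Lemma expectE mu n (F : n.-tuple G -> R) : (forall a, 0 <= mu a) ->
  integ (@path_prob R G mu n) F -> expect mu F = (Ex (@path_prob R G mu n) F)%:E.
Proof.
move=> mu0 hF; have p0 x := path_prob_ge0 x mu0.
have E (H : n.-tuple G -> R) x : path_prob mu x * Num.max (H x) 0 =
    Num.max (path_prob mu x * H x) 0.
  by rewrite maxr_pMr// mulr0.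
have pos (H : n.-tuple G -> R) : integ (@path_prob R G mu n) H ->
    \esum_(x in [set: n.-tuple G]) (path_prob mu x * Num.max (H x) 0)%:E =
    (tsum (fun x => Num.max (path_prob mu x * H x) 0))%:E.
  move=> hH; rewrite -ge0_esumE; last 2 first.
  - by move=> x; exact: posr_ge0.
  - by apply: le_asummable hH => x; exact: norm_posr.
  by apply: eq_esum => x _; rewrite E.
rewrite /expect pos// pos; last exact: integN.
rewrite /Ex (tsumE hF) EFinB; congr (_ - (tsum _)%:E)%E.
by apply/funext => x; rewrite mulrN.
Qed.

Lemma walkE n (x : n.-tuple G) : walk x n = wprod x.
Proof. by rewrite /walk take_oversize// size_tuple. Qed.

Lemma walk_cat n m (x : (n + m).-tuple G) :
  walk x (n + m) = (walk x n * wprod (drop n x))%g.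
Proof. by rewrite walkE /walk -{1}(cat_take_drop n x) wprod_cat. Qed.

End Conversions.

(** * Sandwich between entropy and speed; linearisation of the mean length *)

Section EntropyVersusSpeed.
Context {R : realType} {G : groupType}.
Variable mu : G -> R.
Hypothesis hmu : is_prob mu.
Hypothesis mu_sym : forall x, mu x = mu x^-1%g.
Hypothesis gen : generates (supp mu).
Variable rho : R.
Hypothesis rho01 : 0 < rho < 1.
Hypothesis hrho : forall n x, conv_pow mu n x ^+ 2 <= rho ^+ n.
Hypothesis len2 : integ mu (fun x => gdist mu x ^+ 2).

Local Notation len := (gdist mu).
Local Notation PP mu n := (@path_prob R G mu n).

Let len_ge0 x : 0 <= len x. Proof. exact: gdist_ge0 rho01 _ _ _. Qed.
Let lenV x : len x^-1%g = len x. Proof. exact: gdistV. Qed.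
Let lenM x y : len (x * y)%g <= len x + len y.
Proof. exact: gdistM rho01 _ _ _ _. Qed.

Let mu0 x : 0 <= mu x. Proof. by have [] := hmu. Qed.

Lemma finite_entropy_pow mu' n : is_prob mu' -> integ mu' (fun x => len x ^+ 2) ->
  finite_entropy (conv_pow mu' n).
Proof.
move=> hmu' l2; have hc := is_prob_conv_pow n hmu'; have [_ cs _] := hc.
have [C hC] := shannon_le_mean hmu mu_sym rho01 hrho gen (@ltr01 R).
have ig : integ (conv_pow mu' n) len.
  exact: (integ_le_sqr cs (len2_conv_pow len_ge0 lenM hmu' l2 n)).
by have [] := hC _ hc ig.
Qed.

Variables (mu' Y : G -> R) (eta : R).
Hypothesis hmu' : is_prob mu'.
Hypothesis hY : forall a, mu' a = mu a * (1 + Y a).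
Hypothesis Yeta : forall a, `|Y a| <= eta.
Hypothesis Ypos : forall a, 0 < 1 + Y a.

Let v := Ex mu (fun a => Y a ^+ 2).

Lemma tilt_len2 : integ mu' (fun x => len x ^+ 2).
Proof.
apply: le_asummable (asummableZ (1 + eta) len2) => x.
rewrite hY mulrAC normrM mulrC [leRHS]normrM ler_wpM2r//.
rewrite ger0_norm; last exact: ltW.
apply: le_trans (ler_norm _); rewrite lerD2l.
exact: le_trans (ler_norm _) (Yeta x).
Qed.

(** [mean_le_shannon] and [shannon_le_mean] are divided by [n]: the additive constants vanish in the
    limit, the chi-square term survives because it is proportional to [n], and the factor [1 + e] is
    removed last. *)
Lemma entropy_speed (C : R) : 0 <= C ->
  (forall n m, Ex (prodw (PP mu' n) (PP mu' m)) (@gprod_path R G len n m) <= C) ->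
  exists L : R,
    (forall n, (0 < n)%N -> `|mean_len len mu' n / n%:R - L| <= 6 * C / n%:R) /\
    L - v <= asymptotic_entropy mu' <= L.
Proof.
move=> C0 hC; have l2 := tilt_len2.
have fe n := finite_entropy_pow n hmu' l2.
have [L hL] := speed_rate len_ge0 lenV lenM hmu' l2 C0 hC.
have [h hcv [_ ->]] := entropy_rate_cvg hmu' fe.
exists L; split=> //.
have ig n : integ (conv_pow mu' n) len.
  have [_ cs _] := is_prob_conv_pow n hmu'.
  exact: (integ_le_sqr cs (len2_conv_pow len_ge0 lenM hmu' l2 n)).
have mE n : mean_len len mu' n = Ex (conv_pow mu' n) len.
  exact: (EP_walk hmu' (ig n)).
have cinv (c : R) : (fun n : nat => c / n%:R) @ \oo --> (0 : R).
  apply/cvgr0Pnorm_le => e e0; near=> n.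
  have n0 : 0 < n%:R :> R by rewrite ltr0n; near: n; exact: nbhs_infty_gt.
  have hn : `|c| / e <= n%:R by near: n; exact: nbhs_infty_ger.
  by rewrite normrM normfV (gtr0_norm n0) ler_pdivrMr// mulrC -ler_pdivrMr.
have mcv : (fun n => mean_len len mu' n / n%:R) @ \oo --> L.
  apply/cvgrPdist_le => e e0.
  have := cinv (6 * C) => /cvgr0_norm_le /(_ e e0) H.
  near=> n; have n0 : (0 < n)%N by near: n; exact: nbhs_infty_gt.
  rewrite distrC; apply: le_trans (hL n n0) _.
  by apply: le_trans (ler_norm _) _; near: n.
have L0 : 0 <= L.
  apply: (cvgr_to_ge mcv); apply: nearW => n.
  by rewrite divr_ge0// (mean_len_ge0 len_ge0).
apply/andP; split.
  have lower : (fun n => mean_len len mu' n / n%:R -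
     ln (greenf mu 1%g) / n%:R) @ \oo --> L - 0 by apply: cvgB.
  have upper : (fun n => shannon (conv_pow mu' n) / n%:R + v) @ \oo --> h + v.
    by apply: cvgD => //; exact: cvg_cst.
  rewrite lerBlDr -[leLHS]subr0; apply: (ler_cvg_to lower upper).
  near=> n; have n0 : (0 < n)%N by near: n; exact: nbhs_infty_gt.
  have n0' : 0 < n%:R :> R by rewrite ltr0n.
  have := mean_le_shannon hmu mu_sym rho01 hrho gen hmu' hY Yeta Ypos (ig n) (fe n).
  rewrite -/v -/(mean_len _ _ _) => H.
  rewrite -mulrBl ler_pdivrMr// mulrDl divfK ?gt_eqF//; lra.
apply/ler_addgt0Pr => e e0.
(* With this relative loss the bound exceeds [L] by [e L / (L + 1) <= e]; the [+ 1] covers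
   [L = 0]. *)
have e1 : 0 < e / (L + 1) by rewrite divr_gt0//; lra.
have [C' hC'] := shannon_le_mean hmu mu_sym rho01 hrho gen e1.
have upper : (fun n => (1 + e / (L + 1)) * (mean_len len mu' n / n%:R) + C' / n%:R)
    @ \oo --> (1 + e / (L + 1)) * L + 0.
  by apply: cvgD => //; apply: cvgM => //; exact: cvg_cst.
apply: (@le_trans _ _ ((1 + e / (L + 1)) * L + 0)).
  apply: (ler_cvg_to hcv upper).
  near=> n; have n0 : (0 < n)%N by near: n; exact: nbhs_infty_gt.
  have n0' : 0 < n%:R :> R by rewrite ltr0n.
  have [_] := hC' _ (is_prob_conv_pow n hmu') (ig n).
  rewrite -mE => H; rewrite ler_pdivrMr// mulrDl divfK ?gt_eqF//.
  by rewrite -mulrA divfK ?gt_eqF.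
rewrite addr0 mulrDl mul1r lerD2l mulrAC ler_pdivrMr; last lra.
by rewrite ler_pM2l//; lra.
Unshelve. all: by end_near.
Qed.

(** [EP_tilt_first_order] with the score [t * nu], divided by [n t]. The bound [V n] on the variance
    turns the quadratic term into [sqrt n v / t] and makes the linear error independent of [n]. *)
Lemma difference_quotient (t V : R) (nu : G -> R) n : 0 < t -> (0 < n)%N ->
  integ mu (fun a => nu a ^+ 2) -> Ex mu nu = 0 -> n%:R * v <= 1 ->
  var (PP mu n) (fun x => wlen len x) <= V * n%:R -> 0 <= V ->
  `|(mean_len len mu' n - mean_len len mu n) / (n%:R * t) - cov_len len mu nu n / n%:R|
  <= Num.sqrt V * (Num.sqrt n%:R * v / t +
       Num.sqrt (Ex mu (fun a => (Y a / t - nu a) ^+ 2))).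
Proof.
move=> t0 n0 nu2 nu0 nv1 hV V0; have [_ mus _] := hmu.
have n0' : 0 < n%:R :> R by rewrite ltr0n.
have nu1 := integ_le_sqr mus nu2.
have tnu2 : integ mu (fun a => (t * nu a) ^+ 2) by exact: integ_sqrZ.
have tnu0 : Ex mu (fun a => t * nu a) = 0 by rewrite ExZ// nu0 mulr0.
have w2 := wlen2_integ len_ge0 lenM hmu len2 n.
have := EP_tilt_first_order hmu hmu' hY Yeta w2 tnu2 tnu0 nv1.
have hP := is_prob_path n hmu; have [p0 ps _] := hP.
have [s1 _ _] := iid_sum n hmu nu2 nu0.
have -> : EP mu n (fun s => wlen len s * ssum (fun a => t * nu a) s) =
    t * cov_len len mu nu n.
  rewrite /cov_len /EP -ExZ; last exact: (integM w2 s1).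
  by apply: eq_Ex => x _; rewrite /ssum -mulr_sumr mulrCA.
rewrite -/(mean_len len mu' n) -/(mean_len len mu n).
set a' := mean_len _ _ _; set a := mean_len _ _ _; set b := cov_len _ _ _ _ => H.
have Y2 := Y2_integ hmu Yeta.
set E := Ex mu (fun a => (Y a / t - nu a) ^+ 2).
have E0 : 0 <= E by apply: Ex_ge0 => // x _; exact: sqr_ge0.
have EE : Ex mu (fun a => (Y a - t * nu a) ^+ 2) = t ^+ 2 * E.
  have i : integ mu (fun a => (Y a / t - nu a) ^+ 2).
    apply: integ_sqrB => //; have := integ_sqrZ t^-1 Y2.
    by under eq_fun do rewrite mulrC.
  rewrite -ExZ//; apply: eq_Ex => x _; rewrite -exprMn; congr (_ ^+ 2).
  by field; rewrite gt_eqF.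
rewrite EE in H.
have nt0 : 0 < n%:R * t by rewrite mulr_gt0.
have -> : (a' - a) / (n%:R * t) - b / n%:R = (a' - a - t * b) / (n%:R * t).
  by field; rewrite !gt_eqF.
rewrite normrM normfV (gtr0_norm nt0) ler_pdivrMr//.
apply: le_trans H _.
have v0 : 0 <= v by apply: Ex_ge0 => // x _; exact: sqr_ge0.
set r := Num.sqrt n%:R; have r0 : 0 < r by rewrite sqrtr_gt0.
have r2 : n%:R = r ^+ 2 :> R by rewrite sqr_sqrtr// ltW.
have -> : Num.sqrt (n%:R * (t ^+ 2 * E)) = r * (t * Num.sqrt E).
  rewrite sqrtrM ?ltW// sqrtrM ?sqr_ge0// sqrtr_sqr gtr0_norm//.
have -> : Num.sqrt V * (r * v / t + Num.sqrt E) * (n%:R * t) =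
    Num.sqrt V * r * (n%:R * v + r * (t * Num.sqrt E)).
  by rewrite r2; field; rewrite gt_eqF.
rewrite ler_wpM2r//.
  by rewrite addr_ge0 ?mulr_ge0 ?sqrtr_ge0// ltW.
by rewrite -sqrtrM// ler_wsqrtr.
Qed.

End EntropyVersusSpeed.

(** * Numerical bounds for [n] between [t^(-3/2)] and [2 t^(-3/2)] *)

Section Estimates.
Context {R : realType}.
Variables (t M v : R) (n : nat).
Hypotheses (t01 : 0 < t <= 1) (n0 : (0 < n)%N).
Hypothesis hn : 1 <= n%:R * (t * Num.sqrt t) <= 2.
Hypothesis hv : 0 <= v <= (t * M) ^+ 2.

Let t0 : 0 < t. Proof. by case/andP: t01. Qed.
Let t0' : 0 <= t. Proof. exact: ltW. Qed.
Let s0 : 0 <= Num.sqrt t. Proof. exact: sqrtr_ge0. Qed.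
Let n0' : 0 < n%:R :> R. Proof. by rewrite ltr0n. Qed.
Let n0'' : 0 <= n%:R :> R. Proof. exact: ltW. Qed.

Lemma steps_le : n%:R * t ^+ 2 <= 2 * Num.sqrt t.
Proof.
case/andP: hn => _ h2.
have -> : n%:R * t ^+ 2 = n%:R * (t * Num.sqrt t) * Num.sqrt t.
  by rewrite -!mulrA -expr2 sqr_sqrtr.
by rewrite ler_wpM2r.
Qed.

Lemma steps_variance : 2 * M ^+ 2 * Num.sqrt t <= 1 -> n%:R * v <= 1.
Proof.
case/andP: hv => v0 v1; apply: le_trans.
apply: (@le_trans _ _ (n%:R * (t * M) ^+ 2)); first by rewrite ler_wpM2l.
rewrite exprMn mulrA; have := ler_wpM2r (sqr_ge0 M) steps_le.
by rewrite [X in _ <= X -> _](_ : _ = 2 * M ^+ 2 * Num.sqrt t)//; ring.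
Qed.

(** Four errors are added: entropy against speed, speed against mean length at time [n],
    linearisation at time [n], covariance against its limit. The bounds on [n] give
    [1 / (n t) <= sqrt t] and [sqrt n t <= sqrt (2 sqrt t)]. *)
Lemma quotient_estimate (V D K AE L L0 a' a0 b sigma eta : R) : 0 <= D ->
  L - v <= AE <= L ->
  `|a' / n%:R - L| <= 6 * D / n%:R -> `|a0 / n%:R - L0| <= 6 * D / n%:R ->
  `|b / n%:R - sigma| <= K / Num.sqrt n%:R ->
  `|(a' - a0) / (n%:R * t) - b / n%:R| <=
    Num.sqrt V * (Num.sqrt n%:R * v / t + Num.sqrt eta) ->
  `|t^-1 * (AE - L0) - sigma| <= M ^+ 2 * t + 12 * D * Num.sqrt t +
    Num.sqrt V * (M ^+ 2 * Num.sqrt (2 * Num.sqrt t) + Num.sqrt eta) +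
    `|K| * Num.sqrt (Num.sqrt t).
Proof.
move=> D0 /andP[AE1 AE2] e1 e2 e4 e3.
case/andP: hv => v0 v1; case/andP: hn => h1 h2; case/andP: t01 => _ t1.
have -> : t^-1 * (AE - L0) - sigma = (AE - L) / t
   + (- (a' / n%:R - L) + (a0 / n%:R - L0)) / t
   + ((a' - a0) / (n%:R * t) - b / n%:R) + (b / n%:R - sigma).
  by field; rewrite !gt_eqF.
apply: le_trans (ler_normD _ _) _; apply: lerD; last first.
  apply: le_trans e4 _; rewrite ler_pdivrMr ?sqrtr_gt0//.
  apply: le_trans (ler_norm _) _.
  (* From [n t^(3/2) >= 1] one has [1 / sqrt n <= t^(3/4)]; the weaker [t^(1/4)] is enough. *)
  rewrite -mulrA ler_peMr// -sqrtrM// -[leLHS]sqrtr1 ler_wsqrtr//.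
  by apply: le_trans h1 _; rewrite mulrC ler_wpM2r// ler_piMl.
apply: le_trans (ler_normD _ _) _; apply: lerD; last first.
  apply: le_trans e3 _; rewrite ler_wpM2l ?sqrtr_ge0// lerD2r.
  apply: (@le_trans _ _ (M ^+ 2 * (Num.sqrt n%:R * t))).
    rewrite ler_pdivrMr//.
    have -> : M ^+ 2 * (Num.sqrt n%:R * t) * t = Num.sqrt n%:R * (t * M) ^+ 2 by ring.
    by rewrite ler_wpM2l// sqrtr_ge0.
  rewrite ler_wpM2l ?sqr_ge0//.
  have -> : Num.sqrt n%:R * t = Num.sqrt (n%:R * t ^+ 2).
    by rewrite sqrtrM// sqrtr_sqr ger0_norm.
  by rewrite ler_wsqrtr// steps_le.
apply: le_trans (ler_normD _ _) _; apply: lerD.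
  rewrite normrM normfV (gtr0_norm t0) ler_pdivrMr//.
  have -> : M ^+ 2 * t * t = (t * M) ^+ 2 by ring.
  by rewrite ler_norml; apply/andP; split; lra.
rewrite normrM normfV (gtr0_norm t0) ler_pdivrMr//.
apply: le_trans (ler_normD _ _) _; rewrite normrN.
apply: (@le_trans _ _ (12 * D / n%:R)).
  have -> : 12 * D / n%:R = 6 * D / n%:R + 6 * D / n%:R by ring.
  exact: lerD.
rewrite ler_pdivrMr//.
have -> : 12 * D * Num.sqrt t * t * n%:R = 12 * D * (n%:R * (t * Num.sqrt t)) by ring.
by rewrite ler_peMr// mulr_ge0.
Qed.

End Estimates.

(** * Deviation inequalities as expectations over two independent paths *)

Section GreenExpectations.
Context {R : realType} {G : groupType}.
Implicit Types mu : G -> R.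

Lemma eq_expect mu n (F H : n.-tuple G -> R) :
  (forall x, path_prob mu x != 0 -> F x = H x) -> expect mu F = expect mu H.
Proof.
move=> FH; rewrite /expect; congr (_ - _)%E; apply: eq_esum => x _; congr EFin;
  by have [->|/FH ->//] := eqVneq (path_prob mu x) 0; rewrite !mul0r.
Qed.

(** Left invariance moves the base point [Z_n] to the identity, after which only the two independent
    pieces of the path enter. [phi] is the identity for the first moment and the square for the
    second. *)
Lemma expect_gromov (d : G -> G -> R) (len : G -> R) (phi : R -> R) mu' n m :
  (forall x y, d x y = len (x^-1 * y)%g) -> (forall x, len x^-1%g = len x) ->
  (forall a, 0 <= mu' a) ->
  integ (prodw (@path_prob R G mu' n) (@path_prob R G mu' m))
    (fun z => phi (gprod_path len z)) ->
  expect mu' (fun x : (n + m).-tuple G =>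
    phi (gromov d (walk x n) 1%g (walk x (n + m)))) =
  (Ex (prodw (@path_prob R G mu' n) (@path_prob R G mu' m))
    (fun z => phi (gprod_path len z)))%:E.
Proof.
move=> dE lenV mu0 hi.
pose F s := phi (gprod len (wprod (take n s)) (wprod (drop n s))).
have E (x : (n + m).-tuple G) :
    phi (gromov d (walk x n) 1%g (walk x (n + m))) = F x.
  rewrite /F /gromov /gprod !dE walk_cat invg1 mul1g mulg1 lenV mulKg.
  by rewrite /walk -/(wprod _).
have C (z : n.-tuple G * m.-tuple G) : F (z.1 ++ z.2) = phi (gprod_path len z).
  by rewrite /F take_size_cat ?size_tuple// drop_size_cat ?size_tuple.
have -> : (fun x : (n + m).-tuple G =>
    phi (gromov d (walk x n) 1%g (walk x (n + m)))) = (fun x => F x).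
  exact/funext.
rewrite expectE//; last first.
  by apply/(integP_cat mu' n m F); under eq_fun do rewrite C.
rewrite -/(EP mu' (n + m) F) EP_cat; congr EFin.
by apply: eq_Ex => z _; rewrite C.
Qed.

End GreenExpectations.

(** * Densities along the curve and their derivative in mean square *)

Section Curve.
Context {R : realType} {G : groupType}.
Variables (mu : G -> R) (mu_ : R -> G -> R) (nu : G -> R) (c : R).
Hypothesis hP : is_prob mu.
Hypothesis mu_0 : mu_ 0 = mu.
Hypothesis mutP : forall t, 0 <= t <= 1 -> is_prob (mu_ t).
Hypothesis mut_supp : forall t, 0 <= t <= 1 -> supp (mu_ t) = supp mu.
Hypothesis c0 : 0 <= c.
Hypothesis nu_le : forall a, mu a != 0 -> `|nu a| <= c.
Hypothesis ln_le : forall t a, 0 < t <= 1 -> mu a != 0 ->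
  `|ln (mu_ t a / mu a)| <= t * c.
Hypothesis ln_cvg : forall a, mu a != 0 ->
  t^-1 * (ln (mu_ t a) - ln (mu a)) @[t --> 0^'+] --> nu a.

Let mu_ge0 a : 0 <= mu a. Proof. by have [] := hP. Qed.
Let mus : asummable mu. Proof. by have [] := hP. Qed.

(* Relative density minus one and score, both set to [0] off the support so
   that the bounds below hold everywhere. *)
Definition density_excess t a : R := if mu a == 0 then 0 else mu_ t a / mu a - 1.
Definition score a : R := if mu a == 0 then 0 else nu a.

Local Notation Y := density_excess.
(** The constant from [norm_expR_sub1]: a logarithm bounded by [t c], with [t <= 1], gives an excess
    of at most [t c exp c]. *)
Local Notation M := (c * expR c).

Let M0 : 0 <= M. Proof. by rewrite mulr_ge0// expR_ge0. Qed.

Let closed01 (t : R) : 0 < t <= 1 -> 0 <= t <= 1.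
Proof. by move=> /andP[/ltW -> ->]. Qed.

Lemma mu_pos a : mu a != 0 -> 0 < mu a.
Proof. by rewrite lt_neqAle eq_sym mu_ge0 andbT. Qed.

Lemma density_excessE t a : mu a != 0 -> 1 + Y t a = mu_ t a / mu a.
Proof. by rewrite /Y => /negbTE ->; rewrite addrC subrK. Qed.

Lemma curve_pos t a : 0 <= t <= 1 -> mu a != 0 -> 0 < mu_ t a.
Proof.
move=> t01 ma; have [p0 _ _] := mutP t01.
have : supp (mu_ t) a by rewrite mut_supp.
by rewrite lt_neqAle p0 andbT eq_sym.
Qed.

Lemma density_pos t a : 0 <= t <= 1 -> 0 < 1 + Y t a.
Proof.
move=> t01; have [ma|ma] := eqVneq (mu a) 0.
  by rewrite /Y ma eqxx addr0.
by rewrite density_excessE// divr_gt0 ?curve_pos ?mu_pos.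
Qed.

Lemma curveE t a : 0 <= t <= 1 -> mu_ t a = mu a * (1 + Y t a).
Proof.
move=> t01; have [ma|ma] := eqVneq (mu a) 0; last first.
  by rewrite density_excessE// mulrC divfK.
rewrite ma mul0r; apply/eqP; apply: contrapT => /negP h.
have : supp (mu_ t) a by [].
by rewrite mut_supp// /supp /= ma eqxx.
Qed.

Lemma ln_density_le t a : 0 < t <= 1 -> `|ln (1 + Y t a)| <= t * c.
Proof.
move=> t01; have [ma|ma] := eqVneq (mu a) 0; last by rewrite density_excessE ?ln_le.
by case/andP: t01 => t0 _; rewrite /Y ma eqxx addr0 ln1 normr0 mulr_ge0// ltW.
Qed.

Lemma norm_expR_sub1_le t w : 0 < t <= 1 -> `|w| <= t * c ->
  `|expR w - 1| <= t * M.
Proof.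
move=> /andP[t0 t1] hw; apply: le_trans (norm_expR_sub1 w) _.
rewrite mulrA; apply: ler_pM => //; rewrite ?expR_ge0//.
by rewrite ler_expR (le_trans hw)// ler_piMl.
Qed.

Lemma density_excess_exp t a : 0 <= t <= 1 -> Y t a = expR (ln (1 + Y t a)) - 1.
Proof. by move=> t01; rewrite lnK ?posrE ?density_pos// addrAC subrr add0r. Qed.

Lemma density_excess0 a : Y 0 a = 0.
Proof. by rewrite /Y mu_0; case: (boolP (mu a == 0)) => // ma; rewrite divff// subrr. Qed.

Lemma density_excess_le t a : 0 <= t <= 1 -> `|Y t a| <= t * M.
Proof.
move=> t01; have [->|tn0] := eqVneq t 0.
  by rewrite density_excess0 normr0 mul0r.
have tt : 0 < t <= 1 by case/andP: t01 => ? ->; rewrite lt_neqAle eq_sym tn0 andbT.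
by rewrite density_excess_exp// norm_expR_sub1_le// ln_density_le.
Qed.

Lemma inv_density_le t a : 0 <= t <= 1 -> (1 + Y t a)^-1 <= 1 + t * M.
Proof.
move=> t01; have [->|tn0] := eqVneq t 0.
  by rewrite density_excess0 addr0 invr1 mul0r addr0.
have tt : 0 < t <= 1 by case/andP: t01 => ? ->; rewrite lt_neqAle eq_sym tn0 andbT.
have := ln_density_le a tt; rewrite -normrN => /(norm_expR_sub1_le tt).
rewrite expRN lnK ?posrE ?density_pos// => h.
by have := ler_norm ((1 + Y t a)^-1 - 1); lra.
Qed.

Lemma ndist_curve (K : R) t : 0 <= t <= 1 -> t * M <= K ->
  (ndist (mu_ t) mu <= K%:E)%E.
Proof.
move=> t01 tK; rewrite /ndist.
have -> : `[< supp (mu_ t) = supp mu >] by apply/asboolP; rewrite mut_supp.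
rewrite leeBlDr//; apply: ge_ereal_sup => _ [a /= ma <-].
have -> : mu a / mu_ t a = (1 + Y t a)^-1 by rewrite density_excessE// invf_div.
rewrite -EFinD lee_fin ge_max -density_excessE//.
have h1 := density_excess_le a t01; have h2 := inv_density_le a t01.
by have := ler_norm (Y t a) => h3; apply/andP; split; lra.
Qed.

Definition chi2 t : R := Ex mu (fun a => Y t a ^+ 2).

Lemma chi2_le t : 0 <= t <= 1 -> 0 <= chi2 t <= (t * M) ^+ 2.
Proof.
move=> t01; have Yle a := density_excess_le a t01.
apply/andP; split; first by apply: Ex_ge0 => // a _; exact: sqr_ge0.
rewrite -(Ex_cst ((t * M) ^+ 2) hP); apply: le_Ex => //.
- exact: Y2_integ hP Yle.
- exact: integ_cst.
move=> a _; rewrite -real_normK ?num_real// lerXn2r ?nnegrE//.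
by case/andP: t01 => ? _; rewrite mulr_ge0.
Qed.

Lemma score_le a : `|score a| <= c.
Proof. by rewrite /score; case: (boolP (mu a == 0)) => [_|/nu_le//]; rewrite normr0. Qed.

Lemma score2_integ : integ mu (fun a => score a ^+ 2).
Proof.
apply: (integ_bounded (C := c ^+ 2)) => // a _.
by rewrite normrX lerXn2r ?nnegrE// score_le.
Qed.

Lemma difference_cvg a : mu a != 0 ->
  Y t a / t - score a @[t --> 0^'+] --> (0 : R).
Proof.
move=> ma; apply/cvgr0Pnorm_le => e e0.
have := ln_cvg ma => /cvgrPdist_le /(_ (e / 2)).
rewrite divr_gt0// => /(_ isT) H.
near=> t.
have t0 : 0 < t by near: t; exact: nbhs_right_gt.
have t1 : t <= 1 by near: t; exact: nbhs_right_le.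
have t01 : 0 < t <= 1 by rewrite t0.
have t01' := closed01 t01.
have hC : t * (c * M + 1) <= e / 2.
  rewrite -ler_pdivlMr; last by rewrite ltr_wpDl// mulr_ge0.
  near: t; apply: nbhs_right_le; rewrite !divr_gt0//.
  by rewrite ltr_wpDl// mulr_ge0.
have h1 : `|nu a - t^-1 * ln (1 + Y t a)| <= e / 2.
  rewrite density_excessE// ln_div ?posrE ?mu_pos ?curve_pos//.
  by near: t.
have hw := ln_density_le a t01.
rewrite [X in X / t]density_excess_exp//; set w := ln (1 + Y t a) in h1 hw *.
have h2 : `|expR w - 1 - w| <= t * (t * (c * M)).
  apply: le_trans (norm_expR_sub1D w) _.
  have -> : t * (t * (c * M)) = (t * c) ^+ 2 * expR c by ring.
  apply: ler_pM; [exact: sqr_ge0|exact: expR_ge0| |].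
    by rewrite -real_normK ?num_real// lerXn2r ?nnegrE// mulr_ge0// ltW.
  by rewrite ler_expR (le_trans hw)// ler_piMl.
rewrite /score (negbTE ma).
have -> : (expR w - 1) / t - nu a =
    (expR w - 1 - w) / t - (nu a - t^-1 * w) by field; rewrite gt_eqF.
apply: le_trans (ler_normB _ _) _.
have h3 : `|(expR w - 1 - w) / t| <= t * (c * M).
  by rewrite normrM normfV (gtr0_norm t0) ler_pdivrMr// [leRHS]mulrC.
lra.
Unshelve. all: by end_near.
Qed.

Lemma difference_le t a : 0 < t <= 1 -> `|Y t a / t - score a| <= M + c.
Proof.
move=> t01; have /andP[t0 t1] := t01; apply: le_trans (ler_normB _ _) _.
apply: lerD; last exact: score_le.
by rewrite normrM normfV (gtr0_norm t0) ler_pdivrMr// mulrC density_excess_le// closed01.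
Qed.

Definition l2_error t : R := Ex mu (fun a => (Y t a / t - score a) ^+ 2).

Lemma l2_error_cvg : l2_error t @[t --> 0^'+] --> (0 : R).
Proof. exact: dominated_sqr hP difference_le difference_cvg. Qed.

(** [Y t / t] is centred for each [t], so the squared mean of the score is at most [l2_error t],
    which tends to [0]. *)
Lemma Ex_score : Ex mu score = 0.
Proof.
apply/eqP; rewrite -sqrf_eq0 eq_le sqr_ge0 andbT.
apply: (cvgr_to_ge l2_error_cvg); near=> t.
have t0 : 0 < t by near: t; exact: nbhs_right_gt.
have t1 : t <= 1 by near: t; exact: nbhs_right_le.
have t01 : 0 < t <= 1 by rewrite t0.
have t01' := closed01 t01.
have Yle a := density_excess_le a t01'; have hY a := curveE a t01'.
have F2 : integ mu (fun a => (Y t a / t - score a) ^+ 2).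
  apply: (integ_bounded (C := (M + c) ^+ 2)) => // a _.
  by rewrite normrX lerXn2r ?nnegrE ?addr_ge0// difference_le.
apply: le_trans (sqr_Ex_le hP F2).
have -> : Ex mu (fun a => Y t a / t - score a) = - Ex mu score; last by rewrite sqrrN.
rewrite (@eq_Ex _ _ _ _ (fun a => t^-1 * Y t a - score a)); last first.
  by move=> a _; rewrite mulrC.
have YI : integ mu (Y t) := Y_integ hP Yle.
have EY : Ex mu (Y t) = 0 := Ex_Y hP (mutP t01') hY Yle.
rewrite ExB; [|exact: integZ|exact: integ_le_sqr score2_integ].
by rewrite (ExZ _ YI) EY mulr0 add0r.
Unshelve. all: by end_near.
Qed.

End Curve.

(** * Assembly: entropy, covariance and the derivative *)

Theorem theorem6p2 (R : realType) (G : groupType)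
  (hfg : finitely_generated G) (hna : ~ amenable R G)
  (B : set G) (hBsym : symmetric_set B) (hBgen : generates B)
  (mu : G -> R) (hmu : sym_prob_on B mu)
  (hmom : finite_second_moment (green_dist mu) mu)
  (hdev2 : second_moment_deviation (green_dist mu) mu)
  (hdev1 : locally_uniform_first_moment_deviation (green_dist mu) mu)
  (mu_ : R -> G -> R) (hmu_ : forall t, 0 <= t <= 1 -> prob_on B (mu_ t))
  (hmu0 : mu_ 0 = mu)
  (nu : G -> R)
  (hnu : forall a, B a ->
     t^-1 * (ln (mu_ t a) - ln (mu_ 0 a)) @[t --> 0^'+] --> nu a)
  (hnub : exists C : R, forall a, B a -> `|nu a| <= C)
  (hsup : exists C : R, forall t a, 0 < t <= 1 -> B a ->
     `|t^-1 * ln (mu_ t a / mu_ 0 a) - nu a| <= C) :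
  [/\ forall t, 0 <= t <= 1 ->
        (entropy (mu_ t) < +oo)%E /\
        entropy_rate (mu_ t) @ \oo --> (asymptotic_entropy (mu_ t))%:E,
      sigma_rate nu mu @ \oo --> (sigmaG nu mu)%:E
    & t^-1 * (asymptotic_entropy (mu_ t) - asymptotic_entropy mu)
        @[t --> 0^'+] --> sigmaG nu mu].
Proof.
have [[hprob hsupp] mu_sym] := hmu; have hP := prob_measureP hprob.
have [mu0 mus mu1] := hP.
have gen : generates (supp mu) by rewrite hsupp.
have [rho0 r01 hrho0] := kesten hP hsupp hBsym hBgen hna.
(* The rate [rho0] may be [0], while the entropy bound uses [ln (sqrt rho)]; hence a positive lower
   bound. *)
pose rho := Num.max rho0 (1 / 2).
have rho01 : 0 < rho < 1.
  case/andP: r01 => ra rb; rewrite lt_max gt_max rb.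
  by apply/andP; split; [apply/orP; right|]; lra.
have hrho n x : conv_pow mu n x ^+ 2 <= rho ^+ n.
  apply: le_trans (hrho0 n x) _; case/andP: r01 => ra rb.
  by apply: lerXn2r; rewrite ?nnegrE ?le_max ?lexx ?ra.
pose len := gdist mu.
have len_ge0 x : 0 <= len x := gdist_ge0 hP mu_sym rho01 hrho gen x.
have lenV x : len x^-1%g = len x := gdistV hP mu_sym x.
have lenM x y : len (x * y)%g <= len x + len y := gdistM hP mu_sym rho01 hrho gen x y.
have dE x y : green_dist mu x y = len (x^-1 * y)%g := green_distE hP rho01 hrho x y.
have len2 : integ mu (fun x => len x ^+ 2).
  apply: ge0_asummable => [x|]; first by rewrite mulr_ge0// sqr_ge0.
  move: hmom; rewrite /finite_second_moment; apply: le_lt_trans.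
  by apply: le_esum => x _; rewrite dE invg1 mul1g mulrC.
have [C1 hC1] := hnub; have [C2 hC2] := hsup.
rewrite hmu0 in hnu hC2.
(* One constant bounds both [nu] and, by adding the two hypotheses, the logarithmic density divided
   by [t]. *)
pose c := `|C1| + `|C2|.
have BmuP a : mu a != 0 -> B a by rewrite -hsupp.
have c0 : 0 <= c by rewrite addr_ge0.
have nu_le a : mu a != 0 -> `|nu a| <= c.
  move=> /BmuP/hC1 h; apply: le_trans h _; apply: le_trans (ler_norm _) _.
  by rewrite lerDl.
have ln_le t a : 0 < t <= 1 -> mu a != 0 -> `|ln (mu_ t a / mu a)| <= t * c.
  move=> t01 /BmuP Ba; have /andP[t0 _] := t01.
  rewrite -ler_pdivrMl// -[t^-1]gtr0_norm ?invr_gt0// -normrM.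
  rewrite -[X in `|X|](subrK (nu a)); apply: le_trans (ler_normD _ _) _.
  rewrite /c addrC; apply: lerD.
    by apply: le_trans (hC1 a Ba) _; exact: ler_norm.
  by apply: le_trans (hC2 t a t01 Ba) _; exact: ler_norm.
have ln_cvg a : mu a != 0 ->
    t^-1 * (ln (mu_ t a) - ln (mu a)) @[t --> 0^'+] --> nu a.
  by move=> /BmuP; exact: hnu.
have mutP t : 0 <= t <= 1 -> is_prob (mu_ t).
  by move=> /hmu_ [h _]; exact: prob_measureP.
have mut_supp t : 0 <= t <= 1 -> supp (mu_ t) = supp mu.
  by move=> /hmu_ [_ ->].
pose Y := density_excess mu mu_; pose M := c * expR c.
have M0 : 0 <= M by rewrite mulr_ge0// expR_ge0.
have hY t (t01 : 0 <= t <= 1) a : mu_ t a = mu a * (1 + Y t a).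
  exact: curveE.
have Yle t (t01 : 0 <= t <= 1) a : `|Y t a| <= t * M.
  exact: density_excess_le hP hmu0 mutP mut_supp c0 ln_le _ _ t01.
have Ypos t (t01 : 0 <= t <= 1) a : 0 < 1 + Y t a.
  exact: density_pos hP mutP mut_supp _ _ t01.
have chi_le t (t01 : 0 <= t <= 1) : 0 <= chi2 mu mu_ t <= (t * M) ^+ 2.
  exact: chi2_le hP hmu0 mutP mut_supp c0 ln_le _ t01.
have lent t (t01 : 0 <= t <= 1) := tilt_len2 len2 (hY t t01) (Yle t t01) (Ypos t t01).
(* [nu] is arbitrary outside [B]. Its truncation gives the same sum along every path of positive
   weight, so [sigma_rate] is unaffected. *)
pose nu' := score mu nu.
have nu'2 : integ mu (fun a => nu' a ^+ 2) := score2_integ hP c0 nu_le.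
have nu'0 : Ex mu nu' = 0 := Ex_score hP hmu0 mutP mut_supp c0 nu_le ln_le ln_cvg.
have [D2 hD2] := hdev2.
have D2' n m : Ex (prodw (@path_prob R G mu n) (@path_prob R G mu m))
    (fun z => gprod_path len z ^+ 2) <= `|D2|.
  have hi := gprod2_integ len_ge0 lenV lenM hP len2 n m.
  have := hD2 n m; rewrite (expect_gromov (phi := fun r => r ^+ 2) dE lenV mu0 hi) lee_fin.
  by move=> /le_trans; apply; exact: ler_norm.
have [V V0 hV] := var_dyadic len_ge0 lenV lenM hP len2 D2'.
have [Ks [sigma hsigma]] := cov_rate len_ge0 lenV lenM hP len2 D2' nu'2 nu'0.
have srate n : sigma_rate nu mu n = (cov_len len mu nu' n / n%:R)%:E.
  have E (x : n.-tuple G) : path_prob mu x != 0 ->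
      green_dist mu 1%g (walk x n) * \sum_(j < n) nu (tnth x j) =
      wlen len x * ssum nu' x.
    move=> /path_prob_neq0 hx; rewrite dE invg1 mul1g walkE /wlen; congr (_ * _).
    rewrite -(big_tuple _ _ x predT nu) /ssum; apply: eq_big_seq => a ax.
    by rewrite /nu' /score (negbTE (hx a ax)).
  rewrite /sigma_rate (eq_expect E) expectE//; first by rewrite -EFinM mulrC.
  have [s1 _ _] := iid_sum n hP nu'2 nu'0.
  exact: (integM (wlen2_integ len_ge0 lenM hP len2 n) s1).
have sigma_cv : sigma_rate nu mu @ \oo --> sigma%:E.
  rewrite (_ : sigma_rate nu mu = EFin \o (fun n => cov_len len mu nu' n / n%:R)).
    by apply: cvg_EFin; [exact: nearW|exact: cvg_of_sqrt_rate hsigma].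
  by apply/funext => n; rewrite srate.
have sigmaE : sigmaG nu mu = sigma by rewrite /sigmaG (cvg_lim _ sigma_cv).
have [K K0 [D1 hD1]] := hdev1.
(* [t * M <= K] keeps [mu_ t] in the neighbourhood where the deviation inequality is uniform, so the
   same [D1] serves all these [t]. *)
have speed t : 0 <= t <= 1 -> t * M <= K -> exists L : R,
    (forall n, (0 < n)%N -> `|mean_len len (mu_ t) n / n%:R - L| <= 6 * `|D1| / n%:R) /\
    L - chi2 mu mu_ t <= asymptotic_entropy (mu_ t) <= L.
  move=> t01 tK; have mtP := mutP t t01; have [mt0 _ _] := mtP.
  have nd : (ndist (mu_ t) mu <= K%:E)%E.
    exact: ndist_curve hP hmu0 mutP mut_supp c0 ln_le _ _ t01 tK.
  apply: (entropy_speed hP mu_sym gen rho01 hrho len2 mtP (hY t t01)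
    (Yle t t01) (Ypos t t01) (normr_ge0 D1)) => n m.
  have [_ hps _] := is_prob_prodw (is_prob_path n mtP) (is_prob_path m mtP).
  have hi := integ_le_sqr hps (gprod2_integ len_ge0 lenV lenM mtP (lent t t01) n m).
  have [hpm _] := hmu_ t t01.
  have := hD1 (mu_ t) hpm nd n m.
  rewrite (expect_gromov (phi := id) dE lenV mt0 hi) lee_fin.
  by move=> /le_trans; apply; exact: ler_norm.
(* At [t = 0] the sandwich closes: the entropy of [mu] equals the speed of its walk in the Green
   metric. *)
have chi0 : chi2 mu mu_ 0 = 0.
  by apply: tsum_cst0 => a; rewrite density_excess0// expr2 !mulr0.
have z01 : 0 <= (0 : R) <= 1 by rewrite lexx ler01.
have zK : 0 * M <= K by rewrite mul0r ltW.
have [L0 [hL0 AE0]] := speed 0 z01 zK.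
rewrite hmu0 chi0 subr0 in hL0 AE0.
have AE0' : asymptotic_entropy mu = L0 by apply/eqP; rewrite eq_le andbC.
pose eta := l2_error mu mu_ nu.
pose err t := M ^+ 2 * t + 12 * `|D1| * Num.sqrt t +
   Num.sqrt V * (M ^+ 2 * Num.sqrt (2 * Num.sqrt t) + Num.sqrt (eta t)) +
   `|Ks| * Num.sqrt (Num.sqrt t).
have bound t : 0 < t <= 1 -> t * M <= K -> 2 * M ^+ 2 * Num.sqrt t <= 1 ->
  `|t^-1 * (asymptotic_entropy (mu_ t) - asymptotic_entropy mu) - sigma| <= err t.
  move=> t01' tK tM; have /andP[t0 t1] := t01'.
  have t01 : 0 <= t <= 1 by rewrite ltW.
  have [L [hL AE]] := speed t t01 tK.
  have ts0 : 0 < t * Num.sqrt t by rewrite mulr_gt0// sqrtr_gt0.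
  (* The time is [n = 2^k], a power of two within a factor 2 of [t^(-3/2)], so that the variance
     bound [hV] is available. *)
  have [|k /andP[nlo nhi]] := @exists_pow2 R (t * Num.sqrt t)^-1.
    rewrite invf_ge1// mulr_ile1 ?sqrtr_ge0//; first exact: ltW.
    by rewrite -sqrtr1 ler_wsqrtr.
  have n0 : (0 < 2 ^ k)%N by rewrite expn_gt0.
  have hn : 1 <= (2 ^ k)%:R * (t * Num.sqrt t) <= 2.
    by rewrite -ler_pdivrMr// mul1r nlo -ler_pdivlMr.
  have vv := chi_le t t01.
  have nv1 := steps_variance t01' n0 hn vv tM.
  rewrite AE0'; apply: (quotient_estimate t01' n0 hn vv (normr_ge0 D1) AE
    (hL _ n0) (hL0 _ n0) (hsigma _ n0)).
  exact: (difference_quotient hP mu_sym gen rho01 hrho len2 (mutP t t01)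
    (hY t t01) (Yle t t01) t0 n0 nu'2 nu'0 nv1 (hV k) V0).
split.
- move=> t t01; have mtP := mutP t t01; have [_ mts _] := mtP.
  have fe n := finite_entropy_pow hP mu_sym gen rho01 hrho n mtP (lent t t01).
  have [C hC] := shannon_le_mean hP mu_sym rho01 hrho gen (@ltr01 R).
  have [fe1 _] := hC _ mtP (integ_le_sqr mts (lent t t01)).
  split; first by rewrite (entropyE mtP fe1) ltry.
  by have [h _ [h1 h2]] := entropy_rate_cvg mtP fe; rewrite h2.
- by rewrite sigmaE.
rewrite sigmaE; apply/cvgrPdist_le => e e0.
have eta_cv : eta @ 0^'+ --> (0 : R).
  exact: l2_error_cvg hP hmu0 mutP mut_supp c0 nu_le ln_le ln_cvg.
have := error_cvg0 (M ^+ 2) (12 * `|D1|) (Num.sqrt V) `|Ks| eta_cv.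
move=> /cvgr0_norm_le /(_ e e0) H.
have := cvg0_scale (2 * M ^+ 2) (cvg0_sqrt right0_id) => /cvgr0_norm_le /(_ 1 ltr01) H1.
have := cvg0_scale M right0_id => /cvgr0_norm_le /(_ K K0) H2.
near=> t.
have t0 : 0 < t by near: t; exact: nbhs_right_gt.
have t1 : t <= 1 by near: t; exact: nbhs_right_le.
rewrite distrC; apply: le_trans (bound t _ _ _) _.
- by rewrite t0.
- by rewrite mulrC; apply: le_trans (ler_norm _) _; near: t.
- by apply: le_trans (ler_norm _) _; near: t.
by apply: le_trans (ler_norm _) _; near: t.
Unshelve. all: by end_near.
Qed.
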